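(* There exists a family of monotone Boolean functions $f$ such that $f$ cannot be computed by monotone circuits of depth polylogarithmic in the input length, but $f$ is computed by a family of circuits of polylogarithmic depth in which at most two internal gates compute functions whose (minimal) orientation is non-zero.
   Context: Circuits have $\land,\lor$ gates of fan-in at most two and $\neg$ gates; monotone circuits have no $\neg$ gates. A Boolean function $f:\{0,1\}^N\to\{0,1\}$ has orientation $\beta\in\{0,1\}^N$ if there is a monotone $h:\{0,1\}^{2N}\to\{0,1\}$ with $f(x)=h(x,x\oplus\beta)$ for all $x$. The minimal orientation of $f$ is unique; it is the zero vector exactly when $f$ is monotone. The orientation of a gate is taken with respect to the inputs of the whole circuit. *)

(* Defs.v *)
From mathcomp Require Import all_boot.

Set Implicit Arguments.
Unset Strict Implicit.
Unset Printing Implicit Defensive.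

Definition boolfun (n : nat) := {ffun n.-tuple bool -> bool}.

Definition bits_le n (x y : n.-tuple bool) : bool :=
  [forall i, tnth x i ==> tnth y i].

Definition xor_bits n (x y : n.-tuple bool) : n.-tuple bool :=
  [tuple tnth x i (+) tnth y i | i < n].

Definition zero_bits n : n.-tuple bool := [tuple of nseq n false].

Definition monotone_fun n (f : boolfun n) : bool :=
  [forall x, forall y, bits_le x y ==> (f x ==> f y)].

Definition has_orientation n (f : boolfun n) (b : n.-tuple bool) : bool :=
  [exists h : boolfun (n + n), monotone_fun h &&
    [forall x : n.-tuple bool, f x == h [tuple of x ++ xor_bits x b]]].

(* Minimality is with respect to the coordinatewise order on {0,1}^n. *)
Definition minimal_orientation n (f : boolfun n) (b : n.-tuple bool) : bool :=
  has_orientation f b &&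
  [forall b', has_orientation f b' ==> bits_le b' b ==> (b' == b)].

Definition nonzero_orientation n (f : boolfun n) : bool :=
  [exists b, minimal_orientation f b && (b != zero_bits n)].

(* A circuit on n inputs is a DAG given in topological order: wires
   0, ..., n - 1 carry the inputs, and wire n + k carries the output of the
   k-th gate, which may only read wires of index less than n + k. A conjunction
   or disjunction reads at most two wires; those reading none are the constants
   true and false, which are therefore available in monotone circuits. *)
Variant gate := And of seq nat | Or of seq nat | Not of nat.

Definition wf_gate (w : nat) (g : gate) : bool :=
  match g with
  | And s | Or s => (size s <= 2) && all (fun i => i < w) s
  | Not i => i < w
  end.

Definition no_gate := And [::].

Record circuit (n : nat) := Circuit {
  gates : seq gate;
  output : nat;
  gates_wf : forall k, k < size gates -> wf_gate (n + k) (nth no_gate gates k);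
  output_wf : output < n + size gates
}.

Definition gate_value (v : seq bool) (g : gate) : bool :=
  match g with
  | And s => all (nth false v) s
  | Or s => has (nth false v) s
  | Not i => ~~ nth false v i
  end.

Definition wire_values n (c : circuit n) (x : n.-tuple bool) : seq bool :=
  foldl (fun v g => rcons v (gate_value v g)) x (gates c).

Definition wire_fun n (c : circuit n) (w : nat) : boolfun n :=
  [ffun x => nth false (wire_values c x) w].

Definition computes n (c : circuit n) (f : boolfun n) : Prop :=
  wire_fun c (output c) = f.

Definition gate_inputs (g : gate) : seq nat :=
  match g with And s | Or s => s | Not i => [:: i] end.

Definition wire_depths n (c : circuit n) : seq nat :=
  foldl (fun d g => rcons d (\max_(i <- gate_inputs g) nth 0 d i).+1)
        (nseq n 0) (gates c).

Definition depth n (c : circuit n) : nat := nth 0 (wire_depths c) (output c).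

Definition is_not (g : gate) : bool := if g is Not _ then true else false.

Definition monotone_circuit n (c : circuit n) : bool :=
  ~~ has is_not (gates c).

Definition nonzero_gates n (c : circuit n) : {set 'I_(size (gates c))} :=
  [set k : 'I_(size (gates c)) | nonzero_orientation (wire_fun c (n + k))].

(* d n = O((log n) ^ e) for some fixed exponent e. *)
Definition polylog (d : nat -> nat) : Prop :=
  exists a e n0 : nat, forall n, n0 <= n -> d n <= a * trunc_log 2 n ^ e.

(* Main.v *)
(** Alice and Bob label the nodes of an expanding, locally tree-like structure
   of cells by polynomials over a large field.  At a cell e Alice's labelling
   has values a, b and Bob's has c, d, and counting labellings yields a target
   beta such that for no pair of labellings a c + b + d = beta_e holds at every
   cell.  An input gives for every cell a set of points (a, b).  The function
   must accept the graph of a labelling of Alice and reject the union of the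
   lines a c + b + d = beta_e of a labelling of Bob.

   Upper bound.  A labelling fitting the input is found by arc consistency: if
   half of the cells determine the value at their tail, the undetermined nodes
   shrink geometrically by expansion.  If half of the cells contain two points,
   these determine Bob's line there, and otherwise half of the cells contain
   one point and determine Alice's values.  The choice between the two searches
   is a threshold, which is all that has to be negated.  The result is monotone
   because no input is fitted by both players.

   Lower bound.  Let Q be the size of the field and m_e = Q [a c + b + d =
   beta_e] - 1.  On a rectangle where cell e never meets its target, the sum of
   the products of the m over all sets of at most s cells telescopes to sets of
   size exactly s, and by Cauchy-Schwarz every such product has tiny sum over
   every rectangle, since small sets of cells are sparse.  Hence a rectangle of
   an input variable has discrepancy at most 8^-s, a formula of depth d has at
   most 2^d 8^-s, and the whole space has at least 1/4. *)
From HB Require Import structures.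
From Stdlib Require Import Classical ClassicalEpsilon.
Require Import Defs.
From mathcomp Require Import all_boot all_order all_algebra all_field zify ring lra.

Set Implicit Arguments.
Unset Strict Implicit.
Unset Printing Implicit Defensive.


(** * Formulas and circuits *)

(** The degree [kappa] of the labelling polynomials is squeezed from two sides. The lower bound
    wants it large: while at most [kappa] half-edges of a set of cells meet at a node, interpolation
    makes their values independent, and small sets of cells always have such a node. The upper bound
    wants it small: a polynomial is known once [kappa] of its values are, and expansion must beat a
    loss of [kappa] cells per node. Moment vectors serve both demands. Any [r] of them are
    independent, which keeps small sets of cells sparse, and each block of [r] of them is a basis,
    which gives expansion. There are two fields: a small one, [Fs], coordinatizes the nodes, and a
    huge one, [F], carries the labels. Its size is exponential in the degree [#|J|], because
    Cauchy-Schwarz gains a factor of order 1/Q only for each cell of a matching, and a matching may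
    hold just one cell in [16 * #|J|]. Still the logarithm of the input length is polynomial in a
    parameter j, whereas sparsity reaches up to sets of 2^(j-2) cells; so monotone depth outgrows
    every power of that logarithm. *)

Inductive mform (n : nat) :=
  | MVar of 'I_n | MTrue | MFalse
  | MAnd of mform n & mform n | MOr of mform n & mform n.

Arguments MTrue {n}.
Arguments MFalse {n}.

Fixpoint feval n (x : n.-tuple bool) (phi : mform n) : bool :=
  match phi with
  | MVar i => tnth x i
  | MTrue => true
  | MFalse => false
  | MAnd a b => feval x a && feval x b
  | MOr a b => feval x a || feval x b
  end.

(** Constants have depth 1 because a circuit realizes them by a gate without inputs, whose depth is
    1. *)
Fixpoint fdepth n (phi : mform n) : nat :=
  match phi with
  | MVar _ => 0
  | MTrue | MFalse => 1
  | MAnd a b | MOr a b => (maxn (fdepth a) (fdepth b)).+1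
  end.

Lemma feval_mono n (x y : n.-tuple bool) (phi : mform n) :
  bits_le x y -> feval x phi -> feval y phi.
Proof.
move=> /forallP xy; elim: phi => //= [i|a IHa b IHb|a IHa b IHb].
- exact/implyP.
- by move=> /andP[/IHa-> /IHb->].
- by case/orP=> [/IHa->|/IHb->]; rewrite ?orbT.
Qed.

Definition gates_values (gs : seq gate) (v : seq bool) : seq bool :=
  foldl (fun v g => rcons v (gate_value v g)) v gs.

Definition gates_depths (gs : seq gate) (v : seq nat) : seq nat :=
  foldl (fun d g => rcons d (\max_(i <- gate_inputs g) nth 0 d i).+1) v gs.

Definition gates_ok n (gs : seq gate) : Prop :=
  forall k, k < size gs -> wf_gate (n + k) (nth no_gate gs k).

Lemma size_gates_values gs v : size (gates_values gs v) = size v + size gs.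
Proof.
elim: gs v => [|g gs IH] v /=; first by rewrite addn0.
by rewrite IH size_rcons addSnnS.
Qed.

Lemma size_gates_depths gs v : size (gates_depths gs v) = size v + size gs.
Proof.
elim: gs v => [|g gs IH] v /=; first by rewrite addn0.
by rewrite IH size_rcons addSnnS.
Qed.

Lemma gates_values_rcons gs g v :
  gates_values (rcons gs g) v =
  rcons (gates_values gs v) (gate_value (gates_values gs v) g).
Proof. by rewrite /gates_values foldl_rcons. Qed.

Lemma gates_depths_rcons gs g v :
  gates_depths (rcons gs g) v =
  rcons (gates_depths gs v)
    (\max_(i <- gate_inputs g) nth 0 (gates_depths gs v) i).+1.
Proof. by rewrite /gates_depths foldl_rcons. Qed.

Lemma gates_ok_rcons n gs g :
  gates_ok n (rcons gs g) <-> gates_ok n gs /\ wf_gate (n + size gs) g.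
Proof.
split=> [ok|[ok wfg] k].
  split=> [k ltk|].
    by have := ok k; rewrite size_rcons nth_rcons ltk => -> //; rewrite ltnS ltnW.
  by have := ok (size gs); rewrite size_rcons nth_rcons ltnn eqxx; apply.
rewrite size_rcons ltnS leq_eqVlt nth_rcons => /orP[/eqP->|ltk].
  by rewrite ltnn eqxx.
by rewrite ltk; apply: ok.
Qed.

(** Unfolding the circuit below a wire duplicates shared gates, which costs size but not depth. *)
Lemma gates_form n gs w :
    gates_ok n gs -> ~~ has is_not gs -> w < n + size gs ->
  exists phi : mform n,
    fdepth phi <= nth 0 (gates_depths gs (nseq n 0)) w /\
    forall x : n.-tuple bool, feval x phi = nth false (gates_values gs x) w.
Proof.
elim/last_ind: gs w => [|gs g IH] w.
  rewrite addn0 => _ _ ltw; exists (MVar (Ordinal ltw)); split=> //= x.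
  by rewrite (tnth_nth false).
rewrite gates_ok_rcons has_rcons negb_or size_rcons addnS ltnS.
move=> [ok wfg] /andP[gm gsm]; rewrite gates_depths_rcons nth_rcons.
rewrite size_gates_depths size_nseq leq_eqVlt => /orP[/eqP->|ltw]; last first.
  have [phi [dphi ephi]] := IH w ok gsm ltw.
  exists phi; rewrite ltw; split=> // x.
  by rewrite gates_values_rcons nth_rcons size_gates_values size_tuple ltw.
rewrite ltnn eqxx.
have valE (x : n.-tuple bool) :
    nth false (gates_values (rcons gs g) x) (n + size gs) =
    gate_value (gates_values gs x) g.
  by rewrite gates_values_rcons nth_rcons size_gates_values size_tuple ltnn eqxx.
case: g gm wfg valE => [s|s|//] _ /=; case: s => [|i [|j [|//]]] /= => [_|/andP[ii _]|/and3P[ii ij _]] valE.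
- by exists MTrue; rewrite big_nil; split=> // x; rewrite valE.
- have [phi [dphi ephi]] := IH i ok gsm ii; exists phi; rewrite big_seq1.
  by split=> [|x]; [exact: leqW | rewrite valE andbT].
- have [phi [dphi ephi]] := IH i ok gsm ii; have [psi [dpsi epsi]] := IH j ok gsm ij.
  exists (MAnd phi psi); rewrite big_cons big_seq1 /=; split=> [|x].
    by rewrite ltnS geq_max !leq_max dphi dpsi orbT.
  by rewrite valE ephi epsi andbT.
- by exists MFalse; rewrite big_nil; split=> // x; rewrite valE.
- have [phi [dphi ephi]] := IH i ok gsm ii; exists phi; rewrite big_seq1.
  by split=> [|x]; [exact: leqW | rewrite valE orbF].
- have [phi [dphi ephi]] := IH i ok gsm ii; have [psi [dpsi epsi]] := IH j ok gsm ij.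
  exists (MOr phi psi); rewrite big_cons big_seq1 /=; split=> [|x].
    by rewrite ltnS geq_max !leq_max dphi dpsi orbT.
  by rewrite valE ephi epsi orbF.
Qed.

Lemma monotone_circuit_form n (c : circuit n) (f : boolfun n) :
    monotone_circuit c -> computes c f ->
  exists2 phi : mform n, fdepth phi <= depth c & forall x, feval x phi = f x.
Proof.
move=> mc <-; have [phi [dphi ephi]] := gates_form (@gates_wf n c) mc (@output_wf n c).
by exists phi => // x; rewrite ephi ffunE.
Qed.

(** Tracked for every gate and not only for the output, because orientations are counted over all
    gates. *)
Definition gates_mono n (gs : seq gate) : Prop :=
  forall k, k < size gs -> exists phi : mform n, forall x : n.-tuple bool,
    nth false (gates_values gs x) (n + k) = feval x phi.

Definition wire_is n gs w (P : n.-tuple bool -> bool) d : Prop :=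
  [/\ w < n + size gs, nth 0 (gates_depths gs (nseq n 0)) w <= d
    & forall x : n.-tuple bool, nth false (gates_values gs x) w = P x].

Lemma wire_is_rcons n gs g w (P : n.-tuple bool -> bool) d :
  wire_is gs w P d -> wire_is (rcons gs g) w P d.
Proof.
case=> ltw dw vw; split=> [||x]; first by rewrite size_rcons addnS ltnS ltnW.
  by rewrite gates_depths_rcons nth_rcons size_gates_depths size_nseq ltw.
by rewrite gates_values_rcons nth_rcons size_gates_values size_tuple ltw.
Qed.

Lemma wire_is_cat n gs gs' w (P : n.-tuple bool -> bool) d :
  wire_is gs w P d -> wire_is (gs ++ gs') w P d.
Proof.
elim/last_ind: gs' => [|gs' g IH]; first by rewrite cats0.
by rewrite -rcons_cat => /IH; apply: wire_is_rcons.
Qed.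

Lemma wire_is_last n gs g (P : n.-tuple bool -> bool) d :
    (\max_(i <- gate_inputs g) nth 0 (gates_depths gs (nseq n 0)) i) < d ->
    (forall x : n.-tuple bool, gate_value (gates_values gs x) g = P x) ->
  wire_is (rcons gs g) (n + size gs) P d.
Proof.
move=> dg vg; split=> [||x]; first by rewrite size_rcons addnS.
  by rewrite gates_depths_rcons nth_rcons size_gates_depths size_nseq ltnn eqxx.
by rewrite gates_values_rcons nth_rcons size_gates_values size_tuple ltnn eqxx.
Qed.

Lemma gates_mono_rcons n gs g (phi : mform n) d :
    gates_mono n gs -> wire_is (rcons gs g) (n + size gs) (fun x => feval x phi) d ->
  gates_mono n (rcons gs g).
Proof.
move=> mg [_ _ vg] k; rewrite size_rcons ltnS leq_eqVlt => /orP[/eqP->|ltk].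
  by exists phi.
have [psi epsi] := mg k ltk; exists psi => x.
by rewrite gates_values_rcons nth_rcons size_gates_values size_tuple ltn_add2l ltk.
Qed.

(** Gates are only appended, so formulas compiled earlier keep their wires and several formulas fit
    into one circuit. *)
Lemma compile_form n (phi : mform n) gs :
    gates_ok n gs -> gates_mono n gs ->
  exists gs' w, [/\ gates_ok n (gs ++ gs'), gates_mono n (gs ++ gs')
    & wire_is (gs ++ gs') w (fun x => feval x phi) (fdepth phi)].
Proof.
elim: phi gs => [i|||a IHa b IHb|a IHa b IHb] gs ok mg.
- exists [::], (val i); rewrite cats0; split=> //; split=> [||x].
  + exact: (leq_trans (ltn_ord i) (leq_addr _ _)).
  + elim/last_ind: {ok mg} gs => [|gs g IH]; first by rewrite /= nth_nseq if_same.
    rewrite gates_depths_rcons nth_rcons size_gates_depths size_nseq.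
    by rewrite (leq_trans (ltn_ord i) (leq_addr _ _)).
  + elim/last_ind: {ok mg} gs => [|gs g IH]; first by rewrite /= (tnth_nth false).
    rewrite gates_values_rcons nth_rcons size_gates_values size_tuple.
    by rewrite (leq_trans (ltn_ord i) (leq_addr _ _)).
- have wl : wire_is (rcons gs (And [::])) (n + size gs) (fun x : n.-tuple bool => feval x MTrue) 1.
    by apply: wire_is_last; rewrite //= big_nil.
  exists [:: And [::]], (n + size gs); rewrite cats1; split=> //.
    by rewrite gates_ok_rcons.
  exact: gates_mono_rcons wl.
- have wl : wire_is (rcons gs (Or [::])) (n + size gs) (fun x : n.-tuple bool => feval x MFalse) 1.
    by apply: wire_is_last; rewrite //= big_nil.
  exists [:: Or [::]], (n + size gs); rewrite cats1; split=> //.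
    by rewrite gates_ok_rcons.
  exact: gates_mono_rcons wl.
- have [gs1 [w1 [ok1 mg1 wl1]]] := IHa gs ok mg.
  have [gs2 [w2 [ok2 mg2 wl2]]] := IHb _ ok1 mg1.
  have {}wl1 := wire_is_cat gs2 wl1.
  set gs3 := (gs ++ gs1) ++ gs2 in ok2 mg2 wl1 wl2.
  have wl : wire_is (rcons gs3 (And [:: w1; w2])) (n + size gs3)
      (fun x => feval x (MAnd a b)) (fdepth (MAnd a b)).
    case: wl1 wl2 => [lt1 d1 v1] [lt2 d2 v2].
    apply: wire_is_last => [|x] /=; last by rewrite v1 v2 andbT.
    by rewrite big_cons big_seq1 ltnS geq_max !leq_max d1 d2 orbT.
  exists (gs1 ++ rcons gs2 (And [:: w1; w2])), (n + size gs3).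
  rewrite catA -rcons_cat -/gs3; split=> //; last exact: gates_mono_rcons wl.
  by rewrite gates_ok_rcons; split=> //=; case: wl1 => ->; case: wl2 => ->.
- have [gs1 [w1 [ok1 mg1 wl1]]] := IHa gs ok mg.
  have [gs2 [w2 [ok2 mg2 wl2]]] := IHb _ ok1 mg1.
  have {}wl1 := wire_is_cat gs2 wl1.
  set gs3 := (gs ++ gs1) ++ gs2 in ok2 mg2 wl1 wl2.
  have wl : wire_is (rcons gs3 (Or [:: w1; w2])) (n + size gs3)
      (fun x => feval x (MOr a b)) (fdepth (MOr a b)).
    case: wl1 wl2 => [lt1 d1 v1] [lt2 d2 v2].
    apply: wire_is_last => [|x] /=; last by rewrite v1 v2 orbF.
    by rewrite big_cons big_seq1 ltnS geq_max !leq_max d1 d2 orbT.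
  exists (gs1 ++ rcons gs2 (Or [:: w1; w2])), (n + size gs3).
  rewrite catA -rcons_cat -/gs3; split=> //; last exact: gates_mono_rcons wl.
  by rewrite gates_ok_rcons; split=> //=; case: wl1 => ->; case: wl2 => ->.
Qed.

(** The zero vector is an orientation, through an [h] that reads only the first copy of the input.
    It lies below every vector, so a minimal orientation must equal it. *)
Lemma monotone_zero_orientation n (f : boolfun n) :
  monotone_fun f -> ~~ nonzero_orientation f.
Proof.
move=> mf; apply/existsP=> -[b /andP[/andP[_ /forallP /(_ (zero_bits n))]]].
have -> : has_orientation f (zero_bits n).
  apply/existsP; exists [ffun z : (n + n).-tuple bool => f [tuple tnth z (lshift n i) | i < n]].
  apply/andP; split.
    apply/forallP=> x; apply/forallP=> y; apply/implyP=> xy; rewrite !ffunE.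
    move/forallP: mf => /(_ [tuple tnth x (lshift n i) | i < n]).
    move/forallP=> /(_ [tuple tnth y (lshift n i) | i < n]) /implyP; apply.
    by apply/forallP=> i; rewrite !tnth_mktuple; move/forallP: xy => /(_ (lshift n i)).
  apply/forallP=> x; rewrite ffunE; apply/eqP; congr (f _).
  by apply: eq_from_tnth => i; rewrite tnth_mktuple tnth_lshift.
have -> : bits_le (zero_bits n) b.
  by apply/forallP=> i; rewrite (tnth_nth false) nth_nseq if_same.
by rewrite eq_sym /= => ->.
Qed.

Lemma form_monotone n (f : boolfun n) (phi : mform n) :
  (forall x, f x = feval x phi) -> monotone_fun f.
Proof.
move=> ef; apply/forallP=> x; apply/forallP=> y; apply/implyP=> xy.
by rewrite !ef; apply/implyP; apply: feval_mono.
Qed.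

(** Three gates follow the monotone part: a negation, a conjunction and a disjunction. The last
    computes the monotone [f] itself, which leaves two gates whose orientation may be non-zero. *)
Lemma one_negation_circuit n (f : boolfun n) (f1 f2 u : mform n) d :
    monotone_fun f -> fdepth f1 <= d -> fdepth f2 <= d -> fdepth u <= d ->
    (forall x, f x = feval x f1 || (feval x f2 && ~~ feval x u)) ->
  exists c : circuit n,
    [/\ depth c <= d + 3, computes c f & #|nonzero_gates c| <= 2].
Proof.
move=> mf d1 d2 du ef.
have [//|//|gs1 [w1 []]] := @compile_form n f1 [::]; rewrite cat0s => ok1 mg1 wl1.
have [gs2 [w2 [ok2 mg2 wl2]]] := compile_form f2 ok1 mg1.
have {}wl1 := wire_is_cat gs2 wl1.
have [gs3 [w3 [ok3 mg3 wl3]]] := compile_form u ok2 mg2.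
have {}wl1 := wire_is_cat gs3 wl1; have {}wl2 := wire_is_cat gs3 wl2.
set gs := (gs1 ++ gs2) ++ gs3 in ok3 mg3 wl1 wl2 wl3.
have wl4 : wire_is (rcons gs (Not w3)) (n + size gs) (fun x => ~~ feval x u) d.+1.
  case: wl3 => lt3 d3 v3; apply: wire_is_last => [|x] /=; last by rewrite v3.
  by rewrite big_seq1 ltnS (leq_trans d3).
have {}wl1 := wire_is_rcons (Not w3) wl1; have {}wl2 := wire_is_rcons (Not w3) wl2.
set gsa := rcons gs (Not w3) in wl4 wl1 wl2.
have sza : size gsa = (size gs).+1 by rewrite size_rcons.
have wl5 : wire_is (rcons gsa (And [:: w2; n + size gs])) (n + size gsa)
    (fun x => feval x f2 && ~~ feval x u) d.+2.
  case: wl2 wl4 => lt2 dd2 v2 [lt4 d4 v4]; apply: wire_is_last => [|x] /=.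
    by rewrite big_cons big_seq1 ltnS geq_max d4 (leq_trans dd2) // (leq_trans d2).
  by rewrite v2 v4 andbT.
have {}wl1 := wire_is_rcons (And [:: w2; n + size gs]) wl1.
set gsb := rcons gsa _ in wl5 wl1.
have szb : size gsb = (size gsa).+1 by rewrite size_rcons.
have wl6 : wire_is (rcons gsb (Or [:: w1; n + size gsa])) (n + size gsb) f d.+3.
  case: wl1 wl5 => lt1 dd1 v1 [lt5 d5 v5]; apply: wire_is_last => [|x] /=.
    by rewrite big_cons big_seq1 ltnS geq_max d5 (leq_trans dd1) // (leq_trans d1) // -addn2 leq_addr.
  by rewrite v1 v5 orbF ef.
set gsc := rcons gsb _ in wl6.
have szc : size gsc = (size gsb).+1 by rewrite size_rcons.
have okc : gates_ok n gsc.
  rewrite /gsc /gsb /gsa; do 3 rewrite gates_ok_rcons.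
  split; [split; [split=> //|]|]; rewrite /wf_gate /= ?andbT.
  - by case: wl3.
  - by case: wl2 => ->; case: wl4 => ->.
  - by case: wl1 => ->; case: wl5 => ->.
have lto : n + size gsb < n + size gsc by rewrite szc addnS.
exists (Circuit okc lto); case: (wl6) => _ d6 v6; split.
- by rewrite addn3.
- by apply/ffunP=> x; rewrite ffunE v6.
have lt1 : size gs < size gsc by rewrite szc szb sza; lia.
have lt2 : size gsa < size gsc by rewrite szc szb; lia.
apply: (@leq_trans #|[set Ordinal lt1; Ordinal lt2]|); last by rewrite cards2; case: eqP.
apply/subset_leq_card/subsetP => k; rewrite !inE => nzk.
apply: contraLR nzk; rewrite negb_or -!val_eqE /= => /andP[nk1 nk2].
apply: monotone_zero_orientation.
have [ltk|lek] := ltnP k (size gs).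
  have [phi ephi] := mg3 k ltk; apply: (@form_monotone _ _ phi) => x.
  rewrite ffunE -ephi /= /wire_values /=.
  have /(@wire_is_rcons n gs (Not w3)) : wire_is gs (n + k)
      (fun x : n.-tuple bool => nth false (gates_values gs x) (n + k))
      (nth 0 (gates_depths gs (nseq n 0)) (n + k)).
    by split=> //; rewrite ltn_add2l.
  move/(@wire_is_rcons n _ (And [:: w2; n + size gs])).
  by move/(@wire_is_rcons n _ (Or [:: w1; n + size gsa])) => [_ _ ->].
have ek : k = size gsb :> nat.
  have ltk : (k : nat) < size gsc := ltn_ord k.
  by move: (nat_of_ord k) nk1 nk2 lek ltk => m; lia.
suff -> : wire_fun (Circuit okc lto) (n + k) = f by [].
by apply/ffunP=> x; rewrite ffunE ek v6.
Qed.

(** * Moment vectors: independence, sparse neighbourhoods, expansion *)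

Section Geometry.
Import GRing.Theory.

Section Moment.
Local Open Scope ring_scope.
Variables (F : fieldType) (r : nat).

Definition moment (t : F) : 'rV[F]_r := \row_k t ^+ k.

(** Vandermonde: the polynomial vanishing at all other points of the support has degree below [r],
    and pairing the combination with its coefficients isolates the term of [s0]. *)
Lemma moment_free (T : finType) (t : T -> F) (c : T -> F) :
    injective t -> (#|[set s | c s != 0%R]| <= r)%N ->
  \sum_s c s *: moment (t s) = 0 -> forall s, c s = 0.
Proof.
move=> t_inj supp_le sum0 s0; apply/eqP/negPn/negP => c0.
pose p := \prod_(s in [set s | c s != 0] :\ s0) ('X - (t s)%:P).
have sz_p : (size p <= r)%N.
  rewrite /p -big_enum size_prod_XsubC -cardE (leq_trans _ supp_le) //.
  by rewrite [X in (_ <= X)%N](cardsD1 s0) inE c0.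
have E : \sum_s c s * p.[t s] = \sum_(k < r) p`_k * (\sum_s c s *: moment (t s)) 0 k.
  under eq_bigr => s _ do rewrite (horner_coef_wide _ sz_p) big_distrr /=.
  rewrite exchange_big; apply: eq_bigr => k _.
  rewrite summxE big_distrr; apply: eq_bigr => s _ /=.
  by rewrite !mxE mulrCA.
move: E; rewrite sum0 (bigD1 s0) //= [X in _ + X]big1 => [|s ns]; last first.
  have [->|cs] := eqVneq (c s) 0; first by rewrite mul0r.
  by rewrite /p horner_prod (bigD1 s) /= ?inE ?ns // hornerXsubC subrr mul0r mulr0.
rewrite addr0 [X in _ = X]big1 => [|k _]; last by rewrite mxE mulr0.
move/eqP; rewrite mulf_eq0 (negPf c0) /= horner_prod => /prodf_eq0[s].
by rewrite !inE => /andP[ns _]; rewrite hornerXsubC subr_eq0 (inj_eq t_inj) eq_sym (negPf ns).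
Qed.

(** Row vectors are the words of a Reed-Solomon code: polynomials of degree below [r], seen through
    their values. *)
Definition ev (g : 'rV[F]_r) (x : F) : F := (rVpoly g).[x].

Lemma evD g h x : ev (g + h) x = ev g x + ev h x.
Proof. by rewrite /ev raddfD hornerD. Qed.

Lemma evZ a g x : ev (a *: g) x = a * ev g x.
Proof. by rewrite /ev linearZ /= hornerZ. Qed.

Lemma ev_eq (T : finType) (A : {set T}) (t : T -> F) (g h : 'rV[F]_r) :
    {in A &, injective t} -> (r <= #|A|)%N -> {in A, forall s, ev g (t s) = ev h (t s)} ->
  g = h.
Proof.
move=> t_inj rA gh; apply/eqP; rewrite -subr_eq0; apply/eqP/(can_inj rVpolyK).
rewrite raddf0; apply/eqP/negPn/negP => nz.
have := max_poly_roots nz (rs := [seq t s | s in A]).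
have -> : all (root (rVpoly (g - h))) [seq t s | s in A].
  apply/allP => _ /imageP[s sA ->]; rewrite /root.
  by rewrite -[_.[_]]/(ev _ _) evD -scaleN1r evZ gh // mulN1r subrr.
rewrite map_inj_in_uniq ?enum_uniq; last by move=> s s'; rewrite !mem_enum; apply: t_inj.
rewrite size_map -cardE => /(_ isT isT); rewrite ltnNge => /negP; apply.
by apply: leq_trans rA; apply: size_poly.
Qed.

Lemma ev_unit (T : finType) (A : {set T}) (t : T -> F) x :
    (#|A| < r)%N -> {in A, forall s, t s != x} ->
  exists g : 'rV[F]_r, ev g x = 1 /\ {in A, forall s, ev g (t s) = 0}.
Proof.
move=> Ar tx; pose p := \prod_(s in A) ('X - (t s)%:P).
have px : p.[x] != 0.
  rewrite horner_prod; apply/prodf_neq0 => s sA.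
  by rewrite hornerXsubC subr_eq0 eq_sym tx.
exists (poly_rV (p.[x]^-1 *: p)).
have K : rVpoly (poly_rV (p.[x]^-1 *: p) : 'rV_r) = p.[x]^-1 *: p.
  apply: poly_rV_K; rewrite (leq_trans (size_scale_leq _ _)) //.
  by rewrite /p -big_enum size_prod_XsubC -cardE.
rewrite /ev K; split=> [|s sA]; first by rewrite hornerZ mulVf.
rewrite hornerZ; suff -> : p.[t s] = 0 by rewrite mulr0.
by rewrite horner_prod (bigD1 s) //= hornerXsubC subrr mul0r.
Qed.
End Moment.

(** * Sparse vertices of small sets of nodes *)

Section Sparse.
Local Open Scope ring_scope.
Variables (F : finFieldType) (r : nat) (I : finType) (t : I * 'I_3 -> F).
Hypothesis t_inj : injective t.
Implicit Types (P Z : {set 'rV[F]_r}) (w : {ffun I * 'I_3 -> F}).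

Definition comb w : 'rV[F]_r := \sum_s w s *: moment r (t s).
(** Supports are counted in indices. Each index carries three moment vectors, whence the factor 3 in
    [comb_inj]. *)
Definition isupp w : {set I} := [set i | [exists c, w (i, c) != 0]].
Definition istep i (v : 'rV[F]_r) := [exists w, (isupp w == [set i]) && (v == comb w)].

Lemma combD w w' : comb (w + w') = comb w + comb w'.
Proof. by rewrite -big_split; apply: eq_bigr => s _; rewrite ffunE scalerDl. Qed.

Lemma combB w w' : comb (w - w') = comb w - comb w'.
Proof. by rewrite -sumrB; apply: eq_bigr => s _; rewrite !ffunE scalerBl. Qed.

Lemma comb_inj w w' :
  (3 * #|isupp w :|: isupp w'| <= r)%N -> comb w = comb w' -> w = w'.
Proof.
move=> le_r /eqP; rewrite -subr_eq0 -combB => /eqP c0.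
apply/ffunP => s; apply/eqP; rewrite -subr_eq0; apply/eqP.
have := @moment_free _ r _ t (w - w') t_inj _ c0 s; rewrite !ffunE; apply.
apply: leq_trans le_r.
have -> : (3 * #|isupp w :|: isupp w'| = #|setX (isupp w :|: isupp w') [set: 'I_3]|)%N.
  by rewrite cardsX cardsT card_ord mulnC.
apply/subset_leq_card/subsetP => -[i c]; rewrite !inE !ffunE /= andbT.
apply: contraR; rewrite negb_or !negb_exists => /andP[/forallP/(_ c)/negPn/eqP-> /forallP/(_ c)/negPn/eqP->].
by rewrite subrr.
Qed.

Definition idx P p := [set i | [exists p' in P, istep i (p' - p)]].

(* Each of the two chosen neighbours starts a subtree avoiding both branching
   directions, so independence of the moments keeps the subtrees disjoint. *)
Lemma binary_tree P j rho p (Ex : {set I}) :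
    (6 * j <= r)%N -> (forall q, q \in P -> (2 * j <= #|idx P q|)%N) ->
    p \in P -> (#|Ex| + 2 * rho <= 2 * j)%N ->
  exists2 Z : {set 'rV[F]_r}, Z \subset P /\ #|Z| = (2 ^ rho)%N & forall z, z \in Z -> exists w,
    [/\ z = p + comb w, [disjoint isupp w & Ex] & (#|isupp w| <= rho)%N].
Proof.
move=> jr Pj; elim: rho p Ex => [|rho IH] p Ex pP Exle.
  exists [set p]; first by rewrite sub1set cards1.
  move=> z /set1P->; exists 0.
  have s0 : isupp 0 = set0.
    by apply/setP=> i; rewrite !inE; apply/existsP=> -[c]; rewrite ffunE eqxx.
  split; [|by rewrite s0 disjoints_subset sub0set|by rewrite s0 cards0].
  by rewrite /comb big1 ?addr0 // => s _; rewrite ffunE scale0r.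
have : (1 < #|idx P p :\: Ex|)%N.
  have := Pj p pP; rewrite -(cardsID Ex (idx P p)).
  have := subset_leq_card (subsetIr (idx P p) Ex); lia.
case/card_gt1P=> i [i' []]; rewrite !inE.
move=> /andP[iEx /existsP[p1 /andP[p1P /existsP[w1 /andP[/eqP sw1 /eqP ew1]]]]].
move=> /andP[i'Ex /existsP[p2 /andP[p2P /existsP[w2 /andP[/eqP sw2 /eqP ew2]]]]] nii'.
pose Ex' := i |: (i' |: Ex).
have Ex'le : (#|Ex'| + 2 * rho <= 2 * j)%N.
  rewrite /Ex' !cardsU1; move: Exle; case: (_ \notin _); case: (_ \notin _); lia.
have [Z1 [Z1P Z1c] HZ1] := IH p1 Ex' p1P Ex'le.
have [Z2 [Z2P Z2c] HZ2] := IH p2 Ex' p2P Ex'le.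
have key q wq i0 Z : isupp wq = [set i0] -> i0 \notin Ex -> i0 \in Ex' -> q - p = comb wq ->
   (forall z, z \in Z -> exists w, [/\ z = q + comb w, [disjoint isupp w & Ex'] & (#|isupp w| <= rho)%N]) ->
   forall z, z \in Z -> exists w, [/\ z = p + comb w, [disjoint isupp w & Ex] & (#|isupp w| <= rho.+1)%N] /\
    (isupp w :&: Ex' = [set i0]).
  move=> swq i0Ex i0Ex' ewq HZ z /HZ[w [-> dw cw]]; exists (wq + w).
  have ss : isupp (wq + w) = i0 |: isupp w.
    apply/setP=> k; rewrite inE in_setU1 -in_set1 -swq.
    have [kEx|kEx] := boolP (k \in isupp w).
      rewrite orbT; move: (kEx); rewrite inE => /existsP[c wc]; apply/existsP; exists c.
      suff -> : (wq + w) (k, c) = w (k, c) by [].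
      rewrite ffunE; suff -> : wq (k, c) = 0 by rewrite add0r.
      apply/eqP; have : k \notin isupp wq.
        by rewrite swq inE; apply: contraTneq kEx => ->; rewrite (disjointFl dw).
      by rewrite inE negb_exists => /forallP/(_ c)/negPn.
    rewrite orbF inE; apply: eq_existsb => c.
    move: kEx; rewrite inE negb_exists => /forallP/(_ c)/negPn/eqP w0.
    by rewrite ffunE w0 addr0.
  have i0w : i0 \notin isupp w by rewrite (disjointFl dw).
  split; [split|].
  - by rewrite combD -ewq addrA [p + _]addrC subrK.
  - rewrite ss disjoints_subset subUset sub1set inE i0Ex /= -disjoints_subset.
    by apply: disjointWr dw; rewrite /Ex' !setUA subsetUr.
  - by rewrite ss cardsU1 i0w add1n ltnS.
  - rewrite ss setIUl (setIidPl _) ?sub1set //.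
    by move: dw; rewrite -setI_eq0 => /eqP->; rewrite setU0.
have K1 := key _ _ _ _ sw1 iEx _ ew1 HZ1; have K2 := key _ _ _ _ sw2 i'Ex _ ew2 HZ2.
rewrite /Ex' !inE eqxx /= in K1; rewrite /Ex' !inE eqxx orbT /= in K2.
have {}K1 := K1 isT; have {}K2 := K2 isT.
(* A common point would have two expressions using at most [2 * j] indices in all, which agree by
   [comb_inj]. But one meets [Ex'] in [i] alone and the other in [i'] alone. *)
have d12 : Z1 :&: Z2 = set0.
  apply/setP=> z; rewrite !inE; apply/andP=> -[/K1[u [[-> _ cu] su]] /K2[v [[ezv _ cv] sv]]].
  move/addrI: ezv => /comb_inj uv.
  have {uv}: u = v.
    apply: uv; rewrite (leq_trans (leq_mul (leqnn 3) (leq_card_setU _ _))) //.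
    by move: cu cv; lia.
  move=> uv; move: su; rewrite uv sv => /setP/(_ i); rewrite !inE eqxx => /eqP ii'.
  by rewrite ii' eqxx in nii'.
exists (Z1 :|: Z2).
  by rewrite subUset Z1P Z2P cardsU d12 cards0 subn0 Z1c Z2c addnn -mul2n expnS.
by move=> z /setUP[/K1|/K2] [w [Hw _]]; exists w.
Qed.

(** Otherwise a binary tree of depth [j], with [2 ^ j] distinct points, would fit into [P]. *)
Lemma sparse_vertex P j :
    (6 * j <= r)%N -> P != set0 -> (#|P| < 2 ^ j)%N ->
  exists2 p, p \in P & (#|idx P p| < 2 * j)%N.
Proof.
move=> jr /set0Pn[p0 p0P] cP.
case: (boolP [exists p in P, #|idx P p| < 2 * j]%N) => [/existsP[p /andP[pP ip]]|].
  by exists p.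
rewrite negb_exists => /forallP nP.
have [q qP||Z [ZP cZ] _] := @binary_tree P j j p0 set0 jr _ p0P.
- by have := nP q; rewrite qP /= -leqNgt.
- by rewrite cards0.
by have := subset_leq_card ZP; rewrite cZ leqNgt cP.
Qed.

Definition nzF := {w : F | w != 0}.
Definition cell := ('rV[F]_r * (I * nzF))%type.

(* The ports (side, role) of the cell (x, (i, w)), with side true for Alice and
   role true for the tail, lie at offset 0 and w v_0 from x for Bob and at offset
   v_1 and v_1 + w v_2 for Alice, where v_c = moment (t (i, c)). *)
Definition pcoef (p : bool * bool) (w : F) (c : 'I_3) : F :=
  match nat_of_ord c with
  | 0 => if ~~ p.1 && ~~ p.2 then w else 0
  | 1 => if p.1 then 1 else 0
  | _ => if p.1 && ~~ p.2 then w else 0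
  end.

Definition pshift (p : bool * bool) (k : I * nzF) : {ffun I * 'I_3 -> F} :=
  [ffun s => if s.1 == k.1 then pcoef p (val k.2) s.2 else 0].

Definition node (p : bool * bool) (e : cell) : 'rV[F]_r := e.1 + comb (pshift p e.2).

(** Hence any two ports of a cell in [P], of whatever player and role, are seen by [idx P] at each
    of them. *)
Lemma node_istep p p' e : p != p' -> istep e.2.1 (node p e - node p' e).
Proof.
move=> npp'; apply/existsP; exists (pshift p e.2 - pshift p' e.2).
rewrite /node opprD addrACA subrr add0r combB eqxx andbT.
apply/eqP/setP=> i; rewrite !inE.
apply/existsP/eqP => [[c]|->].
  by rewrite !ffunE /=; case: (i =P e.2.1) => // _; rewrite subrr eqxx.
case: p p' npp' => [s q] [s' q'] npp'.
have [ss|ss] := eqVneq s s'; last first.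
  exists (inord 1); rewrite !ffunE eqxx /pcoef inordK //=.
  by case: s s' ss {npp'} => [] [] //= _; rewrite ?subr0 ?sub0r ?oppr_eq0 oner_eq0.
have {npp'}qq : q != q' by move: npp'; rewrite ss xpair_eqE eqxx.
subst s'; exists (inord (if s then 2 else 0)); rewrite !ffunE eqxx /pcoef inordK; last by case: s.
have wn := valP e.2.2.
by case: s q q' qq => [] [] [] //= _; rewrite ?subr0 ?sub0r ?oppr_eq0.
Qed.

Lemma istep_neq0 i : (3 <= r)%N -> ~~ istep i 0.
Proof.
move=> r3; apply/existsP=> -[w /andP[/eqP sw /eqP w0]].
have s0 : isupp 0 = set0.
  by apply/setP=> k; rewrite !inE; apply/existsP=> -[c]; rewrite ffunE eqxx.
have : w = 0.
  apply: comb_inj; first by rewrite sw s0 setU0 cards1.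
  by rewrite -w0 /comb big1 // => s _; rewrite ffunE scale0r.
by move=> w00; move: sw; rewrite w00 s0 => /setP/(_ i); rewrite !inE eqxx.
Qed.

Lemma node_inj p p' e : (3 <= r)%N -> node p e = node p' e -> p = p'.
Proof.
move=> r3 epp; apply/eqP/negPn/negP => /(@node_istep _ _ e).
by rewrite epp subrr (negPf (istep_neq0 _ r3)).
Qed.

Lemma node_head s (e : cell) :
  node (s, false) e = node (s, true) e + val e.2.2 *: moment r (t (e.2.1, inord (if s then 2 else 0))).
Proof.
rewrite /node -addrA; congr (_ + _).
pose c : 'I_3 := inord (if s then 2 else 0).
have -> : pshift (s, false) e.2 = pshift (s, true) e.2 + [ffun u => if u == (e.2.1, c) then val e.2.2 else 0].
  apply/ffunP=> -[i d]; rewrite !ffunE xpair_eqE /=; case: eqP => //= _; last by rewrite addr0.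
  have -> : (d == c) = (d == (if s then 2 else 0) :> nat) by rewrite -val_eqE /= inordK //; case: s {c}.
  by rewrite /pcoef; case: d => -[|[|[|d]]] //= _; case: s {c} => /=; rewrite ?addr0 ?add0r.
rewrite combD; congr (_ + _); rewrite /comb (bigD1 (e.2.1, c)) //= big1 ?addr0 => [|u /negPf nu].
  by rewrite ffunE eqxx.
by rewrite ffunE nu scale0r.
Qed.

Definition crowded P p := [set q : cell * (bool * bool) |
  (node q.2 q.1 == p) && [exists p', (p' != q.2) && (node p' q.1 \in P)]].

(** A cell with a given port at [p] is determined by its index and multiplier, and its second port
    in [P] puts the index into [idx P p]. The 4 counts the kinds of port. *)
Lemma card_crowded P p : p \in P -> (#|crowded P p| <= 4 * #|F| * #|idx P p|)%N.
Proof.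
move=> pP; pose h (q : cell * (bool * bool)) := (q.1.2.1, (val q.1.2.2, q.2)).
have hinj : {in crowded P p &, injective h}.
  move=> [[x [i w]] q] [[x' [i' w']] q']; rewrite !inE /h /=.
  move=> /andP[/eqP e1 _] /andP[/eqP e2 _] [ii ww qq]; subst i' q'.
  move/val_inj: ww => ww; subst w'.
  by move: e1; rewrite -e2 /node /= => /addIr->.
rewrite -(card_in_imset hinj).
apply: (@leq_trans #|setX (idx P p) [set: F * (bool * bool)]|); last first.
  rewrite cardsX cardsT !card_prod card_bool.
  by move: #|F| #|idx P p| => a b; nia.
apply/subset_leq_card/subsetP=> _ /imsetP[[e q] + ->]; rewrite !inE /= andbT.
move=> /andP[/eqP eq_p /existsP[q' /andP[nq eP]]].
by apply/existsP; exists (node q' e); rewrite eP /= -eq_p node_istep.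
Qed.

(** Deleting a sparse vertex destroys only the cells crowded at it, and what remains is again
    small. *)
Lemma two_ports P j :
    (6 * j <= r)%N -> (#|P| < 2 ^ j)%N ->
  (#|[set e : cell | [exists p, exists p', [&& p != p', node p e \in P & node p' e \in P]]]|
     <= 8 * j * #|F| * #|P|)%N.
Proof.
move=> jr; move: {2}#|P| (leqnn #|P|) => k; elim: k P => [|k IH] P Pk cP.
  move: Pk; rewrite leqn0 cards_eq0 => /eqP->; rewrite eq_card0 // => e.
  by rewrite !inE; apply/existsP=> -[p /existsP[p']]; rewrite !inE /= andbF.
have [->|P0] := eqVneq P set0.
  rewrite eq_card0 // => e.
  by rewrite !inE; apply/existsP=> -[p /existsP[p']]; rewrite !inE /= andbF.
have [p pP ip] := sparse_vertex jr P0 cP.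
have cPp := cardsD1 p P; rewrite pP /= in cPp.
have /IH : (#|P :\ p| <= k)%N by rewrite -ltnS -add1n -cPp.
have -> : (#|P :\ p| < 2 ^ j)%N by apply: leq_ltn_trans cP; rewrite cPp leq_addl.
move=> /(_ isT) {}IH.
set T := [set e | _] in IH; set T' := [set e | _].
have sub : T' \subset T :|: [set q.1 | q in crowded P p].
  apply/subsetP=> e; rewrite !inE => /existsP[q /existsP[q' /and3P[nq qP q'P]]].
  have [eqp|nqp] := eqVneq (node q e) p.
    apply/orP; right; apply/imsetP; exists (e, q) => //; rewrite inE /= eqp eqxx /=.
    by apply/existsP; exists q'; rewrite eq_sym nq.
  have [eqp|nq'p] := eqVneq (node q' e) p.
    apply/orP; right; apply/imsetP; exists (e, q') => //; rewrite inE /= eqp eqxx /=.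
    by apply/existsP; exists q; rewrite nq.
  apply/orP; left; apply/existsP; exists q; apply/existsP; exists q'.
  by rewrite !inE nq nqp nq'p qP q'P.
have c1 := leq_trans (subset_leq_card sub) (leq_card_setU _ _).
have c2 : (#|[set q.1 | q in crowded P p]| <= #|crowded P p|)%N by apply: leq_imset_card.
have c3 : (4 * #|F| * #|idx P p| <= 4 * #|F| * (2 * j))%N by rewrite leq_mul2l ltnW ?orbT.
have c4 : (8 * j * #|F| * (1 + #|P :\ p|) = 8 * j * #|F| * #|P :\ p| + 4 * #|F| * (2 * j))%N by lia.
rewrite cPp c4; apply: (leq_trans c1); apply: leq_add => //.
exact: leq_trans (leq_trans c2 (card_crowded pP)) c3.
Qed.
End Sparse.

(** * Cuts and expansion of the Cayley graph *)

Section Cut.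
Local Open Scope ring_scope.
Variable V : finZmodType.
Implicit Types (Z : {set V}) (v : V).

Definition cut Z v := #|[set z in Z | z + v \notin Z]|.

Lemma cutD Z u v : (cut Z (u + v)%R <= cut Z u + cut Z v)%N.
Proof.
rewrite /cut -(card_imset [set z in Z | z + v \notin Z] (@addIr _ (- u))).
apply: leq_trans (leq_card_setU _ _); apply/subset_leq_card/subsetP=> z.
rewrite !inE => /andP[zZ nz]; rewrite zZ /=.
have [zu|//] := boolP (z + u \in Z); rewrite orFb.
by apply/imsetP; exists (z + u); rewrite ?addrK // inE zu -addrA.
Qed.

Lemma cut0 Z : cut Z 0 = 0%N.
Proof. by apply: eq_card0 => z; rewrite !inE addr0; case: (z \in Z). Qed.

Lemma cut_sum Z n (v : 'I_n -> V) : (cut Z (\sum_i v i)%R <= \sum_i cut Z (v i))%N.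
Proof.
elim/big_rec2: _ => [|i m u _ IH]; first by rewrite cut0.
by rewrite (leq_trans (cutD _ _ _)) // leq_add2l.
Qed.

Lemma sum_cut Z : (\sum_v cut Z v = #|Z| * #|~: Z|)%N.
Proof.
have -> : (\sum_v cut Z v = \sum_v \sum_(z in Z) ((z + v)%R \notin Z))%N.
  apply: eq_bigr => v _; rewrite /cut -sum1_card big_mkcond [RHS]big_mkcond.
  by apply: eq_bigr => z _; rewrite inE; case: (z \in Z); case: (_ \notin Z).
rewrite exchange_big -sum_nat_const; apply: eq_bigr => z _.
rewrite (reindex (fun u => u - z)) /=; last first.
  by exists (fun u => u + z) => u _; rewrite ?subrK ?addrK.
rewrite -sum1_card [RHS]big_mkcond; apply: eq_bigr => u _.
by rewrite addrC subrK inE; case: (_ \notin Z).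
Qed.
End Cut.

Section Expansion.
Local Open Scope ring_scope.
Variables (F : finFieldType) (r K : nat) (t : 'I_K * 'I_r -> F).
Hypothesis t_inj : injective t.
Implicit Types (Z : {set 'rV[F]_r}) (v : 'rV[F]_r).

Lemma sum_coord (g : F -> nat) (l : 'I_r) :
  (#|F| * \sum_(w : 'rV[F]_r) g (w 0%R l) = #|{: 'rV[F]_r}| * \sum_a g a)%N.
Proof.
have : (\sum_(a : F) \sum_(w : 'rV[F]_r) g (w 0%R l + a)%R =
        \sum_(a : F) \sum_(w : 'rV[F]_r) g (w 0%R l))%N.
  apply: eq_bigr => a _; rewrite [RHS](reindex (fun w => w + a *: delta_mx 0 l)).
    by apply: eq_bigr => w _; rewrite !mxE !eqxx mulr1.
  by exists (fun w => w - a *: delta_mx 0 l) => w _; rewrite ?addrK ?subrK.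
rewrite sum_nat_const => <-; rewrite exchange_big /= -sum_nat_const.
apply: eq_bigr => w _; rewrite [RHS](reindex (fun a => w 0 l + a)) //=.
by exists (fun a => - w 0 l + a) => a _; rewrite addrA ?subrr ?addNr add0r.
Qed.

(** For each [k] the [r] moments form a basis, so a uniform vector is a sum of uniformly scaled
    generators. Subadditivity then bounds its average cut, known from [sum_cut], by the cuts along
    generators; the [K] bases are added up. *)
Lemma expansion Z :
  (K * #|F| * (#|Z| * #|~: Z|) <=
   #|{: 'rV[F]_r}| * \sum_i \sum_(a : F) cut Z (a *: moment r (t i))%R)%N.
Proof.
have -> : (\sum_i \sum_(a : F) cut Z (a *: moment r (t i)) =
  \sum_(k < K) \sum_(l < r) \sum_(a : F) cut Z (a *: moment r (t (k, l)))%R)%N.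
  rewrite [RHS](pair_bigA _ (fun k l => \sum_(a : F) cut Z (a *: moment r (t (k, l)))%R))%N /=.
  by apply: eq_bigr => -[].
rewrite big_distrr /= -mulnA -{1}[K]card_ord -sum_nat_const; apply: leq_sum => k _.
pose phi (w : 'rV[F]_r) : 'rV[F]_r := \sum_l w 0 l *: moment r (t (k, l)).
have phi_inj : injective phi.
  move=> w w' /eqP; rewrite -subr_eq0 => /eqP ww.
  apply/rowP=> l; apply/eqP; rewrite -subr_eq0; apply/eqP.
  apply: (@moment_free _ r _ (fun l => t (k, l)) (fun l => w 0 l - w' 0 l)).
  - by move=> l1 l2 /t_inj[].
  - by rewrite -[X in (_ <= X)%N]card_ord max_card.
  by rewrite -[RHS]ww /phi -sumrB; apply: eq_bigr => l' _; rewrite scalerBl.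
rewrite big_distrr /=; rewrite -sum_cut (reindex phi) /=; last first.
  by apply: onW_bij; apply: injF_bij.
have step w : (cut Z (phi w) <= \sum_l cut Z (w 0%R l *: moment r (t (k, l)))%R)%N.
  exact: cut_sum.
apply: (@leq_trans (#|F| * \sum_(w : 'rV[F]_r) \sum_l cut Z (w 0%R l *: moment r (t (k, l)))%R)%N).
  by rewrite leq_mul2l leq_sum ?orbT.
rewrite exchange_big big_distrr /=; apply: leq_sum => l _.
by rewrite (sum_coord (fun a => cut Z (a *: moment r (t (k, l))%R))).
Qed.
End Expansion.
End Geometry.

(** * Arc consistency percolates *)

Section ArcConsistency.
Import GRing.Theory.

Lemma card_pairs (T U : finType) (A : {set T * U}) :
  #|A| = \sum_z #|[set j | (z, j) \in A]|.
Proof.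
transitivity (\sum_z \sum_j (if (z, j) \in A then 1 else 0)).
  by rewrite pair_bigA -sum1_card big_mkcond; apply: eq_bigr => -[].
by apply: eq_bigr => z _; rewrite -sum1_card [RHS]big_mkcond; apply: eq_bigr => j _; rewrite inE.
Qed.

(** By Bernoulli (1 + 1/c)^c is at least 2, so every [c] steps halve the sequence. *)
Lemma geom_halving (a : nat -> nat) c tau :
    0 < c -> (forall k, (c.+1) * a k.+1 <= c * a k) -> a 0 < 2 ^ tau -> a (c * tau) = 0.
Proof.
move=> c0 step.
have iter_step k t : c.+1 ^ t * a (k + t) <= c ^ t * a k.
  elim: t => [|t IH]; first by rewrite addn0.
  rewrite !expnS -!mulnA addnS; have := step (k + t).
  move: IH; set x := c.+1 ^ t; set y := c ^ t; nia.
have two : 2 * c ^ c <= c.+1 ^ c.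
  have bern n : c ^ n * c + n * c ^ n <= c.+1 ^ n * c.
    elim: n => [|n IH]; first by rewrite !expn0; lia.
    by rewrite !expnS; move: IH; set x := c ^ n; set y := c.+1 ^ n; nia.
  by have := bern c; set x := c ^ c; set y := c.+1 ^ c; nia.
have half k : 2 * a (k + c) <= a k.
  have := iter_step k c; have : 0 < c ^ c by rewrite expn_gt0 c0.
  move: two; set x := c ^ c; set y := c.+1 ^ c; nia.
have halves t : 2 ^ t * a (c * t) <= a 0.
  elim: t => [|t IH]; first by rewrite muln0 mul1n.
  rewrite expnS mulnS addnC; have := half (c * t); move: IH; set x := 2 ^ t; nia.
by move=> a0; have := halves tau; move: a0; set x := 2 ^ tau; nia.
Qed.

Section Percolation.
Local Open Scope ring_scope.
Variables (V : finZmodType) (J G : finType) (A : eqType).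
Variables (st : J -> V) (gv : G -> J -> bool -> A) (comp : V -> J -> A -> A -> bool).

(* The word g at z survives k rounds of arc consistency; a word is only tested
   against the cells whose tail is z. *)
Fixpoint keep k z g : bool :=
  if k is k'.+1 then
    keep k' z g &&
    [forall j, [exists g', keep k' (z + st j)%R g' && comp z j (gv g j true) (gv g' j false)]]
  else true.

Definition solution (s : V -> G) :=
  forall z j, comp z j (gv (s z) j true) (gv (s (z + st j)%R) j false).

Lemma keep_solution s : solution s -> forall k z, keep k z (s z).
Proof.
move=> sol; elim=> //= k IH z; rewrite IH /=.
by apply/forallP=> j; apply/existsP; exists (s (z + st j)%R); rewrite IH sol.
Qed.

Variables (kappa m r tau : nat) (Sg : {set V * J}).
Hypothesis gv_eq : forall g g' (B : {set J}), (kappa <= #|B|)%N ->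
  {in B, forall j, gv g j true = gv g' j true} -> g = g'.
Hypothesis comp_head : forall z j a a' b, comp z j a b -> comp z j a' b -> a = a'.
Hypothesis comp_single : forall z j a a' b b',
  (z, j) \in Sg -> comp z j a b -> comp z j a' b' -> a = a'.
Hypothesis half_single : (#|V| * #|J| <= 2 * #|Sg|)%N.
Hypothesis J0 : (0 < #|J|)%N.
Hypothesis kappaJ : (4 * kappa <= #|J|)%N.
Hypothesis kappam : (6 * kappa <= m)%N.
Hypothesis m0 : (0 < m)%N.
Hypothesis r0 : (0 < r)%N.
Hypothesis Jm : (#|J| <= r * m)%N.
Hypothesis cut_large : forall Z : {set V},
  (m * (#|Z| * #|~: Z|) <= #|V| * \sum_j cut Z (st j))%N.
Hypothesis Vtau : (#|V| < 2 ^ tau)%N.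

Let Z k := [set z | (1 < #|[set g | keep k z g]|)%N].

(** Two survivors agree at a cell of [Sg], and also at a cell whose head has at most one survivor,
    where the head value fixes the tail value. With [kappa] agreements they would be equal. *)
Lemma unsolved_degree k z :
  z \in Z k.+1 -> (#|[set j | ((z, j) \in Sg) || ((z + st j)%R \notin Z k)]| < kappa)%N.
Proof.
rewrite inE => /card_gt1P[g [g' []]]; rewrite !inE => kg kg'.
rewrite ltnNge; apply: contra => /gv_eq E; apply/eqP/E => j; rewrite inE.
case/andP: kg => _ /forallP/(_ j)/existsP[h /andP[kh ch]].
case/andP: kg' => _ /forallP/(_ j)/existsP[h' /andP[kh' ch']].
case/orP=> [/comp_single|]; first by apply; eassumption.
rewrite inE -leqNgt => /card_le1_eqP/(_ h h'); rewrite !inE => /(_ kh kh') hh.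
by rewrite hh in ch'; exact: comp_head ch ch'.
Qed.

Lemma unsolvedS k : Z k.+1 \subset Z k.
Proof.
apply/subsetP=> z; rewrite !inE => /leq_trans; apply.
by apply/subset_leq_card/subsetP=> g; rewrite !inE => /andP[].
Qed.

(** An unsolved node has at least three quarters of its cells outside [Sg], and these are at most
    half of all cells. A start bounded away from all of [V] is what expansion needs. *)
Lemma unsolved1 : (3 * #|Z 1| <= 2 * #|V|)%N.
Proof.
have le1 : (#|Z 1| * (#|J| - kappa) <= #|~: Sg|)%N.
  rewrite card_pairs [X in (_ <= X)%N](bigID (mem (Z 1))) /=.
  apply: leq_trans (leq_addr _ _); rewrite -sum_nat_const; apply: leq_sum => z /unsolved_degree.
  set B := [set j | _]; set C := [set j | _] => cB.
  have : ([set: J] \subset B :|: C).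
    by apply/subsetP=> j _; rewrite /B /C !inE; case: (_ \in Sg); rewrite ?orbT.
  move/subset_leq_card; rewrite cardsT leq_subLR => /leq_trans; apply.
  by apply: leq_trans (leq_card_setU B C) _; rewrite leq_add2r ltnW.
have c : (#|Sg| + #|~: Sg| = #|V| * #|J|)%N by rewrite cardsC card_prod.
rewrite -(leq_pmul2r J0); move: le1 c half_single kappaJ; clear.
move: #|Z 1| #|J| #|V| #|Sg| #|~: Sg| => a L M s t le1 c hs kL.
have : (a * (4 * (L - kappa)) <= 4 * t)%N by rewrite mulnCA leq_mul2l.
have : (a * (3 * L) <= a * (4 * (L - kappa)))%N by rewrite leq_mul2l; lia.
rewrite -!mulnA; move: (M * L)%N c hs => ML c hs; lia.
Qed.

(** An edge leaving [Z'] ends either at a node of [Z0 :\: Z'], with at most [#|J|] edges into each,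
    or outside [Z0], with fewer than [kappa] edges from each node of [Z']. Expansion yields on
    average [m / 3] leaving edges per node, and [6 * kappa <= m] lets the second kind take at most
    half of them. *)
Lemma unsolved_rec k : ((6 * r).+1 * #|Z k.+2| <= 6 * r * #|Z k.+1|)%N.
Proof.
set Z' := Z k.+2; set Z0 := Z k.+1.
have sZ : Z' \subset Z0 by exact: unsolvedS.
have cZ := cardsID Z' Z0; rewrite (setIidPr sZ) in cZ.
have le1 : (3 * #|Z'| <= 2 * #|V|)%N.
  apply: leq_trans unsolved1; rewrite leq_mul2l /=; apply: subset_leq_card.
  rewrite /Z'; elim: k {Z' Z0 sZ cZ} => [|k IH]; first exact: unsolvedS.
  exact: subset_trans (unsolvedS _) IH.
have le2 : (\sum_j cut Z' (st j) <= kappa * #|Z'| + #|J| * #|Z0 :\: Z'|)%N.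
  apply: (@leq_trans (\sum_j (#|[set z in Z' | (z + st j)%R \notin Z0]| + #|Z0 :\: Z'|))).
    apply: leq_sum => j _; rewrite /cut -[X in (_ + X)%N](card_preimset _ (addIr (st j))).
    apply: leq_trans (leq_card_setU _ _); apply/subset_leq_card/subsetP=> z.
    by rewrite !inE => /andP[-> ->] /=; rewrite orNb.
  rewrite big_split sum_nat_const leq_add2r.
  have -> : (\sum_j #|[set z in Z' | (z + st j)%R \notin Z0]| =
             \sum_(z in Z') #|[set j | (z + st j)%R \notin Z0]|)%N.
    under eq_bigr => j _ do rewrite -sum1dep_card big_mkcondr.
    rewrite exchange_big; apply: eq_bigr => z _.
    by rewrite -sum1dep_card [RHS]big_mkcond.
  rewrite mulnC -sum_nat_const; apply: leq_sum => z /unsolved_degree/ltnW; apply: leq_trans.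
  by apply/subset_leq_card/subsetP=> j; rewrite !inE => ->; rewrite orbT.
have le3 := cut_large Z'.
have cC : (#|Z'| + #|~: Z'| = #|V|)%N := cardsC Z'.
have V0 : (0 < #|V|)%N by apply/card_gt0P; exists 0.
have le4 : (m * #|Z'| <= 3 * (kappa * #|Z'| + #|J| * #|Z0 :\: Z'|))%N.
  rewrite -(leq_pmul2l V0); move: le1 le2 le3 cC.
  move: (\sum_j _)%N (kappa * _ + _)%N => s u; move: #|Z'| #|~: Z'| #|V| => a b M.
  clear => aM su mab abM; have b3 : (M <= 3 * b)%N by lia.
  apply: (@leq_trans (3 * b * (m * a))%N); first by rewrite leq_mul2r b3 orbT.
  have -> : (3 * b * (m * a) = 3 * (m * (a * b)))%N by lia.
  rewrite [X in (_ <= X)%N]mulnCA leq_mul2l /=.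
  by apply: leq_trans mab _; rewrite leq_mul2l su orbT.
move: le4 cZ Jm kappam m0; move: #|Z'| #|Z0| #|Z0 :\: Z'| => a b d; clear.
move=> le4 cZ Jm kappam m0.
have : (m * a <= m * (6 * r * d))%N by nia.
rewrite leq_pmul2l //; nia.
Qed.

Lemma percolation :
    (forall z, exists g, keep (6 * r * tau).+2 z g) ->
  exists s : {ffun V -> G}, solution s.
Proof.
(* One round before the last, every node has at most one survivor; the last round certifies that
   these survivors are compatible. *)
move=> ex; pose R := (6 * r * tau).+1.
have ZR : #|Z R| = 0%N.
  apply: (@geom_halving (fun k => #|Z k.+1|)); first by rewrite muln_gt0.
    exact: unsolved_rec.
  by apply: leq_ltn_trans Vtau; apply: max_card.
exists [ffun z => xchoose (ex z)] => z j; rewrite !ffunE.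
case/andP: (xchooseP (ex z)) => _ /forallP/(_ j)/existsP[g' /andP[kg' c]].
suff <- : g' = xchoose (ex (z + st j)%R) by [].
have : (z + st j)%R \notin Z R by rewrite (cards0_eq ZR) inE.
rewrite inE -leqNgt => /card_le1_eqP; apply; rewrite inE //.
by case/andP: (xchooseP (ex (z + st j)%R)).
Qed.
End Percolation.
End ArcConsistency.

(** * Averaging over labellings *)

Section Averaging.
Import Order.TTheory GRing.Theory Num.Theory.
Local Open Scope ring_scope.

Section Halfedges.
Variables (E : finType) (V : eqType) (F : finFieldType) (X : finZmodType).
Variables (node : bool -> E -> V) (val : X -> E -> bool -> F) (kappa : nat).
Implicit Types (S : {set E}) (H R : {set E * bool}) (h : E * bool).

Definition halves S : {set E * bool} := [set h | h.1 \in S].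
Definition deg H v := #|[set h in H | node h.2 h.1 == v]|.

(** Interpolation in abstract form; with additivity of [val] it is all that the averaging uses about
    polynomials. *)
Definition has_units := forall H h (a : F),
  h \in H -> (deg H (node h.2 h.1) <= kappa)%N ->
  exists2 u, val u h.1 h.2 = a & {in H :\ h, forall h', val u h'.1 h'.2 = 0}.

Hypothesis valD : forall x y e b, val (x + y) e b = val x e b + val y e b.
Hypothesis units : has_units.

Local Notation Q := (#|F|%:R : rat).

Lemma Q_gt0 : 0 < Q.
Proof. by rewrite ltr0n; apply/card_gt0P; exists 0. Qed.

(** Translation by a unit permutes [X] and shifts the value at [h] while [Phi] sees nothing else
    change, so this value may be replaced by an independent uniform one. *)
Lemma average H h (Phi : X -> F -> rat) :
    h \in H -> (deg H (node h.2 h.1) <= kappa)%N ->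
    (forall x y, {in H :\ h, forall h', val x h'.1 h'.2 = val y h'.1 h'.2} ->
       forall a, Phi x a = Phi y a) ->
  Q * (\sum_x Phi x (val x h.1 h.2)) = \sum_x \sum_a Phi x a.
Proof.
move=> hH dH inv; rewrite mulr_natl -sumr_const.
have -> : \sum_x \sum_a Phi x a = \sum_x \sum_a Phi x (val x h.1 h.2 + a).
  apply: eq_bigr => x _; rewrite [LHS](reindex (fun a => val x h.1 h.2 + a)) //=.
  by exists (fun a => - val x h.1 h.2 + a) => a _; rewrite addrA ?subrr ?addNr add0r.
rewrite [RHS]exchange_big; apply: eq_bigr => a _.
have [u u1 u0] := units a hH dH.
rewrite (reindex (fun x => x + u)) /=; last first.
  by exists (fun x => x - u) => x _; rewrite ?addrK ?subrK.
apply: eq_bigr => x _; rewrite valD u1; apply: inv => h' h'H.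
by rewrite valD u0 // addr0.
Qed.

(* Translating by units averages the factors of S1 independently. *)
Lemma factor_out H S1 (phi : X -> rat) (psi : E -> F -> F -> rat) :
    halves S1 \subset H ->
    {in halves S1, forall h, (deg H (node h.2 h.1) <= kappa)%N} ->
    (forall x y, {in H :\: halves S1, forall h', val x h'.1 h'.2 = val y h'.1 h'.2} ->
       phi x = phi y) ->
  Q ^+ (2 * #|S1|) * (\sum_x phi x * \prod_(e in S1) psi e (val x e true) (val x e false))
    = (\sum_x phi x) * \prod_(e in S1) \sum_c \sum_d psi e c d.
Proof.
move: {2}#|S1| (erefl #|S1|) => k; elim: k S1 => [|k IH] S1 S1k S1H dS1 inv.
  move/cards0_eq: S1k => ->; rewrite cards0 muln0 expr0 mul1r big_set0 mulr1.
  by apply: eq_bigr => x _; rewrite big_set0 mulr1.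
have /card_gt0P[e eS1] : (0 < #|S1|)%N by rewrite S1k.
pose S' := S1 :\ e.
have S'1 : halves S' \subset halves S1.
  by apply/subsetP=> h; rewrite !inE => /andP[].
have hf b : (e, b) \in halves S1 by rewrite inE.
have hH b : (e, b) \in H by rewrite (subsetP S1H) ?hf.
have restE x y b : {in H :\ (e, b), forall h', val x h'.1 h'.2 = val y h'.1 h'.2} ->
  phi x = phi y /\ \prod_(e' in S') psi e' (val x e' true) (val x e' false) =
                   \prod_(e' in S') psi e' (val y e' true) (val y e' false).
  move=> xy; split.
    apply: inv => h'; rewrite inE => /andP[nS1 h'H]; apply: xy; rewrite !inE h'H andbT.
    by apply: contraNneq nS1 => ->.
  apply: eq_bigr => e' e'S'; move: (e'S'); rewrite !inE => /andP[ne e'S1].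
  have K c : val x e' c = val y e' c.
    apply: (xy (e', c)); rewrite !inE xpair_eqE (negPf ne) /=.
    by rewrite (subsetP S1H) // inE.
  by rewrite !K.
have := IH S' _ (subset_trans S'1 S1H) _ _.
have -> : #|S1| = (#|S'|).+1 by rewrite (cardsD1 e S1) eS1.
have S'k : #|S'| = k by move: S1k; rewrite (cardsD1 e S1) eS1 add1n => -[].
move=> /(_ S'k) {}IH; rewrite [X in _ = _ * X](big_setD1 e) //= mulrCA.
rewrite [in RHS]/= -{}IH; last 2 first.
- by move=> h hS'; apply: dS1; apply: (subsetP S'1).
- move=> x y xy; apply: inv => h'; rewrite inE => /andP[nS1 h'H]; apply: xy.
  by rewrite inE h'H andbT; apply: contra nS1; apply: (subsetP S'1).
rewrite mulnS exprD -mulrA mulrCA [RHS]mulrCA; congr (_ * _).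
pose rest x := phi x * \prod_(e' in S') psi e' (val x e' true) (val x e' false).
have -> : \sum_x phi x * (\prod_(e in S1) psi e (val x e true) (val x e false)) =
          \sum_x rest x * psi e (val x e true) (val x e false).
  by apply: eq_bigr => x _; rewrite (big_setD1 e) //= /rest mulrCA mulrC.
have step1 : Q * (\sum_x rest x * psi e (val x e true) (val x e false)) =
             \sum_x \sum_d rest x * psi e (val x e true) d.
  apply: (average (h := (e, false)) (H := H)
    (Phi := fun x d => rest x * psi e (val x e true) d)); rewrite ?dS1 //.
  move=> x y xy a; have [E1 E2] := restE _ _ _ xy; rewrite /rest E1 E2.
  by have /= -> // := xy (e, true); rewrite !inE xpair_eqE andbF /= hH.
have step2 : Q * (\sum_x \sum_d rest x * psi e (val x e true) d) =
             \sum_x \sum_c \sum_d rest x * psi e c d.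
  apply: (average (h := (e, true)) (H := H)
    (Phi := fun x c => \sum_d rest x * psi e c d)); rewrite ?dS1 //.
  move=> x y xy a; have [E1 E2] := restE _ _ _ xy; apply: eq_bigr => d _.
  by rewrite /rest E1 E2.
rewrite expr2 -mulrA step1 step2.
rewrite [RHS]mulrC mulr_suml; apply: eq_bigr => x _.
by rewrite mulr_sumr; apply: eq_bigr => c _; rewrite mulr_sumr.
Qed.

(** [psi e b] is the weight of a cell with its half [b] as first argument. Averaging over one half
    costs at most a factor 2 outside [Sm]; inside, it leaves the weight [om] of the other half,
    whose own average is at most [3 / Q]. *)
Variables (Sm : {set E}) (psi : E -> bool -> F -> F -> rat) (om : E -> bool -> F -> rat).
Hypothesis psi_ge0 : forall e b c d, 0 <= psi e b c d.
Hypothesis psiC : forall e c d, psi e true c d = psi e false d c.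
Hypothesis om_ge0 : forall e b c, 0 <= om e b c.
Hypothesis sum_psi2 : forall e b d, e \notin Sm -> \sum_c psi e b c d <= Q * 2.
Hypothesis sum_psi_om : forall e b d, e \in Sm -> \sum_c psi e b c d <= Q * om e (~~ b) d.
Hypothesis sum_om : forall e b, e \in Sm -> \sum_c om e b c <= 3.
Hypothesis matching : {in halves Sm &, forall h h', node h.2 h.1 = node h'.2 h'.1 -> h = h'}.
Hypothesis kappa0 : (0 < kappa)%N.

Lemma deg_matching R v : R \subset halves Sm -> (deg R v <= 1)%N.
Proof.
move=> /subsetP RS; apply/card_le1_eqP=> h h'; rewrite !inE => /andP[hR /eqP hv] /andP[h'R /eqP h'v].
by apply: matching; rewrite ?RS // hv h'v.
Qed.

Lemma peel_matching R : R \subset halves Sm ->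
  \sum_x \prod_(h in R) om h.1 h.2 (val x h.1 h.2) <= #|X|%:R * (3 / Q) ^+ #|R|.
Proof.
move: {2}#|R| (erefl #|R|) => k; elim: k R => [|k IH] R Rk RS.
  rewrite Rk expr0 mulr1; move/cards0_eq: Rk => ->.
  under eq_bigr => x _ do rewrite big_set0.
  by rewrite sumr_const lexx.
have /card_gt0P[h hR] : (0 < #|R|)%N by rewrite Rk.
have hSm : h.1 \in Sm by have := subsetP RS _ hR; rewrite inE.
have R'S : R :\ h \subset halves Sm by rewrite (subset_trans _ RS) ?subsetDl.
have cR : #|R| = (#|R :\ h|).+1 by rewrite (cardsD1 h R) hR.
rewrite -(ler_pM2l Q_gt0) cR exprS.
have -> : Q * (\sum_x \prod_(k in R) om k.1 k.2 (val x k.1 k.2)) =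
  \sum_x \sum_c om h.1 h.2 c * \prod_(k in R :\ h) om k.1 k.2 (val x k.1 k.2).
  rewrite -(average hR (Phi := fun x c => om h.1 h.2 c *
     \prod_(k in R :\ h) om k.1 k.2 (val x k.1 k.2))).
  - by congr (_ * _); apply: eq_bigr => x _; rewrite (big_setD1 h).
  - exact: leq_trans (deg_matching _ RS) _.
  - by move=> x y xy a; congr (_ * _); apply: eq_bigr => h' /xy->.
apply: (@le_trans _ _ (\sum_x 3 * \prod_(k in R :\ h) om k.1 k.2 (val x k.1 k.2))).
  apply: ler_sum => x _; rewrite -mulr_suml ler_wpM2r ?sum_om //.
  by apply: prodr_ge0.
rewrite -mulr_sumr.
have -> : Q * (#|X|%:R * (3 / Q * (3 / Q) ^+ #|R :\ h|)) =
          3 * (#|X|%:R * (3 / Q) ^+ #|R :\ h|).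
  by field; rewrite gt_eqF ?Q_gt0.
by rewrite ler_wpM2l // IH //; move: Rk; rewrite cR => -[].
Qed.

(** As for degenerate graphs, this lets the cells be peeled off one by one. The strict inequality
    leaves room for one half-edge waiting in [R] at the same node. *)
Definition degenerate S := forall S', S' \subset S -> S' != set0 ->
  exists2 h, h \in halves S' & (deg (halves S') (node h.2 h.1) < kappa)%N.

(* A cell of the matching Sm is used twice: averaging over one of its halves
   leaves the weight om at the other half, which waits in R until the end. *)
Lemma peel S R :
    degenerate S -> R \subset halves Sm -> [disjoint R & halves S] ->
  \sum_x (\prod_(e in S) psi e true (val x e true) (val x e false)) *
         (\prod_(h in R) om h.1 h.2 (val x h.1 h.2))
    <= #|X|%:R * 2 ^+ #|S :\: Sm| * (3 / Q) ^+ (#|S :&: Sm| + #|R|).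
Proof.
move: {2}#|S| (erefl #|S|) => k; elim: k S R => [|k IH] S R Sk dS RS dRS.
  move/cards0_eq: Sk => ->; rewrite set0D set0I cards0 expr0 mulr1 add0n.
  under eq_bigr => x _ do rewrite big_set0 mul1r.
  exact: peel_matching.
have S0 : S != set0 by rewrite -card_gt0 Sk.
have [[e b]] := dS S (subxx _) S0; rewrite inE /= => eS deg_e.
pose H := halves S :|: R; pose S' := S :\ e.
have hH c : (e, c) \in H by rewrite !inE eS.
have dH : (deg H (node b e) <= kappa)%N.
  have := deg_matching (node b e) RS.
  suff : (deg H (node b e) <= deg (halves S) (node b e) + deg R (node b e))%N by lia.
  apply: leq_trans (leq_card_setU _ _); apply/subset_leq_card/subsetP=> h.
  by rewrite !inE andb_orl.
have S'S : S' \subset S by apply: subsetDl.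
have S'k : #|S'| = k by move: Sk; rewrite (cardsD1 e S) eS add1n => -[].
have dS' : degenerate S' by move=> T TS'; apply: dS; apply: subset_trans S'S.
have S'half : halves S' \subset halves S.
  by apply/subsetP=> h; rewrite !inE => /andP[].
pose rest x := (\prod_(e in S') psi e true (val x e true) (val x e false)) *
         (\prod_(h in R) om h.1 h.2 (val x h.1 h.2)).
have rest_ge0 x : 0 <= rest x by apply: mulr_ge0; apply: prodr_ge0.
have avg : Q * (\sum_x (\prod_(e in S) psi e true (val x e true) (val x e false)) *
         (\prod_(h in R) om h.1 h.2 (val x h.1 h.2))) =
    \sum_x (\sum_c psi e b c (val x e (~~ b))) * rest x.
  under [RHS]eq_bigr => x _ do rewrite mulr_suml.
  rewrite -(average (h := (e, b)) (H := H)
    (Phi := fun x c => psi e b c (val x e (~~ b)) * rest x)) //=.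
    congr (_ * _); apply: eq_bigr => x _; rewrite (big_setD1 e) //= -mulrA; congr (_ * _).
    by case: b {deg_e dH} => //; rewrite psiC.
  move=> x y xy a.
  have -> : val x e (~~ b) = val y e (~~ b).
    by apply: (xy (e, ~~ b)); rewrite !inE xpair_eqE eqxx eS /= andbT; case: (b).
  congr (_ * _); congr (_ * _); apply: eq_bigr.
    move=> e' e'S'; move: (e'S'); rewrite !inE => /andP[ne e'S].
    have K c : val x e' c = val y e' c.
      by apply: (xy (e', c)); rewrite !inE xpair_eqE (negPf ne) /= e'S.
    by rewrite !K.
  move=> h hR; rewrite xy // !inE hR orbT andbT.
  by apply: contraTneq hR => ->; rewrite (disjointFl dRS) // inE.
rewrite -(ler_pM2l Q_gt0) avg.
have [eSm|eSm] := boolP (e \in Sm).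
  have dR : (e, ~~ b) \notin R by rewrite (disjointFl dRS) // inE.
  apply: (@le_trans _ _ (\sum_x Q * (om e (~~ b) (val x e (~~ b)) * rest x))).
    by apply: ler_sum => x _; rewrite mulrA ler_wpM2r // sum_psi_om.
  rewrite -mulr_sumr ler_pM2l ?Q_gt0 //.
  have RS' : (e, ~~ b) |: R \subset halves Sm by rewrite subUset sub1set inE /= eSm.
  have dRS' : [disjoint (e, ~~ b) |: R & halves S'].
    rewrite disjoints_subset subUset sub1set !inE eqxx /= -disjoints_subset.
    exact: disjointWr dRS.
  have := IH S' _ S'k dS' RS' dRS'.
  have -> : #|(e, ~~ b) |: R| = (#|R|).+1 by rewrite cardsU1 dR.
  have -> : S' :\: Sm = S :\: Sm.
    by apply/setP=> e'; rewrite !inE; case: eqP => //= ->; rewrite eSm.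
  have -> : #|S :&: Sm| = (#|S' :&: Sm|).+1.
    rewrite (cardsD1 e) inE eS eSm; suff -> : (S :&: Sm) :\ e = S' :&: Sm by [].
    by apply/setP=> e'; rewrite !inE andbA.
  rewrite -addSnnS; apply: le_trans; apply: ler_sum => x _.
  by rewrite /rest big_setU1 //= mulrCA.
apply: (@le_trans _ _ (\sum_x Q * 2 * rest x)).
  by apply: ler_sum => x _; rewrite ler_wpM2r // sum_psi2.
rewrite -mulr_sumr -mulrA ler_pM2l ?Q_gt0 //.
have -> : #|S :\: Sm| = (#|S' :\: Sm|).+1.
  by rewrite (cardsD1 e) inE eS eSm /= !setDDl setUC.
have -> : S :&: Sm = S' :&: Sm.
  by apply/setP=> e'; rewrite !inE; case: eqP => //= ->; rewrite (negPf eSm) andbF.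
rewrite exprS [_ * (2 * _)]mulrCA -!mulrA ler_wpM2l // mulrA IH //.
exact: disjointWr dRS.
Qed.
End Halfedges.
End Averaging.

(** * The discrepancy of a product of cells *)

Section ProductDiscrepancy.
Import Order.TTheory GRing.Theory Num.Theory.
Local Open Scope ring_scope.

Lemma eq_ler (x y : rat) : x = y -> x <= y.
Proof. by move->. Qed.

Lemma cauchy_schwarz (Y : finType) (B : {set Y}) (g : Y -> rat) :
  (\sum_(y in B) g y) ^+ 2 <= #|B|%:R * (\sum_(y in B) g y ^+ 2).
Proof.
pose s := \sum_(y in B) g y; pose n : rat := #|B|%:R.
have [B0|B0] := posnP #|B|.
  by move/cards0_eq: B0 => ->; rewrite !big_set0 expr0n mulr0.
have n0 : 0 < n by rewrite ltr0n.
have : 0 <= \sum_(y in B) (n * g y - s) ^+ 2 by apply: sumr_ge0 => y _; apply: sqr_ge0.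
have -> : \sum_(y in B) (n * g y - s) ^+ 2 = n * (n * (\sum_(y in B) g y ^+ 2) - s ^+ 2).
  transitivity (\sum_(y in B) (n ^+ 2 * g y ^+ 2 - 2 * n * s * g y + s ^+ 2)).
    by apply: eq_bigr => y _; ring.
  rewrite big_split sumrB /= -!mulr_sumr sumr_const -mulr_natl -/s -/n.
  by ring.
by rewrite pmulr_rge0 // subr_ge0.
Qed.

Section LineSums.
Variable F : finFieldType.
Local Notation Q := (#|F|%:R : rat).

Lemma sum_indicator (u : F) : \sum_d (u == d)%:R = 1 :> rat.
Proof. by rewrite (bigD1 u) //= eqxx big1 ?addr0 // => d; rewrite eq_sym => /negPf->. Qed.

Lemma sum_const (x : rat) : \sum_(d : F) x = Q * x.
Proof. by rewrite sumr_const mulr_natl. Qed.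

Lemma sum_affine (k s t : F) : k != 0 -> \sum_u (u * k + s == t)%:R = 1 :> rat.
Proof.
move=> k0; rewrite -[RHS](sum_indicator ((t - s) / k)); apply: eq_bigr => u _; congr ((nat_of_bool _)%:R).
apply/idP/idP => /eqP <-; first by rewrite addrK mulfK.
by rewrite divfK // subrK.
Qed.

Lemma Q_ge1 : 1 <= Q.
Proof. by rewrite ler1n; apply/card_gt0P; exists 0. Qed.

(** In the plane of (c, d) the two conditions are lines. Non-parallel lines are uncorrelated, so the
    sum vanishes unless [a = a'], and it has order [Q ^+ 3] only if also [b = b']. *)
Lemma pair_correlation (a b a' b' s : F) :
  `|\sum_c \sum_d (Q * (a * c + b + d == s)%:R - 1) * (Q * (a' * c + b' + d == s)%:R - 1)|
    <= Q ^+ 2 * ((a == a')%:R * (Q * (b == b')%:R + 1)).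
Proof.
have inner c : \sum_d (Q * (a * c + b + d == s)%:R - 1) * (Q * (a' * c + b' + d == s)%:R - 1)
    = Q ^+ 2 * (a * c + b == a' * c + b')%:R - Q.
  pose u := s - (a * c + b); pose v := s - (a' * c + b').
  have E w d : (w + d == s) = (s - w == d) by rewrite addrC eq_sym -subr_eq.
  transitivity (\sum_d (Q ^+ 2 * ((u == v)%:R * (u == d)%:R) - Q * (u == d)%:R - Q * (v == d)%:R + 1)).
    apply: eq_bigr => d _; rewrite !E -/u -/v.
    have -> : (u == v)%:R * (u == d)%:R = (u == d)%:R * (v == d)%:R :> rat.
      by rewrite -!natrM !mulnb eq_sym; case: (u =P d) => [->|]; rewrite ?andbT ?andbF.
    by ring.
  rewrite big_split !sumrB /= -!mulr_sumr !sum_indicator sum_const.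
  have -> : (a * c + b == a' * c + b') = (u == v).
    by rewrite /u /v (inj_eq (addrI s)) (inj_eq oppr_inj).
  by ring.
under eq_bigr => c _ do rewrite inner.
rewrite sumrB -mulr_sumr sum_const.
have Q0 := Q_gt0 F; have Q1 := Q_ge1.
have [<-|naa] := eqVneq a a'; last first.
  have -> : \sum_c (a * c + b == a' * c + b')%:R = 1 :> rat.
    rewrite -[RHS](@sum_affine (a - a') b b') ?subr_eq0 //; apply: eq_bigr => c _.
    have -> : (a * c + b == a' * c + b') = (c * (a - a') + b == b'); last by [].
    by rewrite -subr_eq0 -[in RHS]subr_eq0; congr (_ == 0); ring.
  by rewrite mulr1 mul0r mulr0 -expr2 subrr normr0.
have -> : \sum_c (a * c + b == a * c + b')%:R = Q * (b == b')%:R.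
  under eq_bigr => c _ do rewrite (inj_eq (addrI _)).
  by rewrite sum_const.
rewrite mul1r ler_norml; case: (b == b'); rewrite ?mulr1 ?mulr0.
  by apply/andP; split; nra.
by apply/andP; split; nra.
Qed.
End LineSums.

(** * Cauchy-Schwarz over one player, matching of the other *)

Section Norm.
Variables (E : finType) (V : eqType) (F : finFieldType) (X Y : finZmodType).
Variables (nodex nodey : bool -> E -> V) (valx : X -> E -> bool -> F) (valy : Y -> E -> bool -> F).
Variables (kappa : nat) (beta : E -> F).
Hypothesis kappa0 : (0 < kappa)%N.
Hypothesis valxD : forall x y e b, valx (x + y) e b = valx x e b + valx y e b.
Hypothesis valyD : forall x y e b, valy (x + y) e b = valy x e b + valy y e b.
Hypothesis unitsx : has_units nodex valx kappa.
Hypothesis unitsy : has_units nodey valy kappa.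
Local Notation Q := (#|F|%:R : rat).

Definition delta e x y :=
  valx x e true * valy y e true + valx x e false + valy y e false == beta e.
Definition disc e x y : rat := Q * (delta e x y)%:R - 1.

(** Cauchy-Schwarz runs over [y]. On [S1] the values of [y] average freely, which forces the two
    copies [x] and [x'] to nearly agree there; the matching [Sm] makes this agreement worth a factor
    [3 / Q] per cell. On the rest [S2] signs are given up and [disc] is bounded by [mass]. *)
Variables S S1 Sm : {set E}.
Hypothesis S1S : S1 \subset S.
Hypothesis SmS1 : Sm \subset S1.
Hypothesis degx : degenerate nodex kappa S.
Hypothesis degy : degenerate nodey kappa S.
Hypothesis unsat : {in halves S1, forall h, (deg nodey (halves S) (nodey h.2 h.1) <= kappa)%N}.
Hypothesis matchx : {in halves Sm &, forall h h', nodex h.2 h.1 = nodex h'.2 h'.1 -> h = h'}.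

Let S2 := S :\: S1.
Let mass e x y : rat := Q * (delta e x y)%:R + 1.
Let lam e x x' : rat := (valx x e true == valx x' e true)%:R *
                        (Q * (valx x e false == valx x' e false)%:R + 1).

Let mass_ge0 e x y : 0 <= mass e x y.
Proof. by rewrite addr_ge0 // mulr_ge0. Qed.

Let lam_ge0 e x x' : 0 <= lam e x x'.
Proof. by rewrite mulr_ge0 // addr_ge0 // mulr_ge0. Qed.

Lemma disc_mass e x y : `|disc e x y| <= mass e x y.
Proof.
rewrite /disc /mass (le_trans (ler_normB _ _)) // normr1 ger0_norm //.
by rewrite mulr_ge0.
Qed.

Lemma two_le_Q (b : bool) : Q * b%:R + 1 <= Q * 2.
Proof. by have := Q_ge1 F; case: b => /=; rewrite ?mulr1 ?mulr0; lra. Qed.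

Lemma inner_bound x y : {in S2, forall e, valy y e true != 0} ->
  \sum_x' (\prod_(e in S1) lam e x x') * (\prod_(e in S2) mass e x' y)
    <= #|X|%:R * (2 ^+ #|S| * (3 / Q) ^+ #|Sm|).
Proof.
move=> y0; have Q0 := Q_gt0 F; have Q1 := Q_ge1 F.
pose psiT e u v : rat :=
  if e \in S1 then (valx x e true == u)%:R * (Q * (valx x e false == v)%:R + 1)
  else if e \in S then Q * (u * valy y e true + v + valy y e false == beta e)%:R + 1 else 0.
pose psi e (b : bool) c d := if b then psiT e c d else psiT e d c.
(* [Q * om] dominates both marginals of [psiT] on [S1], and [om] sums to [2 + 1]; this is the origin
   of the constant 3. *)
pose om e b v : rat := 2 * (valx x e b == v)%:R + Q^-1.
have psiT_ge0 e u v : 0 <= psiT e u v.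
  rewrite /psiT; case: ifP => _; first by rewrite mulr_ge0 // addr_ge0 // mulr_ge0.
  by case: ifP => // _; rewrite addr_ge0 // mulr_ge0.
have sumT e v : e \in S1 ->
    \sum_u psiT e u v = Q * (valx x e false == v)%:R + 1.
  by move=> eS1; rewrite /psiT eS1 -mulr_suml sum_indicator mul1r.
have sumF e u : e \in S1 ->
    \sum_v psiT e u v = (valx x e true == u)%:R * (Q * 2).
  move=> eS1; rewrite /psiT eS1 -mulr_sumr; congr (_ * _).
  by rewrite big_split /= -mulr_sumr sum_indicator sum_const; ring.
have psi_ge0 e b c d : 0 <= psi e b c d by case: b; apply: psiT_ge0.
have psiC e c d : psi e true c d = psi e false d c by [].
have om_ge0 e b c : 0 <= om e b c.
  by rewrite addr_ge0 // ?mulr_ge0 // invr_ge0 ltW.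
have psi2 e b d : e \notin Sm -> \sum_c psi e b c d <= Q * 2.
  move=> eSm; case: (boolP (e \in S1)) => eS1; case: b; rewrite /psi.
  + by rewrite sumT //; apply: two_le_Q.
  + by rewrite sumF //; case: (_ == _); rewrite ?mul1r ?mul0r //; lra.
  + rewrite /psiT (negPf eS1); case: (boolP (e \in S)) => eS; last by rewrite sum_const mulr0; lra.
    rewrite big_split /= -mulr_sumr sum_const.
    under eq_bigr => u _ do rewrite -addrA.
    by rewrite sum_affine ?y0 ?inE ?eS1 //; lra.
  + rewrite /psiT (negPf eS1); case: (boolP (e \in S)) => eS; last by rewrite sum_const mulr0; lra.
    rewrite big_split /= -mulr_sumr sum_const.
    have -> : \sum_v (d * valy y e true + v + valy y e false == beta e)%:R =
              \sum_v (v * 1 + (d * valy y e true + valy y e false) == beta e)%:R :> rat.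
      by apply: eq_bigr => v _; rewrite mulr1 addrCA addrA.
    by rewrite sum_affine ?oner_eq0 //; lra.
have psi_om e b d : e \in Sm -> \sum_c psi e b c d <= Q * om e (~~ b) d.
  move=> eSm; have eS1 := subsetP SmS1 _ eSm.
  rewrite /om mulrDr mulfV ?gt_eqF //; case: b; rewrite /psi /=.
    by rewrite sumT //; case: (_ == _); rewrite ?mulr1 ?mulr0; lra.
  by rewrite sumF //; case: (_ == _); rewrite ?mulr1 ?mulr0 ?mul1r ?mul0r; lra.
have sum_om e b : e \in Sm -> \sum_c om e b c <= 3.
  move=> _; rewrite big_split /= -mulr_sumr sum_indicator sum_const.
  by rewrite mulfV ?gt_eqF //; lra.
have dis0 : [disjoint (set0 : {set E * bool}) & halves S] by rewrite -setI_eq0 set0I.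
have := peel valxD unitsx psi_ge0 psiC om_ge0 psi2 psi_om sum_om matchx kappa0 degx (sub0set _) dis0.
have -> : (#|S :&: Sm| + #|set0 : {set E * bool}|)%N = #|Sm|.
  by rewrite cards0 addn0 (setIidPr _) // (subset_trans SmS1).
move=> H; apply: le_trans (le_trans H _).
  apply: ler_sum => x' _; rewrite big_set0 mulr1 [X in _ <= X](big_setID S1) /= (setIidPr S1S).
  apply: eq_ler; congr (_ * _); apply: eq_bigr => e; first by move=> eS1; rewrite /psiT eS1.
  by rewrite inE /psiT => /andP[/negPf-> ->].
rewrite -mulrA ler_wpM2l //; apply: ler_wpM2r; first by rewrite exprn_ge0 // divr_ge0.
by rewrite ler_weXn2l // subset_leq_card // subsetDl.
Qed.

(** The same peeling with an empty matching, now over [y] and with a factor 2 per cell. *)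
Lemma outer_bound x : (forall e, valx x e true != 0) ->
  \sum_y \prod_(e in S2) mass e x y <= #|Y|%:R * 2 ^+ #|S|.
Proof.
move=> x0; have Q0 := Q_gt0 F.
pose psiT e c d : rat := Q * (valx x e true * c + valx x e false + d == beta e)%:R + 1.
pose psi e (b : bool) c d := if b then psiT e c d else psiT e d c.
have psiT_ge0 e u v : 0 <= psiT e u v by rewrite addr_ge0 // mulr_ge0.
have dS2 : degenerate nodey kappa S2.
  by move=> T TS2; apply: degy; rewrite (subset_trans TS2) ?subsetDl.
have psi_ge0 e b c d : 0 <= psi e b c d by case: b; apply: psiT_ge0.
have psiC e c d : psi e true c d = psi e false d c by [].
have psi2 e b d : e \notin (set0 : {set E}) -> \sum_c psi e b c d <= Q * 2.
  move=> _; case: b; rewrite /psi /psiT big_split /= -mulr_sumr sum_const.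
    have -> : \sum_c (valx x e true * c + valx x e false + d == beta e)%:R =
              \sum_c (c * valx x e true + (valx x e false + d) == beta e)%:R :> rat.
      by apply: eq_bigr => c _; rewrite mulrC addrA.
    by rewrite sum_affine //; lra.
  have -> : \sum_c (valx x e true * d + valx x e false + c == beta e)%:R =
            \sum_c (c * 1 + (valx x e true * d + valx x e false) == beta e)%:R :> rat.
    by apply: eq_bigr => c _; rewrite mulr1 addrC.
  by rewrite sum_affine ?oner_eq0 //; lra.
pose om (e : E) (b : bool) (c : F) : rat := 0.
have om_ge0 e b c : 0 <= om e b c by [].
have psi_om e b d : e \in (set0 : {set E}) -> \sum_c psi e b c d <= Q * om e (~~ b) d by rewrite inE.
have sum_om e b : e \in (set0 : {set E}) -> \sum_c om e b c <= 3 by rewrite inE.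
have match0 : {in halves (set0 : {set E}) &, forall h h', nodey h.2 h.1 = nodey h'.2 h'.1 -> h = h'}.
  by move=> h h'; rewrite !inE.
have dis0 : [disjoint (set0 : {set E * bool}) & halves S2] by rewrite -setI_eq0 set0I.
have := peel valyD unitsy psi_ge0 psiC om_ge0 psi2 psi_om sum_om match0 kappa0 dS2 (sub0set _) dis0.
rewrite setI0 !cards0 expr0 mulr1 setD0 => H; apply: le_trans (le_trans H _).
  by apply: ler_sum => y _; rewrite big_set0 mulr1.
rewrite ler_wpM2l // ler_weXn2l // subset_leq_card // subsetDl //.
Qed.

(** The translations that average [S1] fix any weight that sees only the halves of [S2]. The
    indicator of [B] need not be such a weight, so [discrepancy] replaces it beforehand. *)
Lemma correlation_bound x x' (phi : Y -> rat) :
    (forall y y', {in halves S2, forall h, valy y h.1 h.2 = valy y' h.1 h.2} -> phi y = phi y') ->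
  `|\sum_y phi y * \prod_(e in S1) (disc e x y * disc e x' y)|
    <= (\sum_y `|phi y|) * \prod_(e in S1) lam e x x'.
Proof.
move=> inv; have Q0 := Q_gt0 F.
pose psi e c d := (Q * (valx x e true * c + valx x e false + d == beta e)%:R - 1) *
                  (Q * (valx x' e true * c + valx x' e false + d == beta e)%:R - 1).
have := @factor_out E V F Y nodey valy kappa valyD unitsy (halves S) S1 phi psi _ unsat _.
have sub : halves S1 \subset halves S.
  by apply/subsetP=> h; rewrite !inE; apply: (subsetP S1S).
have inv' y y' : {in halves S :\: halves S1, forall h, valy y h.1 h.2 = valy y' h.1 h.2} -> phi y = phi y'.
  by move=> yy'; apply: inv => h hS2; apply: yy'; move: hS2; rewrite !inE.
move=> /(_ sub inv') eq_fac.
have Qk : 0 < Q ^+ (2 * #|S1|) by rewrite exprn_gt0.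
rewrite -(ler_pM2l Qk) -[X in X * `|_|]gtr0_norm // -normrM.
rewrite [X in `|X|](_ : _ = (\sum_y phi y) * \prod_(e in S1) \sum_c \sum_d psi e c d); last first.
  by rewrite -eq_fac.
rewrite normrM mulrCA; apply: ler_pM => //; first exact: ler_norm_sum.
rewrite normr_prod exprM -prodr_const -big_split /=.
by apply: ler_prod => e _; rewrite normr_ge0 pair_correlation.
Qed.

Lemma discrepancy (A : {set X}) (B : {set Y}) :
    {in A, forall x e, valx x e true != 0} -> {in B, forall y e, valy y e true != 0} ->
  (\sum_(x in A) \sum_(y in B) \prod_(e in S) disc e x y) ^+ 2
    <= (#|X|%:R * #|Y|%:R) ^+ 2 * (4 ^+ #|S| * (3 / Q) ^+ #|Sm|).
Proof.
move=> A0 B0; rewrite exchange_big /=.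
pose g y := \sum_(x in A) \prod_(e in S) disc e x y.
(* [hY] relaxes membership in [B] to what [inner_bound] requires of [y]; unlike [B], it depends on
   the values at [S2] alone. *)
pose hY y : rat := [forall e in S2, valy y e true != 0]%:R.
apply: (le_trans (cauchy_schwarz _ _)).
have cB : #|B|%:R <= #|Y|%:R :> rat by rewrite ler_nat max_card.
pose C : rat := 2 ^+ #|S| * (3 / Q) ^+ #|Sm|.
have C0 : 0 <= C by rewrite mulr_ge0 ?exprn_ge0 ?divr_ge0.
suff main : \sum_y hY y * g y ^+ 2 <= #|X|%:R ^+ 2 * #|Y|%:R * (2 ^+ #|S| * C).
  apply: (@le_trans _ _ (#|Y|%:R * \sum_y hY y * g y ^+ 2)).
    apply: ler_pM => //; first by apply: sumr_ge0 => y _; apply: sqr_ge0.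
    rewrite [X in _ <= X](bigID (mem B)) /= -[X in X <= _]addr0; apply: lerD.
      apply: ler_sum => y yB; have -> : hY y = 1; last by rewrite mul1r.
      by rewrite /hY; have -> : [forall e in S2, valy y e true != 0];
        first by apply/forallP=> e; apply/implyP=> _; apply: B0.
    by apply: sumr_ge0 => y _; rewrite mulr_ge0 ?sqr_ge0.
  apply: (le_trans (ler_wpM2l _ main)) => //.
  rewrite /C (_ : 4 = 2 * 2 :> rat); last by ring.
  rewrite [(2 * 2) ^+ _]exprMn; move: (2 ^+ _) ((3 / Q) ^+ _) => a b.
  by apply: eq_ler; ring.
have gE y : hY y * g y ^+ 2 = \sum_(x in A) \sum_(x' in A)
    (hY y * \prod_(e in S2) (disc e x y * disc e x' y)) *
      \prod_(e in S1) (disc e x y * disc e x' y).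
  rewrite expr2 /g big_distrl big_distrr /=; apply: eq_bigr => x _.
  rewrite big_distrr big_distrr /=; apply: eq_bigr => x' _.
  rewrite -big_split /= (big_setID S1) /= (setIidPr S1S) -/S2.
  by rewrite -mulrA; congr (_ * _); rewrite mulrC.
have -> : \sum_y hY y * g y ^+ 2 = \sum_(x in A) \sum_(x' in A) \sum_y
    (hY y * \prod_(e in S2) (disc e x y * disc e x' y)) *
      \prod_(e in S1) (disc e x y * disc e x' y).
  under eq_bigr => y _ do rewrite gE.
  rewrite exchange_big; apply: eq_bigr => x _.
  by rewrite exchange_big.
have hY0 y : 0 <= hY y by [].
(* Once absolute values are taken, [x'] may range over all of [X], as the averaging in [inner_bound]
   demands. *)
apply: (@le_trans _ _ (\sum_(x in A) \sum_x' \sum_y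
    (hY y * \prod_(e in S2) (mass e x y * mass e x' y)) * \prod_(e in S1) lam e x x')).
  apply: ler_sum => x _; rewrite [X in _ <= X](bigID (mem A)) /= -[X in X <= _]addr0.
  apply: lerD; last first.
    apply: sumr_ge0 => x' _; apply: sumr_ge0 => y _.
    by rewrite !mulr_ge0 ?prodr_ge0 // => e _; rewrite mulr_ge0.
  apply: ler_sum => x' _; apply: (le_trans (ler_norm _)).
  apply: (le_trans (correlation_bound _ _ _)) => [y y' yy'|].
    have K e b : e \in S2 -> valy y e b = valy y' e b.
      by move=> eS2; apply: (yy' (e, b)); rewrite inE.
    rewrite /hY; congr (_%:R * _).
      by congr (nat_of_bool _); apply: eq_forallb => e; case: (boolP (e \in S2)) => //= eS2; rewrite K.
    by apply: eq_bigr => e eS2; rewrite /disc /delta !K.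
  rewrite mulr_suml; apply: ler_sum => y _; apply: ler_wpM2r; first exact: prodr_ge0.
  rewrite normrM ger0_norm // ler_wpM2l // normr_prod; apply: ler_prod => e _.
  by rewrite normr_ge0 normrM ler_pM ?disc_mass.
apply: (@le_trans _ _ (\sum_(x in A) \sum_y (\prod_(e in S2) mass e x y) * (#|X|%:R * C))).
  apply: ler_sum => x _; rewrite exchange_big; apply: ler_sum => y _.
  have P0 : 0 <= \prod_(e in S2) mass e x y by apply: prodr_ge0.
  rewrite /hY; case: (boolP [forall e in S2, _]) => [/forallP y0|_]; last first.
    rewrite big1 => [|x' _]; last by rewrite !mul0r.
    exact: mulr_ge0 P0 (mulr_ge0 (ler0n _ _) C0).
  have -> : \sum_x' (true%:R : rat) * \prod_(e in S2) (mass e x y * mass e x' y) * \prod_(e in S1) lam e x x' =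
     (\prod_(e in S2) mass e x y) *
     \sum_x' (\prod_(e in S1) lam e x x') * (\prod_(e in S2) mass e x' y).
    rewrite mulr_sumr; apply: eq_bigr => x' _; rewrite mul1r big_split /=.
    by rewrite -mulrA; congr (_ * _); rewrite mulrC.
  rewrite ler_wpM2l // inner_bound // => e eS2.
  by move: (y0 e); rewrite eS2.
apply: (@le_trans _ _ (\sum_(x in A) (#|Y|%:R * 2 ^+ #|S|) * (#|X|%:R * C))).
  apply: ler_sum => x xA; rewrite -mulr_suml; apply: ler_wpM2r.
    exact: mulr_ge0 (ler0n _ _) C0.
  by apply: outer_bound; apply: A0.
rewrite sumr_const -[_ *+ #|A|]mulr_natl.
apply: (@le_trans _ _ (#|X|%:R * (#|Y|%:R * 2 ^+ #|S| * (#|X|%:R * C)))); last by apply: eq_ler; ring.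
apply: ler_wpM2r; last by rewrite ler_nat max_card.
exact: mulr_ge0 (mulr_ge0 (ler0n _ _) (exprn_ge0 _ (ler0n _ 2))) (mulr_ge0 (ler0n _ _) C0).
Qed.
End Norm.
End ProductDiscrepancy.

(** * From discrepancy to formula depth *)

Section DiscrepancyMethod.
Import Order.TTheory GRing.Theory Num.Theory.
Local Open Scope ring_scope.

Lemma bernoulli_bound (N n : nat) (t : rat) : (n <= N)%N -> 0 <= t ->
  N%:R * t <= 1 -> (1 + t) ^+ n * (1 - n%:R * t) <= 1.
Proof.
move=> nN t0 Nt; elim: n nN => [|n IH] nN; first by rewrite expr0 mul0r subr0 mul1r.
apply: le_trans (IH (ltnW nN)); rewrite exprS [(1 + t) * _]mulrC -mulrA.
apply: ler_wpM2l; first by rewrite exprn_ge0 // addr_ge0.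
by rewrite -[n.+1]addn1 natrD; have : 0 <= n%:R :> rat by []; nra.
Qed.

Lemma card_small_sets (E : finType) k : (#|[set S : {set E} | #|S| == k]| <= #|E| ^ k)%N.
Proof.
rewrite card_draws; apply: (@leq_trans (#|E| ^_ k)).
  by rewrite -bin_ffact leq_pmulr // fact_gt0.
elim: k => [|k IH]; first by [].
by rewrite ffactnSr expnSr leq_mul // leq_subr.
Qed.

Section LowerBound.
Variables (E X Y : finType) (del : E -> X -> Y -> bool) (Q : rat) (s : nat).
Variables (X0 : {set X}) (Y0 : {set Y}).
Hypothesis E0 : (0 < #|E|)%N.
Let N : rat := #|E|%:R.
Let W : rat := #|X|%:R * #|Y|%:R.
Let m e x y : rat := Q * (del e x y)%:R - 1.
Hypothesis norm_bound : forall (S : {set E}) (A : {set X}) (B : {set Y}),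
  (#|S| <= s)%N -> A \subset X0 -> B \subset Y0 ->
  `|\sum_(x in A) \sum_(y in B) \prod_(e in S) m e x y| <= W * (8 * N)^-1 ^+ #|S|.
Hypothesis large : W <= 2 * (#|X0|%:R * #|Y0|%:R).

Let G x y := \sum_(S : {set E} | (#|S| <= s)%N) \prod_(e in S) m e x y.

Let N0 : 0 < N. Proof. by rewrite ltr0n. Qed.
Let W0 : 0 <= W. Proof. by rewrite mulr_ge0. Qed.

(** The factor of [e] is -1 here, so a set without [e] cancels against the same set with [e] added.
    Only at the full size [s] is there no partner. *)
Lemma telescope e x y : ~~ del e x y ->
  G x y = \sum_(S : {set E} | (#|S| == s)%N && (e \notin S)) \prod_(e in S) m e x y.
Proof.
move=> /negPf d0; rewrite /G (bigID (fun S : {set E} => e \in S)) /=.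
have -> : \sum_(S : {set E} | (#|S| <= s)%N && (e \in S)) \prod_(e in S) m e x y =
   - \sum_(S : {set E} | (#|S| < s)%N && (e \notin S)) \prod_(e in S) m e x y.
  rewrite (reindex_onto (fun S => e |: S) (fun S => S :\ e)) /=; last first.
    by move=> S /andP[_ eS]; rewrite setD1K.
  rewrite -sumrN; apply: eq_big => S.
    rewrite setU11 andbT; have [eS|eS] := boolP (e \in S).
      rewrite andbF; apply/andP=> -[_ /eqP/setP/(_ e)].
      by rewrite !inE eqxx eS.
    by rewrite cardsU1 eS setU1K // eqxx !andbT.
  move=> /andP[_ /eqP eS].
  have eS' : e \notin S by rewrite -eS !inE eqxx.
  by rewrite big_setU1 //= {1}/m d0 mulr0 sub0r mulN1r.
rewrite addrC (bigID (fun S : {set E} => #|S| == s)) /= -addrA.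
rewrite [X in _ + X = _](_ : _ = 0) ?addr0; last first.
  apply/eqP; rewrite subr_eq0; apply/eqP; apply: eq_bigl => S.
  by rewrite ltn_neqAle andbC andbA.
by apply: eq_bigl => S; case: (e \in S); case: eqP => [->|]; rewrite ?andbF ?leqnn ?andbT.
Qed.

(** At most [N ^+ s] sets survive the telescoping, which cancels the power of [N] in [norm_bound]
    and leaves [8^-1 ^+ s]. *)
Lemma rectangle_bound e (A : {set X}) (B : {set Y}) :
    A \subset X0 -> B \subset Y0 -> {in A & B, forall x y, ~~ del e x y} ->
  `|\sum_(x in A) \sum_(y in B) G x y| <= 8^-1 ^+ s * W.
Proof.
move=> AX BY d0.
have -> : \sum_(x in A) \sum_(y in B) G x y =
  \sum_(S : {set E} | (#|S| == s)%N && (e \notin S)) \sum_(x in A) \sum_(y in B) \prod_(e in S) m e x y.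
  rewrite [RHS]exchange_big /=; apply: eq_bigr => x xA.
  by rewrite [RHS]exchange_big /=; apply: eq_bigr => y yB; rewrite (@telescope e) ?d0.
apply: (le_trans (ler_norm_sum _ _ _)).
apply: (@le_trans _ _ (\sum_(S : {set E} | #|S| == s) W * (8 * N)^-1 ^+ s)).
  rewrite [X in _ <= X](bigID (fun S : {set E} => e \notin S)) /= -[X in X <= _]addr0.
  apply: lerD; last by apply: sumr_ge0 => S _; rewrite mulr_ge0 // exprn_ge0 // invr_ge0 mulr_ge0 // ltW.
  by apply: ler_sum => S /andP[/eqP cS _]; rewrite -cS norm_bound // cS.
rewrite sumr_const -[_ *+ _]mulr_natl.
have cs : #|[pred S : {set E} | #|S| == s]|%:R <= N ^+ s.
  rewrite -natrX ler_nat; apply: leq_trans (card_small_sets E s).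
  by rewrite cardsE.
have t0 : 0 <= (8 * N)^-1 ^+ s by rewrite exprn_ge0 // invr_ge0 mulr_ge0 // ltW.
apply: (le_trans (ler_wpM2r (mulr_ge0 W0 t0) cs)).
rewrite mulrCA [W * _]mulrC ler_wpM2r // -exprMn invfM mulrCA mulfV ?gt_eqF // mulr1 //.
Qed.

(** The empty set contributes at least [W / 2]. With t = 1/(8N) the others contribute at most ((1 +
    t)^N - 1) W in absolute value, which [bernoulli_bound] bounds by [W / 7]. *)
Lemma total_bound : W <= 4 * \sum_(x in X0) \sum_(y in Y0) G x y.
Proof.
have -> : \sum_(x in X0) \sum_(y in Y0) G x y =
  \sum_(S : {set E} | (#|S| <= s)%N) \sum_(x in X0) \sum_(y in Y0) \prod_(e in S) m e x y.
  rewrite [RHS]exchange_big /=; apply: eq_bigr => x _.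
  by rewrite [RHS]exchange_big.
rewrite (bigD1 set0) ?cards0 //=.
have -> : \sum_(x in X0) \sum_(y in Y0) \prod_(e in set0) m e x y = #|X0|%:R * #|Y0|%:R.
  under eq_bigr => x _ do under eq_bigr => y _ do rewrite big_set0.
  by under eq_bigr => x _ do rewrite sumr_const; rewrite sumr_const mulr_natl.
set rest := \sum_(S | _) _.
suff : `|rest| <= W * 7^-1.
  by rewrite ler_norml => /andP[lo _]; move: lo large W0; lra.
apply: (le_trans (ler_norm_sum _ _ _)).
pose t := (8 * N)^-1.
have t0 : 0 <= t by rewrite invr_ge0 mulr_ge0 // ltW.
apply: (@le_trans _ _ (\sum_(S : {set E} | S != set0) W * t ^+ #|S|)).
  rewrite [X in _ <= X](bigID (fun S : {set E} => (#|S| <= s)%N)) /= -[X in X <= _]addr0.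
  apply: lerD; last by apply: sumr_ge0 => S _; rewrite mulr_ge0 // exprn_ge0.
  rewrite (eq_bigl (fun S : {set E} => (S != set0) && (#|S| <= s)%N)); last by move=> S; rewrite andbC.
  by apply: ler_sum => S /andP[_ cS]; apply: norm_bound.
rewrite -mulr_sumr ler_wpM2l //.
have : \sum_(S : {set E}) t ^+ #|S| = (1 + t) ^+ #|E|.
  rewrite addrC -prodr_const (bigA_distr _ _ (fun=> t) (fun => 1)) /=.
  by apply: eq_big => // S _; rewrite -big_mkcond prodr_const.
rewrite (bigD1 set0) //= cards0 expr0 => sumE.
have Nt : N * t = 8^-1 by rewrite /t invfM mulrCA mulfV ?gt_eqF // mulr1.
have := @bernoulli_bound #|E| #|E| t (leqnn _) t0; rewrite -/N Nt -sumE => H.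
have e8 : 8^-1 <= 1 :> rat by [].
by move: (H e8); lra.
Qed.

Variables (n : nat) (cellof : 'I_n -> E) (encx : X -> n.-tuple bool) (ency : Y -> n.-tuple bool).
Hypothesis var_rect : forall i x y, x \in X0 -> y \in Y0 ->
  tnth (encx x) i -> ~~ tnth (ency y) i -> ~~ del (cellof i) x y.

(** A conjunction splits the rectangle along [Y] and a disjunction along [X], according to the first
    subformula, so each level at most doubles the bound. *)
Lemma formula_discrepancy (phi : mform n) (A : {set X}) (B : {set Y}) :
    A \subset X0 -> B \subset Y0 ->
    {in A, forall x, feval (encx x) phi} -> {in B, forall y, ~~ feval (ency y) phi} ->
  `|\sum_(x in A) \sum_(y in B) G x y| <= 2 ^+ fdepth phi * (8^-1 ^+ s * W).
Proof.
have w0 : 0 <= 8^-1 ^+ s * W by rewrite mulr_ge0 // exprn_ge0.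
elim: phi A B => [i|||a IHa b IHb|a IHa b IHb] A B AX BY Ap Bp /=.
- rewrite expr0 mul1r; apply: (@rectangle_bound (cellof i)) => // x y xA yB.
  apply: var_rect; [exact: subsetP AX _ _ | exact: subsetP BY _ _ | exact: Ap | exact: Bp].
- rewrite (_ : B = set0).
    by rewrite big1 => [|x _]; [rewrite normr0 mulr_ge0|rewrite big_set0].
  by apply/setP=> y; rewrite inE; apply/negP=> /Bp.
- rewrite (_ : A = set0); first by rewrite big_set0 normr0 mulr_ge0.
  by apply/setP=> x; rewrite inE; apply/negP=> /Ap.
- pose B1 := [set y in B | ~~ feval (ency y) a].
  have H1 := IHa A B1 AX _ _ _; have H2 := IHb A (B :\: B1) AX _ _ _.
  have -> : \sum_(x in A) \sum_(y in B) G x y =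
     \sum_(x in A) \sum_(y in B1) G x y + \sum_(x in A) \sum_(y in B :\: B1) G x y.
    rewrite -big_split; apply: eq_bigr => x _ /=; rewrite (big_setID B1) /=.
    by congr (_ + _); apply: eq_bigl => y; rewrite !inE; case: (y \in B).
  apply: (le_trans (ler_normD _ _)).
  apply: (@le_trans _ _ (2 ^+ fdepth a * (8^-1 ^+ s * W) + 2 ^+ fdepth b * (8^-1 ^+ s * W))).
    apply: lerD; [apply: H1|apply: H2].
    + by apply: subset_trans BY; apply/subsetP=> y; rewrite inE => /andP[].
    + by move=> x /Ap /andP[].
    + by move=> y; rewrite inE => /andP[].
    + by apply: subset_trans BY; apply: subsetDl.
    + by move=> x /Ap /andP[].
    + by move=> y; rewrite !inE negb_and => /andP[+ yB]; rewrite yB /= negbK => fa; have := Bp y yB; rewrite /= fa.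
  rewrite -mulrDl ler_wpM2r // exprS mulr2n mulrDl !mul1r.
  by apply: lerD; rewrite ler_weXn2l // ?leq_maxl ?leq_maxr.
- pose A1 := [set x in A | feval (encx x) a].
  have H1 := IHa A1 B _ BY _ _; have H2 := IHb (A :\: A1) B _ BY _ _.
  have -> : \sum_(x in A) \sum_(y in B) G x y =
     \sum_(x in A1) \sum_(y in B) G x y + \sum_(x in A :\: A1) \sum_(y in B) G x y.
    rewrite (big_setID A1) /=.
    by congr (_ + _); apply: eq_bigl => x; rewrite !inE; case: (x \in A).
  apply: (le_trans (ler_normD _ _)).
  apply: (@le_trans _ _ (2 ^+ fdepth a * (8^-1 ^+ s * W) + 2 ^+ fdepth b * (8^-1 ^+ s * W))).
    apply: lerD; [apply: H1|apply: H2].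
    + by apply: subset_trans AX; apply/subsetP=> x; rewrite inE => /andP[].
    + by move=> x; rewrite inE => /andP[].
    + by move=> y /Bp; rewrite /= negb_or => /andP[].
    + by apply: subset_trans AX; apply: subsetDl.
    + by move=> x; rewrite !inE negb_and => /andP[+ xA]; rewrite xA /= => /negPf fa; have := Ap x xA; rewrite /= fa.
    + by move=> y /Bp; rewrite /= negb_or => /andP[].
  rewrite -mulrDl ler_wpM2r // exprS mulr2n mulrDl !mul1r.
  by apply: lerD; rewrite ler_weXn2l // ?leq_maxl ?leq_maxr.
Qed.

Lemma formula_depth (phi : mform n) :
    (0 < #|X|)%N -> (0 < #|Y|)%N ->
    {in X0, forall x, feval (encx x) phi} -> {in Y0, forall y, ~~ feval (ency y) phi} ->
  (3 * s <= fdepth phi + 2)%N.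
Proof.
move=> X1 Y1 Xp Yp; have := formula_discrepancy (subxx _) (subxx _) Xp Yp.
move/(le_trans (ler_norm _)) => H.
have W1 : 0 < W by rewrite mulr_gt0 // ltr0n.
have : W <= 4 * (2 ^+ fdepth phi * (8^-1 ^+ s * W)) by have := total_bound; lra.
have -> : 4 * (2 ^+ fdepth phi * (8^-1 ^+ s * W)) = 4 * 2 ^+ fdepth phi * 8^-1 ^+ s * W.
  by move: W (8^-1 ^+ s) (2 ^+ _) => a b c; ring.
rewrite -[X in X <= _]mul1r ler_pM2r // exprVn ler_pdivlMr ?exprn_gt0 // mul1r.
rewrite (_ : 4 = 2 ^+ 2 :> rat) // (_ : 8 = 2 ^+ 3 :> rat) // -exprM -exprD.
by rewrite ler_eXn2l // addnC.
Qed.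
End LowerBound.
End DiscrepancyMethod.

(** * Labellings of a sparse incidence structure *)

Definition config (V : finType) (F : finFieldType) kappa := {ffun V -> 'rV[F]_kappa}.
HB.instance Definition _ V F kappa := Finite.on (config V F kappa).
HB.instance Definition _ V F kappa := GRing.Zmodule.on (config V F kappa).

Section Labellings.
Import Order.TTheory GRing.Theory Num.Theory.
Local Open Scope ring_scope.

(** 256 is [4 * 8 ^ 2]: the 4 pays for the loss in [discrepancy], the square for the root taken
    afterwards. *)
Lemma small_factor (N Q : rat) (M m n : nat) :
    1 <= N -> 3 * (256 * N ^+ 2) ^+ M <= Q -> (n <= M * m)%N ->
  4 ^+ n * (3 / Q) ^+ m <= ((8 * N)^-1 ^+ n) ^+ 2.
Proof.
move=> N1 + nm; have [B BE] : exists B, B = 256 * N ^+ 2 by exists (256 * N ^+ 2).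
rewrite -BE => bigQ; have N0 : 0 < N := lt_le_trans ltr01 N1.
have B1 : 1 <= B by rewrite BE; nra.
have B0 : 0 < B := lt_le_trans ltr01 B1.
have iB0 : 0 <= B^-1 by rewrite invr_ge0 ltW.
have iB1 : B^-1 <= 1 by rewrite invf_le1.
have Z0 : 0 < B ^+ M := exprn_gt0 M B0.
have Q0 : 0 < Q by apply: lt_le_trans bigQ; exact: mulr_gt0.
have le2 : (3 / Q) ^+ m <= B^-1 ^+ n.
  apply: le_trans (ler_wiXn2l iB0 iB1 nm); rewrite exprM exprVn; apply: lerXn2r.
  - rewrite nnegrE; exact: divr_ge0 (ler0n _ 3) (ltW Q0).
  - rewrite nnegrE invr_ge0; exact: ltW.
  - by rewrite (ler_pdivrMr _ _ Q0) mulrC (ler_pdivlMr _ _ Z0).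
apply: (@le_trans _ _ (4 ^+ n * B^-1 ^+ n)); first by apply: ler_wpM2l le2; apply: exprn_ge0.
rewrite -exprMn -exprM mulnC exprM; apply: eq_ler; congr (_ ^+ n).
by rewrite BE; field; rewrite gt_eqF.
Qed.

Section Configurations.
Variables (V J : finType) (F : finFieldType) (kappa s D : nat).
Local Notation E := (V * J)%type.
Variables (node : bool * bool -> E -> V) (base : bool * bool -> V -> J -> V) (pt : J * bool -> F).
Hypothesis node_inj : forall p x y k, node p (x, k) = node p (y, k) -> x = y.
Hypothesis baseK : forall p z k, node p (base p z k, k) = z.
Hypothesis node_neq : forall p p' e, node p e = node p' e -> p = p'.
Hypothesis pt_inj : injective pt.
Hypothesis kappa_gt1 : (1 < kappa)%N.
Hypothesis kappaD : (8 * D <= kappa)%N.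

Definition crowd (P : {set V}) z := [set q : E * (bool * bool) |
  (node q.2 q.1 == z) && [exists p', (p' != q.2) && (node p' q.1 \in P)]].

Hypothesis sparse : forall P, P != set0 -> (#|P| <= 2 * s)%N ->
  exists2 z, z \in P & (#|crowd P z| < kappa)%N.
Hypothesis few_double : forall P : {set V}, (#|P| <= 2 * s)%N ->
  (#|[set e : E | [exists p, exists p', [&& p != p', node p e \in P & node p' e \in P]]]|
     <= D * #|P|)%N.

Local Notation config := (config V F kappa).
Local Notation Q := (#|F|%:R : rat).

Definition side_node (a : bool) (b : bool) (e : E) : V := node (a, b) e.
Definition side_val (a : bool) (w : config) (e : E) (b : bool) : F :=
  ev (w (side_node a b e)) (pt (e.2, b)).

Lemma side_valD a x y e b : side_val a (x + y) e b = side_val a x e b + side_val a y e b.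
Proof. by rewrite /side_val ffunE evD. Qed.

Let kappa_gt0 : (0 < kappa)%N. Proof. exact: ltnW. Qed.

Lemma side_node_inj a (h h' : E * bool) :
  side_node a h.2 h.1 = side_node a h'.2 h'.1 -> (h.1.2, h.2) = (h'.1.2, h'.2) -> h = h'.
Proof.
case: h h' => [[x k] b] [[x' k'] b'] /= e1 [ek eb]; move: ek eb e1 => -> ->.
by move/node_inj->.
Qed.

(** Distinct half-edges at a node read its polynomial at distinct points, so a scaled Lagrange basis
    polynomial at that node is the unit. *)
Lemma side_units a : has_units (side_node a) (side_val a) kappa.
Proof.
move=> H h c hH dH; pose z := side_node a h.2 h.1.
pose A := [set h' in H :\ h | side_node a h'.2 h'.1 == z].
have [||g [g1 g0]] := @ev_unit F kappa _ A (fun h' => pt (h'.1.2, h'.2)) (pt (h.1.2, h.2)).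
- apply: leq_trans dH; rewrite /deg [X in (_ < X)%N](cardsD1 h) inE hH eqxx ltnS.
  by apply/subset_leq_card/subsetP=> h'; rewrite !inE -andbA.
- move=> h'; rewrite !inE => /andP[/andP[nh _] /eqP zh']; apply: contraNneq nh => /pt_inj e2.
  by apply/eqP/(side_node_inj zh').
exists [ffun z' => if z' == z then c *: g else 0].
  by rewrite /side_val ffunE eqxx evZ g1 mulr1.
move=> h' h'H; rewrite /side_val ffunE; case: eqP => [zh'|_].
  by rewrite evZ g0 ?mulr0 // inE h'H zh' eqxx.
by rewrite /ev raddf0 horner0.
Qed.

Lemma card_halves (T : {set E}) : #|halves T| = (2 * #|T|)%N.
Proof.
have -> : halves T = setX T [set: bool] by apply/setP=> h; rewrite !inE andbT.
by rewrite cardsX cardsT card_bool mulnC.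
Qed.

(** [P] contains both ports of every cell of [S'] on this side, so each half-edge at a node counts
    towards its crowd. *)
Lemma side_degenerate a (S : {set E}) : (#|S| <= s)%N -> degenerate (side_node a) kappa S.
Proof.
move=> cS S' S'S S'0; pose P := [set side_node a h.2 h.1 | h in halves S'].
have cP : (#|P| <= 2 * s)%N.
  apply: leq_trans (leq_imset_card _ _) _; rewrite card_halves leq_mul2l /=.
  exact: leq_trans (subset_leq_card S'S) cS.
have P0 : P != set0.
  case/set0Pn: S'0 => e eS'; apply/set0Pn; exists (side_node a true e).
  by apply/imsetP; exists (e, true); rewrite ?inE.
have [p /imsetP[h hS' ep] cr] := sparse P0 cP.
exists h => //; rewrite -ep; apply: leq_ltn_trans cr.
pose emb (h : E * bool) : E * (bool * bool) := (h.1, (a, h.2)).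
have emb_inj : injective emb by move=> [e b] [e' b'] [-> ->].
rewrite /deg -(card_imset _ emb_inj); apply/subset_leq_card/subsetP=> _ /imsetP[h' + ->].
rewrite !inE => /andP[h'S' h'p]; rewrite h'p /=; apply/existsP; exists (a, ~~ h'.2).
rewrite xpair_eqE eqxx /=; apply/andP; split; first by case: (h'.2).
by apply/imsetP; exists (h'.1, ~~ h'.2); rewrite ?inE.
Qed.

Definition saturated a (S : {set E}) := [set z | (kappa < deg (side_node a) (halves S) z)%N].

Lemma card_saturated a (S : {set E}) : (kappa * #|saturated a S| <= 2 * #|S|)%N.
Proof.
rewrite -card_halves.
have -> : #|halves S| = (\sum_z deg (side_node a) (halves S) z)%N.
  rewrite -sum1_card (partition_big (fun h => side_node a h.2 h.1) predT) //=.
  by apply: eq_bigr => z _; rewrite sum1dep_card.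
rewrite [X in (_ <= X)%N](bigID (mem (saturated a S))) /=.
apply: leq_trans (leq_addr _ _); rewrite mulnC -sum_nat_const.
by apply: leq_sum => z; rewrite inE => /ltnW.
Qed.

Definition unsat_cells a (S : {set E}) :=
  [set e in S | [forall b, side_node a b e \notin saturated a S]].

Lemma unsat_cellsPn a (S : {set E}) e : e \in S -> e \notin unsat_cells a S ->
  exists b, side_node a b e \in saturated a S.
Proof.
move=> eS; rewrite in_set eS /= negb_forall => /existsP[b /negPn nb].
by exists b.
Qed.

(** Both players together have at most [4 * #|S| / kappa] saturated nodes, so by [few_double] at
    most half of the cells have two ports there. Every other cell is unsaturated on some side, and
    one side receives a quarter of [S]. *)
Lemma unsaturated_side (S : {set E}) : (#|S| <= s)%N ->
  exists a, exists2 S1 : {set E}, S1 \subset S /\ (#|S| <= 4 * #|S1|)%N &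
    {in halves S1, forall h, (deg (side_node a) (halves S) (side_node a h.2 h.1) <= kappa)%N}.
Proof.
have arith (x y z u v : nat) :
  (x <= y + z -> z <= u + v -> 2 * y <= x -> 4 * u < x -> x <= 4 * v)%N by lia.
move=> cS; pose P := saturated true S :|: saturated false S.
have kP : (kappa * #|P| <= 4 * #|S|)%N.
  apply: (@leq_trans (kappa * (#|saturated true S| + #|saturated false S|))%N).
    by rewrite leq_mul2l leq_card_setU orbT.
  by rewrite mulnDr; have := card_saturated true S; have := card_saturated false S; lia.
have cP : (#|P| <= 2 * s)%N.
  rewrite -(leq_pmul2l kappa_gt0); apply: (leq_trans kP).
  by rewrite mulnA leq_mul // -[4%N]/(2 * 2)%N leq_mul2r.
pose S0 := [set e : E | [exists p, exists p', [&& p != p', node p e \in P & node p' e \in P]]].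
have cS0 : (2 * #|S0| <= #|S|)%N.
  have h1 : (#|S0| <= D * #|P|)%N := few_double cP.
  have h2 : (8 * D * #|P| <= 4 * #|S|)%N.
    by apply: leq_trans kP; rewrite leq_mul2r kappaD orbT.
  by move: h1 h2; rewrite -mulnA; move: #|S0| #|S| (D * #|P|)%N => x y z; lia.
pose S1 a := unsat_cells a S.
have Sub : S \subset S0 :|: (S1 true :|: S1 false).
  apply/subsetP=> e eS; apply/setUP.
  case: (boolP (e \in S1 true)) => [e1|ne1]; first by right; apply/setUP; left; exact: e1.
  case: (boolP (e \in S1 false)) => [e2|ne2]; first by right; apply/setUP; right; exact: e2.
  have [b nb] := unsat_cellsPn eS ne1; have [b' nb'] := unsat_cellsPn eS ne2.
  left; rewrite in_set; apply/existsP; exists (true, b); apply/existsP; exists (false, b').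
  apply/and3P; split; [by rewrite xpair_eqE | |]; apply/setUP; [left; exact: nb|right; exact: nb'].
have c1 : (#|S| <= #|S0| + #|S1 true :|: S1 false|)%N.
  exact: leq_trans (subset_leq_card Sub) (leq_card_setU _ _).
have c2 : (#|S1 true :|: S1 false| <= #|S1 true| + #|S1 false|)%N by apply: leq_card_setU.
have good a : {in halves (S1 a), forall h, (deg (side_node a) (halves S) (side_node a h.2 h.1) <= kappa)%N}.
  by move=> h; rewrite in_set in_set => /andP[_ /forallP/(_ h.2)]; rewrite in_set -leqNgt.
have sub a : S1 a \subset S by apply/subsetP=> e; rewrite in_set => /andP[].
have [c3|c3] := leqP #|S| (4 * #|S1 true|).
  by exists true, (S1 true); [split; [exact: sub|]|exact: good].
exists false, (S1 false); [split; [exact: sub|]|exact: good].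
exact: arith c1 c2 cS0 c3.
Qed.

Definition matching_set a (S : {set E}) :=
  [forall h in halves S, forall h' in halves S,
     (side_node a h.2 h.1 == side_node a h'.2 h'.1) ==> (h == h')].

(** In a maximal matching every cell of [S1] shares a node with a matching cell; there are
    [2 * #|Sm|] halves to meet, each at a node with [2 * #|J|] half-edges. *)
Lemma large_matching a (S1 : {set E}) :
  exists2 Sm : {set E}, Sm \subset S1 /\ (#|S1| <= 4 * #|J| * #|Sm|)%N &
    {in halves Sm &, forall h h', side_node a h.2 h.1 = side_node a h'.2 h'.1 -> h = h'}.
Proof.
have m0 : (set0 \subset S1) && matching_set a set0.
  by rewrite sub0set; apply/forallP=> h; rewrite !inE.
have [Sm /maxsetP[/andP[SmS1 mSm] max] _] :=
  @maxset_exists _ (fun T : {set E} => (T \subset S1) && matching_set a T) set0 m0.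
have mP (T : {set E}) : matching_set a T ->
    {in halves T &, forall h h', side_node a h.2 h.1 = side_node a h'.2 h'.1 -> h = h'}.
  move=> /forallP mT h h' hT h'T ehh'; move: (mT h); rewrite hT /= => /forallP/(_ h').
  by rewrite h'T /= ehh' eqxx /= => /eqP.
exists Sm; last exact: mP.
split=> //; pose at_node (q : (E * bool) * (J * bool)) : E :=
  (base (a, q.2.2) (side_node a q.1.2 q.1.1) q.2.1, q.2.1).
have sub : S1 \subset [set at_node q | q in setX (halves Sm) [set: J * bool]].
  apply/subsetP=> e eS1.
  have hit (b b' : bool) e' : e' \in Sm -> side_node a b e = side_node a b' e' ->
      e \in [set at_node q | q in setX (halves Sm) [set: J * bool]].
    move=> e'Sm eq_n; apply/imsetP; exists ((e', b'), (e.2, b)); first by rewrite !inE /= e'Sm.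
    rewrite /at_node /=; case: e {eS1} eq_n => x k eq_n; congr (_, _).
    by apply: (@node_inj (a, b) _ _ k); rewrite baseK.
  have [eSm|eSm] := boolP (e \in Sm); first exact: (hit true true e).
  case: (boolP (matching_set a (e |: Sm))) => [mm|].
    have := max (e |: Sm); rewrite subUset sub1set eS1 SmS1 mm subsetUr => /(_ isT isT) es.
    by move: eSm; rewrite -es setU11.
  rewrite negb_forall => /existsP[h]; rewrite negb_imply negb_forall => /andP[hT /existsP[h']].
  rewrite negb_imply => /andP[h'T]; rewrite negb_imply => /andP[/eqP hh' nhh'].
  move: hT h'T; rewrite !inE.
  case: h h' hh' nhh' => [e1 b1] [e2 b2] /= hh' nhh' /orP[/eqP e1e|e1S] /orP[/eqP e2e|e2S].
  - move: hh' nhh'; rewrite e1e e2e => /node_neq[->].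
    by rewrite eqxx.
  - by move: hh'; rewrite e1e; apply: hit.
  - by move/esym: hh'; rewrite e2e; apply: hit.
  - by move: (mP _ mSm (e1, b1) (e2, b2)); rewrite !inE => /(_ e1S e2S hh') eh; rewrite eh eqxx in nhh'.
apply: leq_trans (leq_trans (subset_leq_card sub) (leq_imset_card _ _)) _.
rewrite cardsX card_halves cardsT [#|{: J * bool}|]card_prod card_bool.
by move: #|J| #|Sm| => x y; lia.
Qed.

Definition nonvanishing a : {set config} := [set w | [forall e, side_val a w e true != 0]].

(** A union bound: by [average] each single value is zero for exactly one labelling in [#|F|]. *)
Lemma card_nonvanishing a : (4 * #|{: E}| <= #|F|)%N ->
  (3 * #|config| <= 4 * #|nonvanishing a|)%N.
Proof.
move=> EF; have Q0 := Q_gt0 F.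
have one e : (#|F| * #|[set w : config | side_val a w e true == 0%R]| = #|config|)%N.
  apply/eqP; rewrite -(eqr_nat rat) natrM.
  have dH : (deg (side_node a) [set (e, true)] (side_node a true e) <= kappa)%N.
    apply: leq_trans kappa_gt0; rewrite /deg -[X in (_ <= X)%N](cards1 (e, true)).
    by apply/subset_leq_card/subsetP=> h; rewrite inE => /andP[].
  have := @average E V F config (side_node a) (side_val a) kappa (@side_valD a)
    (@side_units a) [set (e, true)] (e, true) (fun _ c => (c == 0)%:R) (set11 _) dH (fun _ _ _ _ => erefl).
  move=> /= avg.
  have -> : #|[set w : config | side_val a w e true == 0]|%:R =
            \sum_(w : config) (side_val a w e true == 0)%:R :> rat.
    rewrite -sum1_card natr_sum big_mkcond; apply: eq_bigr => w _.
    by rewrite inE; case: (_ == _).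
  rewrite avg (eq_bigr (fun=> 1)) => [|w _]; first by rewrite sumr_const.
  by rewrite (bigD1 0) //= eqxx big1 ?addr0 // => c /negPf->.
have cover : ~: nonvanishing a \subset \bigcup_e [set w : config | side_val a w e true == 0].
  apply/subsetP=> w; rewrite !inE negb_forall => /existsP[e /negPn we].
  by apply/bigcupP; exists e => //; rewrite inE.
have c1 : (#|F| * #|~: nonvanishing a| <= #|{: E}| * #|config|)%N.
  apply: (@leq_trans (#|F| * \sum_(e : E) #|[set w : config | side_val a w e true == 0%R]|)%N).
    rewrite leq_mul2l (leq_trans (subset_leq_card cover)) ?orbT //.
    elim/big_rec2: _ => [|i n A _ IH]; first by rewrite cards0.
    by apply: leq_trans (leq_card_setU _ _) _; rewrite leq_add2l.
  rewrite big_distrr /=; under eq_bigr => e _ do rewrite one.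
  by rewrite sum_nat_const.
have c2 : (#|nonvanishing a| + #|~: nonvanishing a| = #|config|)%N := cardsC _.
have c3 : (4 * #|~: nonvanishing a| <= #|config|)%N.
  have F0 : (0 < #|F|)%N by apply/card_gt0P; exists 0.
  rewrite -(leq_pmul2l F0); move: c1 EF; clear.
  by move: #|F| #|~: _| #|{: E}| #|config| => q x e w c1 EF; nia.
by move: c2 c3; lia.
Qed.
Variable beta : E -> F.
Definition conflict e (x y : config) : bool := delta (side_val true) (side_val false) beta e x y.
Local Notation Nr := (#|{: E}|%:R : rat).

Lemma side_discrepancy (S : {set E}) (A B : {set config}) :
    (0 < #|{: E}|)%N -> (3 * (256 * #|{: E}| ^ 2) ^ (16 * #|J|) <= #|F|)%N ->
    (#|S| <= s)%N -> A \subset nonvanishing true -> B \subset nonvanishing false ->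
  `|\sum_(x in A) \sum_(y in B) \prod_(e in S) (Q * (conflict e x y)%:R - 1)|
    <= #|{: config}|%:R * #|{: config}|%:R * (8 * Nr)^-1 ^+ #|S|.
Proof.
move=> E0 bigF Ss /subsetP Atrue /subsetP Bfalse.
have A0 : {in A, forall x e, side_val true x e true != 0}.
  by move=> x /Atrue; rewrite inE => /forallP.
have B0 : {in B, forall x e, side_val false x e true != 0}.
  by move=> x /Bfalse; rewrite inE => /forallP.
have [a [S1 [S1S c1] un]] := unsaturated_side Ss.
(* The unsaturated side becomes the Cauchy-Schwarz variable and the opposite side supplies the
   matching. The conflict is symmetric in the players, so both cases are instances of
   [discrepancy]. *)
have [Sm [SmS1 c2] mt] := large_matching (~~ a) S1.
have sq : (\sum_(x in A) \sum_(y in B) \prod_(e in S) (Q * (conflict e x y)%:R - 1)) ^+ 2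
    <= (#|{: config}|%:R * #|{: config}|%:R) ^+ 2 * (4 ^+ #|S| * (3 / Q) ^+ #|Sm|).
  case: a un mt => un mt.
    rewrite exchange_big /=.
    have -> : \sum_(y in B) \sum_(x in A) \prod_(e in S) (Q * (conflict e x y)%:R - 1) =
      \sum_(y in B) \sum_(x in A) \prod_(e in S) disc (side_val false) (side_val true) beta e y x.
      apply: eq_bigr => y _; apply: eq_bigr => x _; apply: eq_bigr => e _.
      rewrite /disc /conflict /delta; congr (_ * (nat_of_bool (_ == _))%:R - _).
      by rewrite mulrC -!addrA; congr (_ + _); rewrite addrC.
    exact: (discrepancy beta kappa_gt0 (@side_valD false) (@side_valD true) (@side_units false)
      (@side_units true) S1S SmS1 (side_degenerate false Ss) (side_degenerate true Ss) un mt B0 A0).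
  exact: (discrepancy beta kappa_gt0 (@side_valD true) (@side_valD false) (@side_units true)
    (@side_units false) S1S SmS1 (side_degenerate true Ss) (side_degenerate false Ss) un mt A0 B0).
have N1 : 1 <= Nr by rewrite ler1n.
have nm : (#|S| <= 16 * #|J| * #|Sm|)%N.
  apply: (leq_trans c1); apply: (@leq_trans (4 * (4 * #|J| * #|Sm|))%N); first by rewrite leq_mul2l c2.
  by rewrite !mulnA.
have bigQ : 3 * (256 * Nr ^+ 2) ^+ (16 * #|J|) <= Q.
  by rewrite -natrX -natrM -natrX -natrM ler_nat.
have fac := small_factor N1 bigQ nm.
have W0 : 0 <= #|{: config}|%:R * #|{: config}|%:R :> rat by rewrite mulr_ge0.
have t0 : 0 <= (8 * Nr)^-1 ^+ #|S| by rewrite exprn_ge0 // invr_ge0 mulr_ge0.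
rewrite -(@ler_pXn2r _ 2) ?nnegrE ?normr_ge0 //; last exact: mulr_ge0.
rewrite real_normK ?num_real //; apply: (le_trans sq).
by rewrite [X in _ <= X]exprMn; apply: ler_wpM2l fac; apply: exprn_ge0.
Qed.

Lemma game_depth n (cellof : 'I_n -> E) (encx ency : config -> n.-tuple bool) (phi : mform n) :
    (0 < #|{: E}|)%N -> (3 * (256 * #|{: E}| ^ 2) ^ (16 * #|J|) <= #|F|)%N ->
    (4 * #|{: E}| <= #|F|)%N ->
    (forall i x y, x \in nonvanishing true -> y \in nonvanishing false ->
       tnth (encx x) i -> ~~ tnth (ency y) i -> ~~ conflict (cellof i) x y) ->
    {in nonvanishing true, forall x, feval (encx x) phi} ->
    {in nonvanishing false, forall y, ~~ feval (ency y) phi} ->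
  (3 * s <= fdepth phi + 2)%N.
Proof.
move=> E0 bigF EF var_rect phi1 phi0.
have X0 : (0 < #|{: config}|)%N by apply/card_gt0P; exists 0.
have large : #|{: config}|%:R * #|{: config}|%:R
    <= 2 * (#|nonvanishing true|%:R * #|nonvanishing false|%:R) :> rat.
  have := card_nonvanishing true EF; have := card_nonvanishing false EF.
  rewrite -!natrM ler_nat; move: #|config| #|nonvanishing true| #|nonvanishing false| => w u v; nia.
apply: (formula_depth E0 _ large var_rect X0 X0 phi1 phi0) => S A B Ss AX BY.
exact: side_discrepancy.
Qed.

(** A pair of labellings has [2 * kappa * #|V|] coefficients, a target has [#|V| * #|J|] entries. *)
Lemma target_exists : (2 * kappa < #|J|)%N -> (0 < #|V|)%N ->
  exists b : {ffun E -> F}, forall x y : config, exists e,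
    side_val true x e true * side_val false y e true + side_val true x e false +
      side_val false y e false != b e.
Proof.
move=> kJ V0; pose tgt (q : config * config) : {ffun E -> F} :=
  [ffun e => side_val true q.1 e true * side_val false q.2 e true + side_val true q.1 e false +
      side_val false q.2 e false].
have F1 : (1 < #|F|)%N.
  by apply/card_gt1P; exists 0, 1; rewrite ?inE // eq_sym oner_eq0.
have lt : (#|[set tgt q | q in [set: config * config]]| < #|{ffun E -> F}|)%N.
  apply: leq_ltn_trans (leq_imset_card _ _) _.
  have cc : #|{: config}| = (#|F| ^ (kappa * #|V|))%N.
    transitivity #|{ffun V -> 'rV[F]_kappa}|; first by [].
    by rewrite card_ffun card_mx mul1n -expnM.
  rewrite cardsT [#|{: config * config}|]card_prod cc card_ffun card_prod -expnD.
  rewrite ltn_exp2l //; move: kJ V0; clear.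
  by move: #|V| #|J| => v l; nia.
have [b] : exists b, b \notin [set tgt q | q in [set: config * config]].
  apply/existsP; rewrite -negb_forall; apply: contraL lt => /forallP all_in.
  rewrite -leqNgt; apply/subset_leq_card/subsetP=> b _; exact: all_in.
move=> nb; exists b => x y.
apply/existsP; apply: contraR nb; rewrite negb_exists => /forallP E_eq.
apply/imsetP; exists (x, y) => //; apply/ffunP=> e; rewrite ffunE.
by move: (E_eq e); rewrite negbK => /eqP.
Qed.
End Configurations.
End Labellings.

(** * The game *)

Section GameFunctions.
Import Order.TTheory GRing.Theory Num.Theory.
Local Open Scope ring_scope.

Section Game.
Variables (V : finZmodType) (J : finType) (F : finFieldType) (kappa m r tau : nat).
Local Notation E := (V * J)%type.
Variables (node : bool * bool -> E -> V) (base : bool * bool -> V -> J -> V).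
Variables (st : bool -> J -> V) (pt : J * bool -> F) (beta : {ffun E -> F}).
Hypothesis node_inj : forall p x y k, node p (x, k) = node p (y, k) -> x = y.
Hypothesis baseK : forall p z k, node p (base p z k, k) = z.
Hypothesis node_head : forall a e, node (a, false) e = node (a, true) e + st a e.2.
Hypothesis pt_inj : injective pt.
Hypothesis J0 : (0 < #|J|)%N.
Hypothesis kappaJ : (4 * kappa <= #|J|)%N.
Hypothesis kappam : (6 * kappa <= m)%N.
Hypothesis m0 : (0 < m)%N.
Hypothesis r0 : (0 < r)%N.
Hypothesis Jm : (#|J| <= r * m)%N.
Hypothesis cut_large : forall a (Z : {set V}),
  (m * (#|Z| * #|~: Z|) <= #|V| * \sum_k cut Z (st a k))%N.
Hypothesis Vtau : (#|V| < 2 ^ tau)%N.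

Local Notation config := (config V F kappa).
Local Notation side_val := (side_val node pt).
Hypothesis target : forall x y : config, exists e,
  side_val true x e true * side_val false y e true + side_val true x e false +
    side_val false y e false != beta e.

Definition input := E -> F -> F -> bool.
Implicit Types (P : input) (e : E).

Definition cellat a z k : E := (base (a, true) z k, k).
Definition word_val (g : 'rV[F]_kappa) k b := ev g (pt (k, b)).
(* The points (al, b) of the cell e allowed by Bob's values c, d. *)
Definition line e c d al b := (al != 0) && (al * c + b + d == beta e).
Definition fits P e c d := [forall q : F * F, P e q.1 q.2 ==> line e c d q.1 q.2].

Definition compA P z k a b := P (cellat true z k) a b.
Definition compB P z k c d := (c != 0) && fits P (cellat false z k) c d.
Definition keepA P := keep (st true) word_val (compA P).
Definition keepB P := keep (st false) word_val (compB P).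
Definition rounds := (6 * r * tau).+2.

Definition alice P := [forall z, [exists g, keepA P rounds z g]].
Definition bob P := [forall z, [exists g, keepB P rounds z g]].
Definition stuck P := [exists e, [forall q : F * F, (q.1 != 0) ==> ~~ fits P e q.1 q.2]].
Definition inhabited P := [forall e, [exists q : F * F, P e q.1 q.2]].
Definition thick P e := (1 < #|[set q : F * F | P e q.1 q.2]|)%N.
Definition many P := (#|{: E}| <= 2 * #|[set e | thick P e]|)%N.

(** [~~ bob P] is itself monotone, since additional points only make fitting harder for Bob. [stuck]
    and [inhabited] secure that at each cell the head value determines the tail value. *)
Definition game P := (stuck P || [&& inhabited P, ~~ bob P & many P]) ||
  (inhabited P && alice P) && ~~ many P.

Definition fitsA P (x : config) := forall e, P e (side_val true x e true) (side_val true x e false).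
Definition fitsB P (y : config) := forall e,
  side_val false y e true != 0 /\ fits P e (side_val false y e true) (side_val false y e false).

Lemma cellatK a e : cellat a (node (a, true) e) e.2 = e.
Proof.
case: e => x k; congr (_, _); apply: (@node_inj (a, true) _ _ k).
by rewrite baseK.
Qed.

Lemma side_val_cellat a (s : config) z k :
  side_val a s (cellat a z k) true = word_val (s z) k true /\
  side_val a s (cellat a z k) false = word_val (s (z + st a k)) k false.
Proof.
by rewrite /side_val /side_node node_head /cellat baseK.
Qed.

Lemma solution_cells a comp (s : config) :
  solution (st a) word_val comp s <->
  forall e, comp (node (a, true) e) e.2 (side_val a s e true) (side_val a s e false).
Proof.
split=> sol => [e|z k].
  have := sol (node (a, true) e) e.2; have [<- <-] := side_val_cellat a s (node (a, true) e) e.2.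
  by rewrite cellatK.
have := sol (cellat a z k); have [-> ->] := side_val_cellat a s z k.
by rewrite /cellat baseK.
Qed.

Lemma fitsA_alice P x : fitsA P x -> alice P.
Proof.
move=> fx; apply/forallP=> z; apply/existsP; exists (x z); apply: (keep_solution (s := x)).
by apply/solution_cells => e; rewrite /compA cellatK.
Qed.

Lemma fitsB_bob P y : fitsB P y -> bob P.
Proof.
move=> fy; apply/forallP=> z; apply/existsP; exists (y z); apply: (keep_solution (s := y)).
by apply/solution_cells => e; rewrite /compB cellatK; case: (fy e) => -> ->.
Qed.

Lemma fits_exclusive P x y : fitsA P x -> fitsB P y -> False.
Proof.
move=> fx fy; have [e /negP] := target x y; apply.
have [_ /forallP/(_ (side_val true x e true, side_val true x e false))] := fy e.
by rewrite fx /= => /andP[_].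
Qed.

Lemma solve a (comp : V -> J -> F -> F -> bool) (T : {set E}) :
    (forall z k c c' d, comp z k c d -> comp z k c' d -> c = c') ->
    (forall z k c c' d d', cellat a z k \in T -> comp z k c d -> comp z k c' d' -> c = c') ->
    (#|{: E}| <= 2 * #|T|)%N ->
    (forall z, exists g, keep (st a) word_val comp rounds z g) ->
  exists s : config, solution (st a) word_val comp s.
Proof.
move=> comp_head comp_T half ex.
pose Sg := [set q : E | cellat a q.1 q.2 \in T].
have cS : #|Sg| = #|T|.
  rewrite -(@card_preimset _ (fun q : E => cellat a q.1 q.2) T); last first.
    move=> [z k] [z' k'] [ez ek]; subst k'; congr (_, _).
    by rewrite -(baseK (a, true) z k) ez baseK.
  by apply: eq_card => q; rewrite !inE.
apply: (percolation (kappa := kappa) (m := m) (r := r) (tau := tau) (Sg := Sg)) => //.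
- move=> g g' B kB gg'; apply: (@ev_eq F kappa J B (fun k => pt (k, true))) => //.
  by move=> k k' _ _ /pt_inj[].
- by move=> z k c c' d d'; rewrite inE; apply: comp_T.
- by rewrite cS -card_prod.
Qed.

Lemma bob_fits P : inhabited P -> many P -> bob P -> exists y, fitsB P y.
Proof.
move=> /forallP ne T /forallP bP.
have lineE e c d q : fits P e c d -> P e q.1 q.2 -> q.1 != 0 /\ q.1 * c + q.2 + d = beta e.
  by move=> /forallP/(_ q)/implyP f /f/andP[-> /eqP].
have [||z|y sol] := @solve false (compB P) [set e | thick P e] _ _ T.
(* A point of the cell and the value [d] give [c], because the first coordinate of the point is
   non-zero. *)
- move=> z k c c' d /andP[_ fc] /andP[_ fc'].
  have /existsP[q Pq] := ne (cellat false z k).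
  have [q0 e1] := lineE _ _ _ _ fc Pq; have [_ e2] := lineE _ _ _ _ fc' Pq.
  by move: e1; rewrite -e2 => /addIr/addIr/(mulfI q0).
(* Two points of the cell lie on Bob's line and differ in the first coordinate, so they fix its
   slope. *)
- move=> z k c c' d d'; rewrite inE => /card_gt1P[q [q' []]]; rewrite !inE => Pq Pq' nqq.
  move=> /andP[_ fc] /andP[_ fc'].
  have [_ e1] := lineE _ _ _ _ fc Pq; have [_ e2] := lineE _ _ _ _ fc Pq'.
  have [_ e3] := lineE _ _ _ _ fc' Pq; have [_ e4] := lineE _ _ _ _ fc' Pq'.
  have E1 : (q.1 - q'.1) * c = q'.2 - q.2.
    have : q.1 * c + q.2 = q'.1 * c + q'.2 by apply: (@addIr _ d); rewrite e1 e2.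
    by move=> h; apply/eqP; rewrite mulrBl subr_eq addrAC [q'.2 + _]addrC -h addrK.
  have E2 : (q.1 - q'.1) * c' = q'.2 - q.2.
    have : q.1 * c' + q.2 = q'.1 * c' + q'.2 by apply: (@addIr _ d'); rewrite e3 e4.
    by move=> h; apply/eqP; rewrite mulrBl subr_eq addrAC [q'.2 + _]addrC -h addrK.
  have [q1|q1] := eqVneq q.1 q'.1.
    move: E1; rewrite q1 subrr mul0r => /esym/eqP; rewrite subr_eq0 => /eqP q2.
    by move: nqq; rewrite (surjective_pairing q) (surjective_pairing q') q1 q2 eqxx.
  by move: E1; rewrite -E2; apply: mulfI; rewrite subr_eq0.
- by apply/existsP; apply: bP.
exists y => e; have /solution_cells/(_ e) := sol.
by rewrite /compB cellatK => /andP.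
Qed.

Lemma alice_fits P : ~~ stuck P -> ~~ many P -> alice P -> exists x, fitsA P x.
Proof.
move=> ns T /forallP aP.
have half : (#|{: E}| <= 2 * #|~: [set e | thick P e]|)%N.
  move: T; rewrite /many -ltnNge; have := cardsC [set e | thick P e].
  by move: #|{: E}| #|_| #|~: _| => u v w <-; lia.
have [||z|x sol] := @solve true (compA P) (~: [set e | thick P e]) _ _ half.
(* As the cell is not stuck, its points lie on one line with [c != 0], where [b] determines [a]. *)
- move=> z k a a' b Pa Pa'; move: ns; rewrite negb_exists => /forallP/(_ (cellat true z k)).
  rewrite negb_forall => /existsP[[c d]]; rewrite negb_imply negbK /= => /andP[c0 /forallP f].
  have /andP[_ /eqP e1] := implyP (f (a, b)) Pa; have /andP[_ /eqP] := implyP (f (a', b)) Pa'.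
  by rewrite -e1 => /addIr/addIr/(mulIf c0).
- move=> z k a a' b b'; rewrite !inE /thick -leqNgt => /card_le1_eqP le1 Pa Pa'.
  by have := le1 (a, b) (a', b'); rewrite !inE => /(_ Pa Pa')[].
- by apply/existsP; apply: aP.
exists x => e; have /solution_cells/(_ e) := sol.
by rewrite /compA cellatK.
Qed.

Definition input_le P P' := forall e a b, P e a b -> P' e a b.

Lemma fits_anti P P' e c d : input_le P P' -> fits P' e c d -> fits P e c d.
Proof.
move=> PP' /forallP f; apply/forallP=> q; apply/implyP=> Pq.
exact: implyP (f q) (PP' _ _ _ Pq).
Qed.

Lemma stuck_mono P P' : input_le P P' -> stuck P -> stuck P'.
Proof.
move=> PP' /existsP[e /forallP se]; apply/existsP; exists e; apply/forallP=> q.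
apply/implyP=> q0; have := implyP (se q) q0; apply: contra; exact: fits_anti.
Qed.

Lemma inhabited_mono P P' : input_le P P' -> inhabited P -> inhabited P'.
Proof.
move=> PP' /forallP ne; apply/forallP=> e; have /existsP[q Pq] := ne e.
by apply/existsP; exists q; apply: PP'.
Qed.

Lemma many_mono P P' : input_le P P' -> many P -> many P'.
Proof.
move=> PP' /leq_trans; apply; rewrite leq_mul2l /=; apply/subset_leq_card/subsetP=> e.
rewrite !inE => /leq_trans; apply; apply/subset_leq_card/subsetP=> q.
by rewrite !inE; apply: PP'.
Qed.

Lemma keep_sub a (comp comp' : V -> J -> F -> F -> bool) k z (g : 'rV[F]_kappa) :
    (forall z k c d, comp z k c d -> comp' z k c d) ->
  keep (st a) word_val comp k z g -> keep (st a) word_val comp' k z g.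
Proof.
move=> sub; elim: k z g => //= k IH z g /andP[/IH-> /forallP ex]; apply/forallP=> i.
have /existsP[g' /andP[kg' cg']] := ex i; apply/existsP; exists g'.
by rewrite IH // sub.
Qed.

Lemma alice_mono P P' : input_le P P' -> alice P -> alice P'.
Proof.
move=> PP' /forallP aP; apply/forallP=> z; have /existsP[g kg] := aP z.
apply/existsP; exists g; apply: keep_sub kg => z' k c d; exact: PP'.
Qed.

Lemma bob_anti P P' : input_le P P' -> bob P' -> bob P.
Proof.
move=> PP' /forallP aP; apply/forallP=> z; have /existsP[g kg] := aP z.
apply/existsP; exists g; apply: keep_sub kg => z' k c d /andP[c0 f].
by rewrite /compB c0 (fits_anti PP' f).
Qed.

Lemma fitsB_anti P P' y : input_le P P' -> fitsB P' y -> fitsB P y.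
Proof. by move=> PP' fy e; have [y0 f] := fy e; split; last exact: fits_anti f. Qed.

(* Where the branch switches from alice to bob, alice's success makes bob fail. *)
Lemma game_mono P P' : input_le P P' -> game P -> game P'.
Proof.
move=> PP'; rewrite {2}/game; case: (boolP (stuck P')) => //= nsP'.
have nsP : ~~ stuck P by apply: contra nsP'; apply: stuck_mono.
rewrite /game (negPf nsP) /= => /orP[/and3P[ne nb T]|/andP[/andP[ne al] nT]].
  rewrite (inhabited_mono PP' ne) (many_mono PP' T) andbT /=.
  by rewrite (contra (@bob_anti P P' PP') nb).
rewrite (inhabited_mono PP' ne) (alice_mono PP' al) /=.
case: (boolP (many P')) => T'; last by rewrite orbT.
rewrite andbT orbF.
apply/negP=> /(bob_fits (inhabited_mono PP' ne) T')[y /(fitsB_anti PP') fy].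
have [x fx] := alice_fits nsP nT al.
exact: fits_exclusive fx fy.
Qed.

Lemma game_fitsA P x : fitsA P x -> game P.
Proof.
move=> fx; have ne : inhabited P.
  by apply/forallP=> e; apply/existsP; exists (side_val true x e true, side_val true x e false); apply: fx.
rewrite /game ne (fitsA_alice fx) /=; case: (boolP (many P)) => T; last by rewrite orbT.
rewrite orbF andbT; apply/orP; right; apply/negP=> /(bob_fits ne T)[y].
exact: fits_exclusive fx.
Qed.

Lemma game_fitsB P y : fitsB P y -> ~~ game P.
Proof.
move=> fy; have nsP : ~~ stuck P.
  rewrite negb_exists; apply/forallP=> e; rewrite negb_forall; apply/existsP.
  exists (side_val false y e true, side_val false y e false) => /=.
  by case: (fy e) => -> ->.
rewrite /game (negPf nsP) (fitsB_bob fy) /= andbF /=.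
apply/negP=> /andP[/andP[_ al] nT]; have [x fx] := alice_fits nsP nT al.
exact: fits_exclusive fx fy.
Qed.
End Game.
End GameFunctions.

(** * The depth of the game *)

Section GameDepth.
Import GRing.Theory.

Section FormulaDepth.
Variable n : nat.
Implicit Types (Pr : n.-tuple bool -> bool).

Definition mdep Pr d := exists2 phi : mform n, fdepth phi <= d & forall x, feval x phi = Pr x.

Lemma mdep_le Pr d d' : d <= d' -> mdep Pr d -> mdep Pr d'.
Proof. by move=> dd' [phi dphi ephi]; exists phi => //; apply: leq_trans dd'. Qed.

Lemma mdep_ext Pr Pr' d : Pr =1 Pr' -> mdep Pr d -> mdep Pr' d.
Proof. by move=> PP' [phi dphi ephi]; exists phi => // x; rewrite ephi. Qed.

Lemma mdep_const b d : 0 < d -> mdep (fun=> b) d.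
Proof. by case: b => d0; [exists MTrue|exists MFalse]. Qed.

Lemma mdep_and Pr Pr' d : mdep Pr d -> mdep Pr' d -> mdep (fun x => Pr x && Pr' x) d.+1.
Proof.
move=> [phi dphi ephi] [psi dpsi epsi]; exists (MAnd phi psi) => [|x] /=.
  by rewrite ltnS geq_max dphi.
by rewrite ephi epsi.
Qed.

Lemma mdep_or Pr Pr' d : mdep Pr d -> mdep Pr' d -> mdep (fun x => Pr x || Pr' x) d.+1.
Proof.
move=> [phi dphi ephi] [psi dpsi epsi]; exists (MOr phi psi) => [|x] /=.
  by rewrite ltnS geq_max dphi.
by rewrite ephi epsi.
Qed.

Lemma size_halves T (u : seq T) k : size u <= 2 ^ k.+1 ->
  size (take (2 ^ k) u) <= 2 ^ k /\ size (drop (2 ^ k) u) <= 2 ^ k.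
Proof. by rewrite size_take size_drop expnS; case: ltnP; lia. Qed.

Lemma mdep_all T (u : seq T) (Pr : n.-tuple bool -> T -> bool) d k :
    0 < d -> size u <= 2 ^ k -> (forall t, mdep (Pr^~ t) d) ->
  mdep (fun x => all (Pr x) u) (d + k).
Proof.
move=> d0 + Pd; elim: k u => [|k IH] u uk.
  rewrite addn0; case: u uk => [|t [|//]] _; first exact: mdep_const.
  by apply: mdep_ext (Pd t) => x; rewrite /= andbT.
have [u1 u2] := size_halves uk.
rewrite addnS; apply: mdep_ext (mdep_and (IH _ u1) (IH _ u2)) => x.
by rewrite -all_cat cat_take_drop.
Qed.

Lemma mdep_has T (u : seq T) (Pr : n.-tuple bool -> T -> bool) d k :
    0 < d -> size u <= 2 ^ k -> (forall t, mdep (Pr^~ t) d) ->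
  mdep (fun x => has (Pr x) u) (d + k).
Proof.
move=> d0 + Pd; elim: k u => [|k IH] u uk.
  rewrite addn0; case: u uk => [|t [|//]] _; first exact: mdep_const.
  by apply: mdep_ext (Pd t) => x; rewrite /= orbF.
have [u1 u2] := size_halves uk.
rewrite addnS; apply: mdep_ext (mdep_or (IH _ u1) (IH _ u2)) => x.
by rewrite -has_cat cat_take_drop.
Qed.

Lemma mdep_forall (T : finType) (Pr : n.-tuple bool -> T -> bool) d k :
    0 < d -> #|T| <= 2 ^ k -> (forall t, mdep (Pr^~ t) d) ->
  mdep (fun x => [forall t, Pr x t]) (d + k).
Proof.
move=> d0; rewrite cardE => Tk /(mdep_all d0 Tk); apply: mdep_ext => x.
by apply/allP/forallP => [H t|H t _]; apply: H; rewrite ?mem_enum.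
Qed.

Lemma mdep_exists (T : finType) (Pr : n.-tuple bool -> T -> bool) d k :
    0 < d -> #|T| <= 2 ^ k -> (forall t, mdep (Pr^~ t) d) ->
  mdep (fun x => [exists t, Pr x t]) (d + k).
Proof.
move=> d0; rewrite cardE => Tk /(mdep_has d0 Tk); apply: mdep_ext => x.
apply/hasP/existsP => [[t _ Pt]|[t Pt]]; first by exists t.
by exists t; rewrite ?mem_enum.
Qed.

(** Divide and conquer: the disjunction guesses how many hits [i] lie in the first half, at [k + 2]
    extra levels, and summing over the halvings gives the square. *)
Lemma mdep_count T (u : seq T) (Pr : n.-tuple bool -> T -> bool) d k m :
    0 < d -> size u <= 2 ^ k -> (forall t, mdep (Pr^~ t) d) ->
  mdep (fun x => m <= count (Pr x) u) (d + k * (k + 2)).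
Proof.
move=> d0 + Pd; elim: k u m => [|k IH] u m uk.
  rewrite addn0; case: u uk => [|t [|//]] _ /=; first exact: mdep_const.
  case: m => [|[|m]]; first exact: mdep_const.
    by apply: mdep_ext (Pd t) => x; rewrite addn0; case: (Pr x t).
  by apply: mdep_ext (mdep_const false d0) => x; case: (Pr x t).
have [u1 u2] := size_halves uk.
have step i : mdep (fun x => (i <= count (Pr x) (take (2 ^ k) u)) &&
    (m - i <= count (Pr x) (drop (2 ^ k) u))) (d + k * (k + 2)).+1.
  by apply: mdep_and; apply: IH.
have si : size (iota 0 (2 ^ k).+1) <= 2 ^ k.+1.
  by rewrite size_iota expnS mul2n -addnn -addn1 leq_add2l expn_gt0.
have /(@mdep_le _ _ (d + k.+1 * (k.+1 + 2))) := mdep_has (ltn0Sn _) si step.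
move/(_ _)=> H; apply: mdep_ext (H _); last by lia.
move=> x; rewrite -[in RHS](cat_take_drop (2 ^ k) u) count_cat.
apply/hasP/idP => [[i _ /andP[i1 i2]]|le]; first by lia.
exists (count (Pr x) (take (2 ^ k) u)); last by rewrite leqnn leq_subLR.
by rewrite mem_iota ltnS (leq_trans (count_size _ _)).
Qed.

Lemma mdep_card (T : finType) (Pr : n.-tuple bool -> T -> bool) d k m :
    0 < d -> #|T| <= 2 ^ k -> (forall t, mdep (Pr^~ t) d) ->
  mdep (fun x => m <= #|[set t | Pr x t]|) (d + k * (k + 2)).
Proof.
move=> d0; rewrite cardE => Tk /(mdep_count m d0 Tk); apply: mdep_ext => x.
congr (_ <= _); rewrite -sum1_count big_enum_cond -sum1_card /=.
by apply: eq_bigl => t; rewrite inE.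
Qed.
End FormulaDepth.

Section GameFunction.
Local Open Scope ring_scope.
Variables (V : finZmodType) (J : finType) (F : finFieldType).
Variables (kappa m r tau s D theta nu lam : nat).
Local Notation E := (V * J)%type.
Variables (node : bool * bool -> E -> V) (base : bool * bool -> V -> J -> V).
Variables (st : bool -> J -> V) (pt : J * bool -> F) (beta : {ffun E -> F}).
Local Notation config := (config V F kappa).
Local Notation side_val := (side_val node pt).
Local Notation input := (input V J F).

Definition bits : nat := #|{: E * F * F}|.
Definition decode (x : bits.-tuple bool) : input := fun e a b => tnth x (enum_rank (e, a, b)).
Definition game_fun : boolfun bits :=
  [ffun x => game kappa r tau base st pt beta (decode x)].

Hypothesis cardV : (#|V| <= 2 ^ nu)%N.
Hypothesis cardJ : (#|J| <= 2 ^ lam)%N.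
Hypothesis cardF : (#|F| <= 2 ^ theta)%N.

Let cardE : (#|{: E}| <= 2 ^ (nu + lam))%N.
Proof. by rewrite card_prod expnD leq_mul. Qed.

Let cardFF : (#|{: F * F}| <= 2 ^ (2 * theta))%N.
Proof. by rewrite card_prod mul2n -addnn expnD leq_mul. Qed.

Let cardG : (#|{: 'rV[F]_kappa}| <= 2 ^ (theta * kappa))%N.
Proof. by rewrite card_mx mul1n expnM; case: kappa => // k; rewrite leq_exp2r. Qed.

(** The depth of one round: a disjunction over all words, a conjunction over the cells at a node,
    and two binary gates. Trying every word is affordable because only the logarithm of their number
    enters. *)
Local Notation w := (theta * kappa + lam + 2)%N.

Lemma mdep_input e a b d : mdep (fun x => decode x e a b) d.
Proof. by exists (MVar (enum_rank (e, a, b))). Qed.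

Lemma mdep_keep (st' : J -> V) (wv : 'rV[F]_kappa -> J -> bool -> F)
    (comp : bits.-tuple bool -> V -> J -> F -> F -> bool) d i z g :
    (0 < d)%N -> (forall z k a b, mdep (fun x => comp x z k a b) d) ->
  mdep (fun x => keep st' wv (comp x) i z g) (d + i * w).
Proof.
move=> d0 cd; elim: i z g => [|i IH] z g /=; first by rewrite addn0; apply: mdep_const.
apply: (@mdep_le _ _ ((d + i * w).+1 + theta * kappa + lam).+1); first by lia.
apply: mdep_and; first by apply: mdep_le (IH z g); lia.
apply: mdep_forall => [|//|k]; first by lia.
apply: mdep_exists => // g'; apply: mdep_and; first exact: IH.
by apply: mdep_le (cd _ _ _ _); lia.
Qed.

Lemma mdep_keepN (st' : J -> V) (wv : 'rV[F]_kappa -> J -> bool -> F)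
    (comp : bits.-tuple bool -> V -> J -> F -> F -> bool) d i z g :
    (0 < d)%N -> (forall z k a b, mdep (fun x => ~~ comp x z k a b) d) ->
  mdep (fun x => ~~ keep st' wv (comp x) i z g) (d + i * w).
Proof.
move=> d0 cd; elim: i z g => [|i IH] z g /=; first by rewrite addn0; apply: mdep_const.
apply: (@mdep_le _ _ ((d + i * w).+1 + theta * kappa + lam).+1); first by lia.
apply: (@mdep_ext _ (fun x => ~~ keep st' wv (comp x) i z g ||
  [exists k, [forall g', ~~ keep st' wv (comp x) i (z + st' k) g' ||
                         ~~ comp x z k (wv g k true) (wv g' k false)]])).
  move=> x; rewrite negb_and negb_forall; congr (_ || _); apply: eq_existsb => k.
  by rewrite negb_exists; apply: eq_forallb => g'; rewrite negb_and.
apply: mdep_or; first by apply: mdep_le (IH z g); lia.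
apply: mdep_exists => [|//|k]; first by lia.
apply: mdep_forall => // g'; apply: mdep_or; first exact: IH.
by apply: mdep_le (cd _ _ _ _); lia.
Qed.

(** Not fitting means that some point off the line is present, which is a monotone condition. *)
Lemma mdep_fitsN e c d : mdep (fun x => ~~ fits beta (decode x) e c d) (1 + 2 * theta).
Proof.
apply: (@mdep_ext _ (fun x => [exists q : F * F,
    ~~ line beta e c d q.1 q.2 && decode x e q.1 q.2])).
  move=> x; rewrite /fits negb_forall; apply: eq_existsb => q.
  by rewrite negb_imply andbC.
apply: mdep_exists => // q; case: (line _ _ _ _ _ _) => /=; first exact: mdep_const.
exact: mdep_input.
Qed.

Lemma mdep_alice : mdep (fun x => alice kappa r tau base st pt (decode x))
  (1 + rounds r tau * w + theta * kappa + nu).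
Proof.
apply: mdep_forall => [|//|z]; first by lia.
apply: mdep_exists => // g; apply: mdep_keep => // z' k a b; exact: mdep_input.
Qed.

Lemma mdep_bobN : mdep (fun x => ~~ bob kappa r tau base st pt beta (decode x))
  (1 + 2 * theta + rounds r tau * w + theta * kappa + nu).
Proof.
apply: (@mdep_ext _ (fun x => [exists z, [forall g,
    ~~ keepB base st pt beta (decode x) (rounds r tau) z g]])).
  move=> x; rewrite /bob negb_forall; apply: eq_existsb => z.
  by rewrite negb_exists.
apply: mdep_exists => [|//|z]; first by lia.
apply: mdep_forall => // g; apply: mdep_keepN => // z' k c d.
have [->|c0] := eqVneq c 0.
  by apply: (@mdep_ext _ (fun=> true)) (mdep_const _ _ _) => // x; rewrite /compB eqxx.
by apply: mdep_ext (mdep_fitsN (cellat base false z' k) c d) => x; rewrite /compB c0.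
Qed.

Lemma mdep_stuck : mdep (fun x => stuck beta (decode x))
  (1 + 2 * theta + 2 * theta + (nu + lam)).
Proof.
apply: mdep_exists => [|//|e]; first by lia.
apply: mdep_forall => // q; have [q0|q0] := eqVneq q.1 0.
  by apply: (@mdep_ext _ (fun=> true)); [|exact: mdep_const].
exact: mdep_fitsN.
Qed.

Lemma mdep_inhabited : mdep (fun x => inhabited (decode x)) (1 + 2 * theta + (nu + lam)).
Proof.
apply: mdep_forall => // e; apply: mdep_exists => // q; exact: mdep_input.
Qed.

Lemma mdep_many : mdep (fun x => many (decode x))
  (1 + 2 * theta * (2 * theta + 2) + (nu + lam) * (nu + lam + 2)).
Proof.
apply: (@mdep_ext _ (fun x => (uphalf #|{: E}| <= #|[set e | thick (decode x) e]|)%N)).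
  by move=> x; rewrite /many mul2n leq_uphalf_double.
apply: mdep_card => // e; apply: mdep_card => // q; exact: mdep_input.
Qed.

Definition game_depth_bound : nat :=
  1 + 4 * theta + rounds r tau * w + theta * kappa + (nu + lam) +
  2 * theta * (2 * theta + 2) + (nu + lam) * (nu + lam + 2).

Lemma game_circuit : monotone_fun game_fun -> exists c : circuit bits,
  [/\ (depth c <= game_depth_bound + 6)%N, computes c game_fun & (#|nonzero_gates c| <= 2)%N].
Proof.
move=> mf; pose d := game_depth_bound.
have le Pr d' : (d' <= d)%N -> mdep Pr d' -> mdep Pr d by apply: mdep_le.
have [|phi1 d1 e1] := le _ _ _ _ mdep_stuck; first by rewrite /d /game_depth_bound; lia.
have [|phi2 d2 e2] := le _ _ _ _ mdep_inhabited; first by rewrite /d /game_depth_bound; lia.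
have [|phi3 d3 e3] := le _ _ _ _ mdep_bobN; first by rewrite /d /game_depth_bound; lia.
have [|phi4 d4 e4] := le _ _ _ _ mdep_many; first by rewrite /d /game_depth_bound; lia.
have [|phi5 d5 e5] := le _ _ _ _ mdep_alice; first by rewrite /d /game_depth_bound; lia.
have [|||x|c [dc cc nc]] := @one_negation_circuit _ game_fun
    (MOr phi1 (MAnd phi2 (MAnd phi3 phi4))) (MAnd phi2 phi5) phi4 (d + 3) mf.
- by rewrite /= -/d; lia.
- by rewrite /= -/d; lia.
- by rewrite (leq_trans d4) ?leq_addr.
- by rewrite ffunE /= e1 e2 e3 e4 e5.
by exists c; split=> //; rewrite -addnA in dc.
Qed.

Hypothesis node_inj : forall p x y k, node p (x, k) = node p (y, k) -> x = y.
Hypothesis baseK : forall p z k, node p (base p z k, k) = z.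
Hypothesis node_head : forall a e, node (a, false) e = node (a, true) e + st a e.2.
Hypothesis pt_inj : injective pt.
Hypothesis J0 : (0 < #|J|)%N.
Hypothesis kappaJ : (4 * kappa <= #|J|)%N.
Hypothesis kappam : (6 * kappa <= m)%N.
Hypothesis m0 : (0 < m)%N.
Hypothesis r0 : (0 < r)%N.
Hypothesis Jm : (#|J| <= r * m)%N.
Hypothesis cut_large : forall a (Z : {set V}),
  (m * (#|Z| * #|~: Z|) <= #|V| * \sum_k cut Z (st a k))%N.
Hypothesis Vtau : (#|V| < 2 ^ tau)%N.
Hypothesis target : forall x y : config, exists e,
  side_val true x e true * side_val false y e true + side_val true x e false +
    side_val false y e false != beta e.

Lemma game_fun_monotone : monotone_fun game_fun.
Proof.
apply/forallP=> x; apply/forallP=> y; apply/implyP=> /forallP xy; rewrite !ffunE.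
apply/implyP; apply: (game_mono node_inj baseK node_head pt_inj J0 kappaJ kappam m0 r0 Jm
  cut_large Vtau target) => e a b; exact: (implyP (xy _)).
Qed.

Hypothesis node_neq : forall p p' e, node p e = node p' e -> p = p'.
Hypothesis kappa_gt1 : (1 < kappa)%N.
Hypothesis kappaD : (8 * D <= kappa)%N.
Hypothesis sparse : forall P, P != set0 -> (#|P| <= 2 * s)%N ->
  exists2 z, z \in P & (#|crowd node P z| < kappa)%N.
Hypothesis few_double : forall P : {set V}, (#|P| <= 2 * s)%N ->
  (#|[set e : E | [exists p, exists p', [&& p != p', node p e \in P & node p' e \in P]]]|
     <= D * #|P|)%N.
Hypothesis bigF : (3 * (256 * #|{: E}| ^ 2) ^ (16 * #|J|) <= #|F|)%N.
Hypothesis EF : (4 * #|{: E}| <= #|F|)%N.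

Lemma game_lower (c : circuit bits) :
  monotone_circuit c -> computes c game_fun -> (3 * s <= depth c + 2)%N.
Proof.
move=> mc /(monotone_circuit_form mc)[phi dphi ephi].
pose encx (x : config) : bits.-tuple bool := [tuple
  let: (e, a, b) := enum_val i in
  (side_val true x e true == a) && (side_val true x e false == b) | i < bits].
pose ency (y : config) : bits.-tuple bool := [tuple
  let: (e, a, b) := enum_val i in
  line beta e (side_val false y e true) (side_val false y e false) a b | i < bits].
have decx x e a b : decode (encx x) e a b =
    (side_val true x e true == a) && (side_val true x e false == b).
  by rewrite /decode tnth_mktuple enum_rankK.
have decy y e a b : decode (ency y) e a b =
    line beta e (side_val false y e true) (side_val false y e false) a b.
  by rewrite /decode tnth_mktuple enum_rankK.
have E0 : (0 < #|{: E}|)%N.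
  by rewrite card_prod muln_gt0 J0 andbT; apply/card_gt0P; exists 0.
apply: (@leq_trans (fdepth phi + 2)); last by rewrite leq_add2r.
apply: (@game_depth _ _ _ _ s D node base pt node_inj baseK node_neq pt_inj kappa_gt1 kappaD
  sparse few_double beta _ (fun i => (enum_val i).1.1) encx ency phi E0 bigF EF).
(* A variable that is true for Alice and false for Bob names Alice's own point at [e]. Its first
   coordinate is non-zero, so it can be off Bob's line only by missing the target. *)
- move=> i x y; rewrite !inE => /forallP x0 _; rewrite !tnth_mktuple /conflict /delta.
  case: (enum_val i) => [[e a] b] /= /andP[/eqP<- /eqP<-].
  by rewrite /line x0.
- move=> x _; rewrite ephi ffunE; apply: (game_fitsA node_inj baseK node_head pt_inj J0 kappaJ
    kappam m0 r0 Jm cut_large Vtau target (x := x)) => e.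
  by rewrite decx !eqxx.
- move=> y; rewrite inE ephi ffunE => /forallP y0.
  apply: (game_fitsB node_inj baseK node_head pt_inj J0 kappaJ kappam m0 r0 Jm cut_large
    Vtau target (y := y)) => e; split; first exact: y0.
  by apply/forallP=> q; rewrite decy implybb.
Qed.
End GameFunction.
End GameDepth.

(** * The choice of the sizes *)

Section Instance.
Import GRing.Theory.

Lemma injection_exists (T U : finType) : #|T| <= #|U| -> exists f : T -> U, injective f.
Proof.
move=> TU; exists (fun x => enum_val (widen_ord TU (enum_rank x))) => x y.
by move=> /enum_val_inj/(congr1 val)/= /val_inj/enum_rank_inj.
Qed.

Lemma sum_nzF (F : finFieldType) (g : F -> nat) :
  g 0%R = 0 -> \sum_a g a = \sum_(w : nzF F) g (val w).
Proof.
move=> g0; rewrite (bigID (fun a => a != 0%R)) /= [X in _ + X]big1 ?addn0; last first.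
  by move=> a /negPn/eqP->.
rewrite (reindex_omap (val : nzF F -> F) insub) => [|a a0]; last by rewrite insubT.
by apply: eq_bigl => w; rewrite valK eqxx andbT (valP w).
Qed.

Lemma card_nzF (F : finFieldType) : #|{: nzF F}| = #|F|.-1.
Proof. by rewrite card_sig -(cardC1 (0%R : F)); apply: eq_card. Qed.

Lemma nu_lam_bound l j : l < j -> 2 <= j ->
  (14 + 2 * l) * (6 * j) + (26 + 4 * l) + 4 <= 130 * j ^ 2.
Proof.
rewrite -mulnn => lj j2.
have h1 : l * j <= j * j by rewrite leq_mul2r ltnW ?orbT.
have h2 : j <= j * j by rewrite leq_pmulr //; lia.
have h3 : 4 <= j * j by apply: (leq_mul j2 j2).
rewrite mulnDl -!mulnA [2 * (l * _)](_ : _ = 12 * (l * j)); lia.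
Qed.

Lemma kappa_theta j : 0 < j -> 64 * j <= 4096 * j ^ 2.
Proof. rewrite -mulnn => j0; have h : j <= j * j by exact: leq_pmulr.
lia. Qed.

Lemma rounds_theta j : 0 < j -> 36 * j + 2 <= 4096 * j ^ 2.
Proof. rewrite -mulnn => j0; have h : j <= j * j by exact: leq_pmulr.
lia. Qed.

Lemma rounds_theta2 j y z : 6 * (6 * j) * y.+1 + 2 <= (36 * j + 2) * (y + z + 4).
Proof.
rewrite mulnDl; apply: leq_add; last by lia.
by rewrite mulnA leq_mul2l orbC; apply/orP; left; lia.
Qed.

Lemma theta_upper x y z : 0 < x -> y + 4 <= 130 * z -> 
  4 * (2 + 16 * x * (8 + 2 * y)) <= x * (128 * (256 * z)).
Proof.
move=> x0 yz; apply: (@leq_trans (x * (8 + 64 * (8 + 2 * y)))).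
  by rewrite mulnDr mulnDr; have : 4 * 2 <= x * 8; lia.
by rewrite leq_mul2l; apply/orP; right; lia.
Qed.

Lemma kappa_quarter j q : 0 < j -> 2 <= q -> 4 * (64 * j * q) <= 512 * j * (6 * j) * q.-1.
Proof.
move=> j0 q2; have -> : 512 * j * (6 * j) * q.-1 = 256 * j * (2 * q.-1) * (6 * j) by lia.
apply: leq_trans (leq_pmulr _ _); last by lia.
have -> : 4 * (64 * j * q) = 256 * j * q by lia.
by rewrite leq_mul2l; apply/orP; right; lia.
Qed.

Lemma leq_expn x y m n : 0 < y -> x <= y -> m <= n -> x ^ m <= y ^ n.
Proof.
move=> y0 xy mn; apply: (@leq_trans (y ^ m)); last exact: leq_pexp2l.
by case: m {mn} => // m; rewrite leq_exp2r.
Qed.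

Lemma depth_poly kappa r tau theta nu lam : 0 < theta -> nu <= theta -> lam <= theta ->
    kappa <= theta -> 6 * r * tau + 2 <= theta ->
  game_depth_bound kappa r tau theta nu lam <= 34 * theta ^ 3.
Proof.
move=> t0 nut lamt kt rt; have hR : rounds r tau <= theta by rewrite /rounds -addn2.
rewrite /game_depth_bound; move: (rounds r tau) hR => R hR.
have h1 : R * (theta * kappa + lam + 2) <= theta * (theta * theta + theta + 2).
  by apply: leq_mul => //; rewrite leq_add2r leq_add // leq_mul2l kt orbT.
have h2 : theta * kappa <= theta * theta by rewrite leq_mul2l kt orbT.
have h3 : (nu + lam) * (nu + lam + 2) <= (2 * theta) * (2 * theta + 2).
  by apply: leq_mul; rewrite ?leq_add2r mul2n -addnn leq_add.
have -> : theta ^ 3 = theta * (theta * theta) by rewrite !expnS expn0 muln1.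
have h4 : theta <= theta * theta by rewrite leq_pmulr.
have h5 : theta * theta <= theta * (theta * theta) by rewrite leq_mul2l h4 orbT.
move: h1 h2 h3 h4 h5 nut lamt t0; clear.
move: (R * (theta * kappa + lam + 2)) ((nu + lam) * (nu + lam + 2)) => x1 x3.
move: (theta * kappa) => x2; lia.
Qed.

Section Sizes.
Variable l : nat.
Hypothesis l0 : 0 < l.
(** [r = 6 * j] is required by [sparse_vertex], and [q = #|Fs|] must reach the [3 * K * r] points of
    the moment curve. [kappa] is [8 * D] for the [D = 8 * j * q] of [two_ports], and [K] gives
    [6 * kappa <= K * q]. [2 ^ lam] bounds [#|J|], [2 ^ nu] is [#|V|], and [theta] makes [2 ^ theta]
    exceed the bound on the label field required by [small_factor]. *)
Let j := 2 ^ l.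
Let q := 2 ^ (14 + 2 * l).
Let r := 6 * j.
Let K := 512 * j.
Let kappa := 64 * j * q.
Let nu := (14 + 2 * l) * r.
Let lam := 26 + 4 * l.
Let tau := nu.+1.
Let theta := 2 + 16 * 2 ^ lam * (8 + 2 * (nu + lam)).
Let s := 2 ^ (j - 2).

Let j2 : 2 <= j. Proof. by rewrite /j -[2]expn1 leq_exp2l. Qed.
Let lj : l < j. Proof. exact: ltn_expl. Qed.
Let qE : q = 128 * (128 * j ^ 2).
Proof. by rewrite /q /j -expnM (_ : 128 = 2 ^ 7) // -!expnD; congr (_ ^ _); lia. Qed.
Let lamE : 2 ^ lam = 4096 * j ^ 2 * q.
Proof.
rewrite /lam /q /j -expnM (_ : 4096 = 2 ^ 12) // -!expnD; congr (_ ^ _); lia.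
Qed.
Let s2 : 2 * s < 2 ^ j.
Proof. by rewrite /s -expnS ltn_exp2l //; lia. Qed.

Lemma theta_bounds : [/\ nu <= theta, lam <= theta, kappa <= theta,
  6 * r * tau + 2 <= theta & 4 * theta <= 2 ^ (42 + 6 * l)].
Proof.
have lam_gt : lam < 2 ^ lam by apply: ltn_expl.
have q0 : 0 < q by rewrite expn_gt0.
have big : 2 ^ lam * (nu + lam + 4) <= theta by rewrite /theta; move: (2 ^ lam) (nu + lam) => x y; clear; lia.
have lam1 : 0 < 2 ^ lam by rewrite expn_gt0.
have nul : nu + lam + 4 <= 130 * j ^ 2 by apply: nu_lam_bound.
have j0 : 0 < j by apply: ltnW.
split.
- by apply: leq_trans big; apply: leq_trans (leq_pmull _ lam1); rewrite -addnA leq_addr.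
- by apply: leq_trans big; apply: leq_trans (leq_pmull _ lam1); rewrite -addnA addnCA leq_addr.
- apply: leq_trans big; apply: (@leq_trans (2 ^ lam)); last by rewrite leq_pmulr // addn4.
  by rewrite lamE /kappa leq_mul2r kappa_theta ?orbT.
- apply: leq_trans big; apply: leq_trans (rounds_theta2 j nu lam) _.
  rewrite leq_mul2r; apply/orP; right; rewrite lamE.
  by apply: leq_trans (rounds_theta j0) _; rewrite leq_pmulr.
apply: (@leq_trans (2 ^ lam * (2 ^ 7 * (2 ^ 8 * j ^ 2)))); first exact: theta_upper.
rewrite /lam /j -expnM -!expnD leq_exp2l //; lia.
Qed.

(** The logarithm of the input length lies between [theta] and [4 * theta], hence is polynomial in
    [j], while [s] is exponential in [j]. *)
Lemma hard_function : exists n, exists f : boolfun n, [/\ monotone_fun f,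
    exists c : circuit n, [/\ depth c <= 34 * trunc_log 2 n ^ 3 + 6, computes c f
      & #|nonzero_gates c| <= 2],
    forall c : circuit n, monotone_circuit c -> computes c f -> 3 * s <= depth c + 2,
    trunc_log 2 n <= 2 ^ (42 + 6 * l) & l <= n].
Proof.
have [nut lamt kappat roundst theta3] := theta_bounds.
have theta0 : 0 < theta by rewrite /theta.
have j0 : 0 < j by apply: ltnW.
have [Fs _ cFs] := @pPrimePowerField 2 (14 + 2 * l) isT isT.
rewrite -/q in cFs.
have [F _ cF] := @pPrimePowerField 2 theta isT theta0.
pose I : finType := ('I_K * 'I_r)%type; pose J : finType := (I * nzF Fs)%type.
pose V := 'rV[Fs]_r.
have q2 : 2 <= q by rewrite /q -[2]expn1 leq_exp2l.
have cJ : #|J| = K * r * q.-1 by rewrite !card_prod !card_ord card_nzF cFs.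
have cV : #|{: V}| = 2 ^ nu by rewrite card_mx mul1n cFs /q -expnM.
have [|t t_inj] := @injection_exists (I * 'I_3)%type Fs.
  rewrite !card_prod !card_ord cFs qE /K /r -mulnn.
  by move: j => x; lia.
have cJlam : #|J| <= 2 ^ lam.
  rewrite cJ lamE; apply: leq_mul; last exact: leq_pred.
  by rewrite /K /r -mulnn; move: j => x; lia.
have thetaE : 2 ^ lam <= theta by rewrite /theta; move: (2 ^ lam) (nu + lam) => x y; clear; lia.
have lamth : lam.+1 <= theta by apply: leq_trans thetaE; apply: ltn_expl.
have [|pt pt_inj] := @injection_exists (J * bool)%type F.
  rewrite card_prod card_bool cF; apply: leq_trans (leq_mul cJlam (leqnn 2)) _.
  by rewrite mulnC -expnS leq_exp2l.
pose nd := node t : bool * bool -> V * J -> V.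
pose base (p : bool * bool) (z : V) (k : J) : V := (z - comb r t (pshift p k))%R.
pose st (a : bool) (k : J) : V := (val k.2 *: moment r (t (k.1, inord (if a then 2 else 0))))%R.
have node_inj' p x y k : nd p (x, k) = nd p (y, k) -> x = y by rewrite /nd /node => /addIr.
have baseK p z k : nd p (base p z k, k) = z by rewrite /nd /node /base /= subrK.
have node_head' a e : nd (a, false) e = (nd (a, true) e + st a e.2)%R by apply: node_head.
have r3 : 3 <= r by rewrite /r; lia.
have node_neq p p' e : nd p e = nd p' e -> p = p' by move/(node_inj t_inj); apply.
have q1 : 0 < q.-1 by lia.
have K0 : 0 < K by rewrite /K muln_gt0 j0.
have r0 : 0 < r by apply: leq_trans r3.
have J0 : 0 < #|J| by rewrite cJ (muln_gt0 (K * r)) q1 andbT (muln_gt0 K) K0 r0.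
have kappa_gt1 : 1 < kappa.
  rewrite /kappa; apply: leq_trans q2 _; rewrite leq_pmull // muln_gt0 j0 //.
have kappaJ : 4 * kappa <= #|J| by rewrite cJ; apply: kappa_quarter.
have kappam : 6 * kappa <= K * #|Fs|.
  by rewrite cFs /kappa /K -!mulnA; move: (j * q) => x; lia.
have Km : 0 < K * #|Fs| by rewrite cFs (muln_gt0 K) K0 ltnW.
have Jm : #|J| <= r * (K * #|Fs|).
  by rewrite cJ cFs mulnA [r * K]mulnC leq_mul2l leq_pred orbT.
have cutl a (Z : {set V}) :
    K * #|Fs| * (#|Z| * #|~: Z|) <= #|V| * \sum_k cut Z (st a k).
  pose t' (i : I) := t (i, inord (if a then 2 else 0)).
  have t'_inj : injective t' by move=> i i' /t_inj[].
  apply: leq_trans (expansion t'_inj Z) _; rewrite leq_mul2l; apply/orP; right.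
  rewrite -(pair_bigA _ (fun i w => cut Z (st a (i, w)))) /=.
  (* Cells have non-zero multipliers only; the zero multiplier in [expansion] has an empty cut. *)
  apply: leq_sum => i _; rewrite (sum_nzF (g := fun c => cut Z (c *: moment r (t' i))%R)) //.
  by rewrite scale0r cut0.
have Vtau : #|{: V}| < 2 ^ tau by rewrite cV ltn_exp2l.
have V0 : 0 < #|{: V}| by rewrite cV expn_gt0.
have kJ : 2 * kappa < #|J| by move: kappaJ kappa_gt1; clear; lia.
have [beta target] := target_exists nd pt kJ V0.
have cE : #|{: V * J}| <= 2 ^ (nu + lam) by rewrite card_prod cV expnD leq_mul.
have kappaD : 8 * (8 * j * #|Fs|) <= kappa by rewrite cFs /kappa !mulnA.
have small (P : {set V}) : #|P| <= 2 * s -> #|P| < 2 ^ j by move=> /leq_ltn_trans; apply.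
have sparse P : P != set0 -> #|P| <= 2 * s ->
    exists2 z, z \in P & #|crowd nd P z| < kappa.
  move=> P0 /small cP; have [z zP iz] := sparse_vertex t_inj (leqnn r) P0 cP.
  exists z => //; apply: leq_ltn_trans (card_crowded t zP) _.
  rewrite cFs; apply: (@leq_trans (4 * q * (2 * j))); last by rewrite /kappa; move: j q; clear; lia.
  by rewrite ltn_mul2l iz muln_gt0 /= ltnW.
have few (P : {set V}) : #|P| <= 2 * s -> #|[set e : V * J | [exists p, exists p',
    [&& p != p', nd p e \in P & nd p' e \in P]]]| <= 8 * j * #|Fs| * #|P|.
  move=> /small cP; exact: (two_ports t_inj (leqnn r) cP).
have bigF : 3 * (256 * #|{: V * J}| ^ 2) ^ (16 * #|J|) <= #|F|.
  rewrite cF /theta expnD; apply: leq_mul => //.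
  have base_le : 256 * #|{: V * J}| ^ 2 <= 2 ^ (8 + 2 * (nu + lam)).
    rewrite expnD; apply: leq_mul => //; rewrite [2 * (nu + lam)]mulnC expnM.
    by rewrite leq_exp2r.
  have -> : 2 ^ (16 * 2 ^ lam * (8 + 2 * (nu + lam))) =
            (2 ^ (8 + 2 * (nu + lam))) ^ (16 * 2 ^ lam) by rewrite -expnM mulnC.
  by apply: leq_expn base_le _; [rewrite expn_gt0|rewrite leq_mul2l cJlam orbT].
have EF : 4 * #|{: V * J}| <= #|F|.
  rewrite cF; apply: leq_trans (leq_mul (leqnn 4) cE) _.
  rewrite -(expnD 2 2) leq_exp2l // /theta leq_add2l.
  have : 0 < 2 ^ lam by rewrite expn_gt0.
  by move: (2 ^ lam) (nu + lam) => x y; clear; nia.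
have T_lo : theta <= trunc_log 2 (bits V J F).
  apply: trunc_log_max => //; rewrite /bits card_prod cF leq_pmull // card_prod.
  rewrite cF muln_gt0 expn_gt0 andbT card_prod muln_gt0 V0 J0 //.
have bits0 : 0 < bits V J F by rewrite lt0n; apply: contraTneq (leq_trans theta0 T_lo) => ->.
have T_hi : trunc_log 2 (bits V J F) <= 4 * theta.
  rewrite -(@leq_exp2l 2) //; apply: leq_trans (trunc_logP (isT : 1 < 2) bits0) _.
  rewrite /bits card_prod card_prod cF.
  apply: leq_trans (leq_mul (leq_mul cE (leqnn _)) (leqnn _)) _.
  by rewrite -!expnD leq_exp2l // (_ : 4 * theta = theta + theta + theta + theta);
    [rewrite !leq_add2r leq_add|lia].
exists (bits V J F), (game_fun kappa r tau base st pt beta).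
have mono : monotone_fun (game_fun kappa r tau base st pt beta).
  exact: (game_fun_monotone node_inj' baseK node_head' pt_inj J0 kappaJ kappam Km r0 Jm cutl Vtau target).
split=> //.
- have cVle : #|{: V}| <= 2 ^ nu by rewrite cV.
  have cFle : #|F| <= 2 ^ theta by rewrite cF.
  have [c [dc cc nc]] := game_circuit (theta := theta) (nu := nu) (lam := lam) cVle cJlam cFle mono.
  exists c; split=> //; apply: (leq_trans dc); rewrite leq_add2r.
  apply: (leq_trans (depth_poly theta0 nut lamt kappat roundst)).
  by rewrite leq_mul2l; apply/orP; right; apply: leq_expn (leq_trans theta0 T_lo) T_lo (leqnn 3).
- move=> c mc cc; exact: (game_lower node_inj' baseK node_head' pt_inj J0 kappaJ kappam Km r0 Jm
    cutl Vtau target node_neq kappa_gt1 kappaD sparse few bigF EF mc cc).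
- exact: leq_trans T_hi theta3.
apply: leq_trans (trunc_logP (isT : 1 < 2) bits0).
apply: leq_trans (ltnW (ltn_expl _ (isT : 1 < 2))) _; rewrite leq_exp2l //.
apply: leq_trans T_lo; apply: leq_trans lamth; rewrite /lam.
by move: l; clear; lia.
Qed.
End Sizes.
End Instance.

(** * The family *)

Lemma square_le_exp2 l : 10 <= l -> 8 * (l * l) <= 2 ^ l.
Proof.
elim: l => // l IH; rewrite leq_eqVlt => /orP[/eqP<-//|].
rewrite ltnS => l10; have {}IH := IH l10; rewrite expnS.
have h : 10 * l <= l * l by rewrite leq_mul2r l10 orbT.
have -> : l.+1 * l.+1 = l * l + 2 * l + 1 by lia.
by move: (2 ^ l) (l * l) IH h l10 => x y; lia.
Qed.

Definition shallow n (f : boolfun n) (c : circuit n) : Prop :=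
  [/\ depth c <= 34 * trunc_log 2 n ^ 3 + 6, computes c f & #|nonzero_gates c| <= 2].

Definition hard k n (f : boolfun n) : Prop := forall c : circuit n,
  monotone_circuit c -> computes c f -> k * trunc_log 2 n ^ k < depth c.

Definition good_size k n : Prop := exists f : boolfun n,
  [/\ monotone_fun f, exists c, shallow f c & hard k f].

Lemma good_sizes_unbounded k : exists2 n, k <= n & good_size k n.
Proof.
(* The shift makes [51 * l <= l * l], which absorbs the linear terms, so that [k + (42 + 6 * l) * k]
   stays below [8 * (l * l) - 2]. *)
pose l := k + 51.
have [|n [f [mf [c sc] lower logn ln]]] := @hard_function l; first by rewrite /l; lia.
exists n; first by apply: leq_trans ln; rewrite /l leq_addr.
exists f; split=> //; first by exists c.
move=> c' mc cc; have {}lower := lower c' mc cc.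
have l10 : 10 <= l by rewrite /l; lia.
have sq := square_le_exp2 l10.
have le1 : k * trunc_log 2 n ^ k <= 2 ^ (k + (42 + 6 * l) * k).
  rewrite expnD; apply: leq_mul; first by rewrite ltnW // ltn_expl.
  by rewrite expnM; case: (k) => // i; rewrite leq_exp2r.
have le2 : k + (42 + 6 * l) * k <= 2 ^ l - 2.
  have kl : k + 51 <= l by rewrite /l.
  have : k * l <= l * l by rewrite leq_mul2r; apply/orP; right; lia.
  have : 10 * l <= l * l by rewrite leq_mul2r l10 orbT.
  have : k + 51 <= l by [].
  have : 51 * l <= l * l by rewrite leq_mul2r; apply/orP; right; lia.
  move: sq; rewrite mulnDl -[6 * l * k]mulnA [l * k]mulnC.
  by move: (2 ^ l) (l * l) (k * l) => x y z; clear; lia.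
have le3 : 2 ^ (k + (42 + 6 * l) * k) <= 2 ^ (2 ^ l - 2) by rewrite leq_exp2l.
have e0 : 2 <= 2 ^ (2 ^ l - 2).
  rewrite -[X in X <= _]expn1 leq_exp2l //; move: sq l10.
  by move: (2 ^ l) => x; clear; nia.
have le4 := leq_trans le1 le3.
by move: le4 e0 lower; move: (2 ^ (2 ^ l - 2)) (k * _) => x y; lia.
Qed.

Lemma hard_anti k k' n (f : boolfun n) : k <= k' -> hard k' f -> hard k f.
Proof.
move=> kk hf c mc cc; apply: leq_ltn_trans (hf c mc cc).
case: (trunc_log 2 n) => [|T]; last by rewrite leq_mul // leq_pexp2l.
by case: k kk => [|k] _; rewrite ?mul0n // exp0n // muln0.
Qed.

(** [hard_function] serves only certain lengths, but the family needs a function at each. The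
    function for the largest good [k] up to [K] is hard for all smaller ones by [hard_anti]; a
    length with no such [k] gets a constant. *)
Lemma best_function n K : exists f : boolfun n, exists c : circuit n,
  [/\ monotone_fun f, shallow f c & forall k, k <= K -> good_size k n -> hard k f].
Proof.
have best k : good_size k n -> exists f : boolfun n, exists c : circuit n,
    [/\ monotone_fun f, shallow f c & forall k', k' <= k -> good_size k' n -> hard k' f].
  move=> [f [mf [c sc] hf]]; exists f, c; split=> // k' kk _; exact: hard_anti hf.
elim: K => [|K [f [c [mf sc hf]]]].
  have [/best//|ng] := classic (good_size 0 n).
  have mono : monotone_fun ([ffun=> false] : boolfun n).
    by apply/forallP=> x; apply/forallP=> y; rewrite !ffunE implybT.
  have [|||x|c [dc cc nc]] := @one_negation_circuit n [ffun=> false] MFalse MFalse MFalse 1 mono.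
  - by [].
  - by [].
  - by [].
  - by rewrite ffunE.
  exists [ffun=> false], c; split=> //; last by move=> k; rewrite leqn0 => /eqP-> /ng.
  split=> //; apply: leq_trans dc _; lia.
have [/best//|ng] := classic (good_size K.+1 n).
exists f, c; split=> // k; rewrite leq_eqVlt => /orP[/eqP-> /ng //|]; exact: hf.
Qed.

Theorem theorem9 :
  exists f : forall n : nat, boolfun n,
    [/\ forall n, monotone_fun (f n),
        ~ (exists c : forall n : nat, circuit n,
             [/\ polylog (fun n => depth (c n)),
                 forall n, monotone_circuit (c n)
               & forall n, computes (c n) (f n)])
      & exists c : forall n : nat, circuit n,
          [/\ polylog (fun n => depth (c n)),
              forall n, computes (c n) (f n)
            & forall n, #|nonzero_gates (c n)| <= 2]].
Proof.
pose f n := proj1_sig (constructive_indefinite_description _ (best_function n n)).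
have f_best n : exists c : circuit n, [/\ monotone_fun (f n), shallow (f n) c
    & forall k, k <= n -> good_size k n -> hard k (f n)].
  exact: proj2_sig (constructive_indefinite_description _ (best_function n n)).
pose c n := proj1_sig (constructive_indefinite_description _ (f_best n)).
have c_best n : [/\ monotone_fun (f n), shallow (f n) (c n)
    & forall k, k <= n -> good_size k n -> hard k (f n)].
  exact: proj2_sig (constructive_indefinite_description _ (f_best n)).
exists f; split=> [n||]; first by case: (c_best n).
- move=> [b [[a [e [n0 bound]]] mb cb]].
  (* [k] dominates the coefficient and the exponent of the assumed bound; [n0] puts [n] into its
     range and 2 makes the logarithm positive. *)
  pose k := a + e + n0 + 2.
  have [n kn gn] := good_sizes_unbounded k.
  have [_ _ /(_ k kn gn)/(_ (b n) (mb n) (cb n))] := c_best n.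
  have n0n : n0 <= n by apply: leq_trans kn; rewrite /k; lia.
  apply/negP; rewrite -leqNgt; apply: leq_trans (bound n n0n) _.
  have T0 : 0 < trunc_log 2 n.
    by apply: trunc_log_max => //; apply: leq_trans kn; rewrite /k expn1 leq_addl.
  by apply: leq_mul; [|apply: leq_pexp2l => //]; rewrite /k; lia.
exists c; split=> [|n|n]; last first.
- by case: (c_best n) => _ [].
- by case: (c_best n) => _ [].
(* From length 2 on the cube is at least 1 and absorbs the additive 6 into 34. *)
exists 40, 3, 2 => n n2; case: (c_best n) => _ [dc _ _] _; apply: leq_trans dc _.
have T0 : 0 < trunc_log 2 n by apply: trunc_log_max.
have T3 : 0 < trunc_log 2 n ^ 3 by rewrite expn_gt0 T0.
by move: (trunc_log 2 n ^ 3) T3 => x; lia.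
Qed.
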